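(* Fix $\alpha>0$. Let $\Psi,\Phi$ be entire functions with $\Psi\not\equiv0$ and $\Phi(z)=az+d$, $|a|\le1$, and suppose that $W^{(\alpha)}_{\Psi,\Phi}$ is a bounded complex symmetric weighted composition operator on $\mathcal F^2_\alpha$. Whenever $a\neq1$, set $p=d/(1-a)$. Then $$\sigma\bigl(W^{(\alpha)}_{\Psi,\Phi}\bigr)=\begin{cases}\{0,\Psi(d)\}, & a=0,\\ \Psi(0)e^{\alpha|d|^2/2}\,\mathbb T, & a=1,\ d\ne0,\\ \{\Psi(0)\}, & a=1,\ d=0,\\ \overline{\{\Psi(p)a^n:n\ge0\}}, & |a|=1,\ a\ne1,\\ \{0\}\cup\{\Psi(p)a^n:n\ge0\}, & 0<|a|<1,\end{cases}$$ where $\mathbb T$ denotes the unit circle.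
   Context: For $\alpha>0$, $\mathcal F^2_\alpha$ is the weighted Fock space of all entire functions $f$ on $\mathbb C$ with $\|f\|_\alpha^2=\frac\alpha\pi\int_{\mathbb C}|f(z)|^2e^{-\alpha|z|^2}\,dA(z)<\infty$ ($dA$ = area measure), a Hilbert space with the corresponding inner product. For entire $\Psi,\Phi$, $W^{(\alpha)}_{\Psi,\Phi}f=\Psi\cdot(f\circ\Phi)$. $\sigma(T)$ is the spectrum of $T$; the overline on a set denotes closure in $\mathbb C$. A conjugation on a complex Hilbert space $\mathbb H$ is an anti-linear map $C$ with $C^2=I$ and $\langle Cx,Cy\rangle=\langle y,x\rangle$ for all $x,y\in\mathbb H$. A bounded linear operator $T$ is complex symmetric if $T=CT^*C$ for some conjugation $C$. *)

(* Defs.v *)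
From HB Require Import structures.
From mathcomp Require Import all_boot all_order all_algebra.
From mathcomp Require Import complex ring lra.
From mathcomp Require Import all_classical all_reals all_analysis measurable_realfun.

Set Implicit Arguments.
Unset Strict Implicit.
Unset Printing Implicit Defensive.

Import Order.TTheory GRing.Theory Num.Theory.
Import numFieldNormedType.Exports.
Export numFieldNormedType.Exports.

Local Open Scope classical_set_scope.
Local Open Scope ring_scope.
Local Open Scope complex_scope.

(* The complex plane is [R[i]]; its topology and its structure of normed
   module over itself are carried by the alias [R[i]^o]. *)

Section OperatorTheory.
Context {R : realType} {V : lmodType R[i]}.
(* [dot] is an inner product, linear in its first argument. *)
Variable dot : V -> V -> R[i].

Definition hnorm (x : V) : R := Num.sqrt (complex.Re (dot x x)).

Definition bounded_op (T : V -> V) : Prop :=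
  linear T /\ exists M : R, forall x, hnorm (T x) <= M * hnorm x.

(* Bounded operators on a Hilbert space have exactly one adjoint, so it can be
   referred to by its defining relation. *)
Definition is_adjoint (T S : V -> V) : Prop :=
  bounded_op S /\ forall x y, dot (T x) y = dot x (S y).

Definition conjugation (J : V -> V) : Prop :=
  [/\ forall (c : R[i]) x y, J (c *: x + y) = c^* *: J x + J y,
      forall x, J (J x) = x &
      forall x y, dot (J x) (J y) = dot y x].

Definition complex_symmetric (T : V -> V) : Prop :=
  exists J S, [/\ conjugation J, is_adjoint T S & forall x, T x = J (S (J x))].

Definition spectrum (T : V -> V) : set R[i] :=
  [set l | ~ exists S, [/\ bounded_op S,
                         forall x, S (T x - l *: x) = x &
                         forall x, T (S x) - l *: S x = x]].

End OperatorTheory.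

Section Fock.
Context {R : realType}.
Implicit Types (alpha : R) (f g : R[i] -> R[i]^o).

Definition entire f : Prop :=
  forall z : R[i]^o, derivable (f : R[i]^o -> R[i]^o) z 1.

(* The area measure is the product Lebesgue measure on [R * R], a point [w] of
   which stands for the complex number [w.1 +i* w.2]. *)
Definition area := (@lebesgue_measure R \x @lebesgue_measure R)%E.

Definition toC (w : R * R) : R[i] := w.1 +i* w.2.

Definition cintegral (F : R[i] -> R[i]) : R[i] :=
  (\int[area]_w complex.Re (F (toC w))) +i*
  (\int[area]_w complex.Im (F (toC w))).

Definition gauss alpha (z : R[i]) : R := expR (- (alpha * Normc.normc z ^+ 2)).

(* The positive factor alpha / pi is irrelevant to finiteness. *)
Definition fock_pred alpha : {pred R[i] -> R[i]^o} :=
  mem [set f | entire f /\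
    (\int[area]_w (Normc.normc (f (toC w)) ^+ 2 * gauss alpha (toC w))%:E
      < +oo)%E].

Record fock alpha : Type :=
  Fock { fock_fun :> R[i] -> R[i]^o ; _ : fock_fun \in fock_pred alpha }.

HB.instance Definition _ alpha := [isSub for @fock_fun alpha].
HB.instance Definition _ alpha := [Choice of fock alpha by <:].

Lemma entireD f g : entire f -> entire g -> entire (f + g).
Proof. by move=> df dg z; exact: derivableD. Qed.

Lemma entireZ (c : R[i]) f : entire f -> entire (c *: f).
Proof. by move=> df z; exact: derivableZ. Qed.

Lemma entire_continuous f (z : R[i]) (e : R) : entire f -> 0 < e ->
  exists2 d : R, 0 < d &
    forall w, Normc.normc (w - z) < d -> Normc.normc (f w - f z) < e.
Proof.
move=> df e0.
have /derivable1_diffP/differentiable_continuous := df z.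
move=> /cvgrPdist_lt /(_ e%:C).
rewrite ltcR => /(_ e0) /nbhs_normP[] /= d d0 H.
have [dr di] : (0 < complex.Re d) /\ complex.Im d = 0.
  by move: d0; rewrite ltcE /= => /andP[/eqP -> ->].
exists (complex.Re d) => // w wd.
have := H w; rewrite /= distrC => H'.
have {}wd : `|w - z| < d.
  rewrite [d]complexE di mulr0 addr0.
  by rewrite [ltLHS](_ : _ = (Normc.normc (w - z))%:C) ?ltcR.
have := H' wd.
rewrite distrC [ltLHS](_ : _ = (Normc.normc (f w - f z))%:C) ?ltcR//.
Qed.

Lemma box_open_measurable (U : set (R * R)) :
  (forall w, U w -> exists2 e : R, 0 < e &
    forall v, `|v.1 - w.1| < e -> `|v.2 - w.2| < e -> U v) ->
  measurable U.
Proof.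
move=> oU.
pose box (p q r s : rat) : set (R * R) :=
  `]ratr p, ratr q[ `*` `]ratr r, ratr s[.
pose B p q r s := if `[< box p q r s `<=` U >] then box p q r s else set0.
have -> : U = \bigcup_p \bigcup_q \bigcup_r \bigcup_s B p q r s.
  apply/seteqP; split=> [w /oU[e e0 He]|w]; last first.
    move=> [p _ [q _ [r _ [s _]]]]; rewrite /B.
    by case: ifPn => // /asboolP; exact.
  have ex (x : R) : exists p q : rat,
      [/\ x - e < ratr p, ratr p < x, x < ratr q & ratr q < x + e].
    have /rat_in_itvoo[p] : x - e < x by rewrite ltrBlDr ltrDl.
    rewrite in_itv/= => /andP[p1 p2].
    have /rat_in_itvoo[q] : x < x + e by rewrite ltrDl.
    by rewrite in_itv/= => /andP[q1 q2]; exists p, q.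
  have [p [q [p1 p2 q1 q2]]] := ex w.1.
  have [r [s [r1 r2 s1 s2]]] := ex w.2.
  exists p => //; exists q => //; exists r => //; exists s => //.
  rewrite /B ifT; last first.
    apply/asboolP => v [] /=; rewrite !in_itv/= => /andP[a1 a2] /andP[b1 b2].
    by apply: He; rewrite ltr_distl; apply/andP; split;
      [exact: lt_trans a1|exact: lt_trans q2|exact: lt_trans b1|
       exact: lt_trans s2].
  by split; rewrite /= in_itv/= ?p2 ?r2.
do 4! (apply: bigcupT_measurable_rat => ?).
rewrite /B; case: ifPn => // _.
by apply: measurableX; exact: measurable_itv.
Qed.

Lemma normc_toR (z : R[i]) : `|z| = (Normc.normc z)%:C. Proof. by []. Qed.

Lemma measurable_normc f : entire f ->
  measurable_fun [set: R * R] (fun w => Normc.normc (f (toC w))).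
Proof.
move=> ef mD; apply: (measurability _ (RGenOInfty.measurableE R)) => //.
move=> /= _ [_ [a ->] <-]; rewrite setTI.
apply: box_open_measurable => w /=; rewrite in_itv/= andbT => aw.
have [|d d0 H] := entire_continuous (toC w) ef (e := Normc.normc (f (toC w)) - a).
  by rewrite subr_gt0.
have d20 : 0 < d / 2 by rewrite divr_gt0.
exists (d / 2) => // v v1 v2; rewrite in_itv/= andbT.
have : Normc.normc (toC v - toC w) < d.
  rewrite -ltcR -normc_toR.
  have -> : toC v - toC w = (v.1 - w.1)%:C + 'i * (v.2 - w.2)%:C.
    by apply/eqP; rewrite eq_complex /=; apply/andP; split; apply/eqP; ring.
  apply: le_lt_trans (ler_normD _ _) _.
  have -> : d%:C = (d / 2)%:C + (d / 2)%:C by rewrite -rmorphD -splitr.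
  have nR (x : R) : `|x%:C| = `|x|%:C.
    by rewrite normc_toR /= expr0n addr0 sqrtr_sqr.
  rewrite normrM !nR.
  have -> : `|'i : R[i]| = 1 by rewrite normc_toR /= expr0n add0r expr1n sqrtr1.
  by rewrite mul1r ltrD ?ltcR.
move=> /H fd.
suff : Normc.normc (f (toC w)) - Normc.normc (f (toC v)) <=
    Normc.normc (f (toC v) - f (toC w)).
  by move: fd => /[swap] /le_lt_trans /[apply]; rewrite ltrD2l ltrN2.
rewrite -lecR rmorphB -!normc_toR distrC.
exact: (lerB_dist (f (toC w) : R[i]) (f (toC v) : R[i])).
Qed.

Lemma entire_id : entire (id : R[i] -> R[i]^o).
Proof. by move=> z; exact: derivable_id. Qed.

Lemma measurable_fock_integrand alpha f : entire f ->
  measurable_fun [set: R * R]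
    (fun w => (Normc.normc (f (toC w)) ^+ 2 * gauss alpha (toC w))%:E).
Proof.
move=> ef; apply/measurable_EFinP/measurable_funM.
  by apply: measurable_funX; exact: measurable_normc.
apply: measurableT_comp => //; apply: measurableT_comp => //.
apply: measurable_funM => //.
by apply: measurable_funX; exact: (measurable_normc entire_id).
Qed.

Lemma normcD_sqr (x y : R[i]) : Normc.normc (x + y) ^+ 2 <=
  2 * Normc.normc x ^+ 2 + 2 * Normc.normc y ^+ 2.
Proof.
case: x y => [a b] [c d] /=; rewrite !sqr_sqrtr ?addr_ge0 ?sqr_ge0//.
have := sqr_ge0 (a - c); have := sqr_ge0 (b - d); lra.
Qed.

Lemma fock_submod_closed alpha : submod_closed (fock_pred alpha).
Proof.
have ge0 h w : (0 <= (Normc.normc (h (toC w)) ^+ 2 * gauss alpha (toC w))%:E)%E.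
  by rewrite lee_fin mulr_ge0 ?sqr_ge0 ?expR_ge0.
split.
  rewrite inE/=; split; first by move=> z; exact: derivable_cst.
  rewrite integral0_eq ?ltry// => w _.
  by rewrite !expr0n addr0 sqrtr0 expr0n mul0r.
move=> c f g; rewrite !inE/= => -[ef If] [eg Ig].
have efg := entireD (entireZ (c := c) ef) eg.
split; first exact: efg.
pose k := 2 * Normc.normc c ^+ 2.
have k0 : 0 <= k by rewrite mulr_ge0 ?sqr_ge0.
have mf := measurable_fock_integrand alpha ef.
have mg := measurable_fock_integrand alpha eg.
set F := fun w => (Normc.normc (f (toC w)) ^+ 2 * gauss alpha (toC w))%:E.
set G := fun w => (Normc.normc (g (toC w)) ^+ 2 * gauss alpha (toC w))%:E.
apply: (@le_lt_trans _ _ (\int[area]_w (k%:E * F w + 2%:E * G w))%E).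
  apply: ge0_le_integral => //.
  - exact: measurable_fock_integrand.
  - by apply: emeasurable_funD; exact: measurable_funeM.
  move=> w _; rewrite -!EFinM -EFinD lee_fin !mulrA -mulrDl.
  rewrite ler_wpM2r ?expR_ge0//.
  apply: le_trans (normcD_sqr _ _) _.
  apply: lerD; rewrite -[leRHS]mulrA -expr2 //.
  by rewrite /k -mulrA -exprMn -Normc.normcM.
rewrite ge0_integralD//; last 4 first.
- by move=> w _; rewrite mule_ge0 ?ge0.
- exact: measurable_funeM.
- by move=> w _; rewrite mule_ge0 ?ge0.
- exact: measurable_funeM.
have F0 w : [set: R * R] w -> (0 <= F w)%E by move=> _; exact: ge0.
have G0 w : [set: R * R] w -> (0 <= G w)%E by move=> _; exact: ge0.
rewrite !ge0_integralZl_EFin//.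
by apply: lte_add_pinfty; apply: lte_mul_pinfty.
Qed.

HB.instance Definition _ alpha :=
  GRing.isSubmodClosed.Build _ _ (fock_pred alpha) (fock_submod_closed alpha).
HB.instance Definition _ alpha :=
  [SubChoice_isSubLmodule of fock alpha by <:].

Definition fock_dot alpha (f g : fock alpha) : R[i] :=
  (alpha / pi)%:C *
  cintegral (fun z => f z * (g z)^* * (gauss alpha z)%:C).

(* A map [W : fock alpha -> fock alpha] satisfying this exists iff
   [Psi * (f \o Phi)] lies in [fock alpha] for all [f], and is then unique. *)
Definition is_weighted_composition alpha (Psi Phi : R[i] -> R[i])
    (W : fock alpha -> fock alpha) : Prop :=
  forall (f : fock alpha) z, W f z = Psi z * f (Phi z).

End Fock.

Arguments fock_dot {R} alpha f g.

(* Main.v *)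
Require Import Defs.
From mathcomp Require Import all_boot all_order all_algebra.
From mathcomp Require Import complex ring lra.
From mathcomp Require Import all_classical all_reals all_analysis measurable_realfun.

Set Implicit Arguments.
Unset Strict Implicit.
Unset Printing Implicit Defensive.

Import Order.TTheory GRing.Theory Num.Theory.
Import numFieldNormedType.Exports.

Local Open Scope classical_set_scope.
Local Open Scope ring_scope.
Local Open Scope complex_scope.

(* The kernels [K_w z = exp (alpha w^* z)] reproduce the Fock space by the
   Gaussian mean value property, the adjoint sends [K_w] to a multiple of
   [K_(Phi w)], and complex symmetry [W = J W^* J] transfers this to [J K_w].

   If [a = 0], then [W] has rank one. If [|a| = 1], boundedness of [W^*] on
   kernels and Liouville's theorem force [Psi z = Psi 0 exp (- alpha a d^* z)],
   so [W] is a positive multiple [rho] of a unitary operator. When [a <> 1] the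
   orthogonal basis [(z - p)^n K_p] diagonalizes [W]. When [a = 1] and [d <> 0],
   a Neumann series confines the spectrum to the circle of radius [rho], and
   every point of it is an approximate eigenvalue.

   If [0 < |a| < 1], then [g = J K_p] satisfies [Psi z g (Phi z) = Psi p g z],
   and comparing the functions [J K_w] at the orbit of [Phi] shows that [g] has
   no zeros.  By Hadamard's theorem [g] is the exponential of a quadratic
   polynomial, whose leading coefficient is [< alpha / 2] in modulus because [g]
   lies in the Fock space.  Hence [(z - p)^n g] are eigenvectors, and since
   [W^N f = (Psi p)^N g . (f / g) o Phi^N], the Taylor coefficients of [f / g] at
   [p] give an explicit operator [Q] with [(W - l) Q = Q (W - l) = W^N] for large
   [N], from which the resolvent at [l <> 0] outside the orbit is recovered.  *)

(** * Complex norm and derivatives *)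

(** The complex analysis is extracted from the Fock spaces themselves. Goursat's bisection yields
    the Gaussian mean value property, hence the reproducing formula, which can be differentiated in
    [w] under the integral. Taylor series, the identity theorem, Cauchy estimates and Liouville's
    theorem then follow by placing a function in a Fock space whose weight is chosen for the
    purpose. Limits are taken pointwise: [fock_lim] returns them to the space with a norm bound and
    plays the part of completeness. For [0 < |a| < 1] the obstacle is that dividing by [g] costs
    growth: [f / g] is only known to be [O(exp (3 al / 2 |z|^2))], so a series obtained from its
    Taylor coefficients need not land in the space after multiplication by [g]. Passing to [W^N]
    contracts the argument by [a^N] and scales the exponent by [|a|^(2N)], which for large [N] fits
    between the exponent of [g] and [al / 2]. This is why the leading coefficient of [log g] must be
    strictly below [al / 2], and why the resolvent is reached through a quasi-inverse of order
    [N]. *)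

Notation nrm := Normc.normc.
(* Inside products [_^*] parses as the conjugation of closed fields, which is
   only convertible to [conjc]. *)
Notation cj := conjc.

Section ComplexNorm.
Context {R : realType}.
Implicit Types (z w : R[i]) (x y : R).

Lemma nrmE z : (nrm z)%:C = `|z|. Proof. by []. Qed.

Lemma nrm_ge0 z : 0 <= nrm z.
Proof. by rewrite -lecR nrmE; exact: (@normr_ge0 R[i] R[i]). Qed.

Lemma nrm0 : nrm (0 : R[i]) = 0. Proof. exact: Normc.normc0. Qed.

Lemma nrm1 : nrm (1 : R[i]) = 1. Proof. exact: Normc.normc1. Qed.

Lemma nrmM z w : nrm (z * w) = nrm z * nrm w. Proof. exact: Normc.normcM. Qed.

Lemma nrmV z : nrm z^-1 = (nrm z)^-1. Proof. exact: Normc.normcV. Qed.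

Lemma nrmN z : nrm (- z) = nrm z. Proof. exact: normcN. Qed.

Lemma nrmD z w : nrm (z + w) <= nrm z + nrm w. Proof. exact: le_normcD. Qed.

Lemma nrmB z w : nrm (z - w) <= nrm z + nrm w.
Proof. by rewrite -(nrmN w); exact: nrmD. Qed.

Lemma nrm_distC z w : nrm (z - w) = nrm (w - z).
Proof. by rewrite -nrmN opprB. Qed.

Lemma nrmBD u z w : nrm (z - w) <= nrm (z - u) + nrm (u - w).
Proof. by rewrite [z - w](_ : _ = (z - u) + (u - w)) ?nrmD//; ring. Qed.

Lemma nrm_eq0 z : (nrm z == 0) = (z == 0).
Proof. by apply/eqP/eqP => [/Normc.eq0_normc//|->]; exact: nrm0. Qed.

Lemma nrm_gt0 z : (0 < nrm z) = (z != 0).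
Proof. by rewrite lt_neqAle nrm_ge0 andbT eq_sym nrm_eq0. Qed.

Lemma nrmX z n : nrm (z ^+ n) = nrm z ^+ n.
Proof. by elim: n => [|n IH]; rewrite ?nrm1// !exprS nrmM IH. Qed.

Lemma nrmR x : nrm x%:C = `|x|.
Proof. by rewrite /= expr0n addr0 sqrtr_sqr. Qed.

Lemma nrmJ z : nrm (cj z) = nrm z.
Proof. by case: z => a b /=; rewrite sqrrN. Qed.

Lemma nrm_sum (I : Type) (r : seq I) (P : pred I) (F : I -> R[i]) :
  nrm (\sum_(i <- r | P i) F i) <= \sum_(i <- r | P i) nrm (F i).
Proof.
elim/big_rec2: _ => [|i y z _ h]; first by rewrite nrm0.
by apply: le_trans (nrmD _ _) _; rewrite lerD2l.
Qed.

Lemma nrm_sqr z : nrm z ^+ 2 = complex.Re z ^+ 2 + complex.Im z ^+ 2.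
Proof. by case: z => a b /=; rewrite sqr_sqrtr// addr_ge0 ?sqr_ge0. Qed.

Lemma mulcJ z : z * cj z = (nrm z ^+ 2)%:C.
Proof.
rewrite nrm_sqr; case: z => a b; apply/eqP; rewrite eq_complex /=.
by apply/andP; split; apply/eqP; ring.
Qed.

Lemma Re_le z : `|complex.Re z| <= nrm z.
Proof.
rewrite -(@ler_pXn2r _ 2) ?nnegrE ?nrm_ge0// nrm_sqr real_normK ?num_real//.
by rewrite lerDl sqr_ge0.
Qed.

Lemma Im_le z : `|complex.Im z| <= nrm z.
Proof.
rewrite -(@ler_pXn2r _ 2) ?nnegrE ?nrm_ge0// nrm_sqr real_normK ?num_real//.
by rewrite lerDr sqr_ge0.
Qed.

Lemma nrm_le z : nrm z <= `|complex.Re z| + `|complex.Im z|.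
Proof.
rewrite -(@ler_pXn2r _ 2) ?nnegrE ?nrm_ge0 ?addr_ge0// nrm_sqr sqrrD.
rewrite !real_normK ?num_real// addrAC lerDl mulrn_wge0//.
Qed.

Lemma complexDE (a b : R) : a +i* b = a%:C + 'i * b%:C.
Proof. by rewrite [LHS]complexE. Qed.

Lemma cReD z w : complex.Re (z + w) = complex.Re z + complex.Re w.
Proof. by case: z w => a b []. Qed.
Lemma cImD z w : complex.Im (z + w) = complex.Im z + complex.Im w.
Proof. by case: z w => a b []. Qed.
Lemma cReN z : complex.Re (- z) = - complex.Re z.
Proof. by case: z. Qed.
Lemma cImN z : complex.Im (- z) = - complex.Im z.
Proof. by case: z. Qed.
Lemma cReM z w : complex.Re (z * w) =
  complex.Re z * complex.Re w - complex.Im z * complex.Im w.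
Proof. by case: z w => a b []. Qed.
Lemma cImM z w : complex.Im (z * w) =
  complex.Re z * complex.Im w + complex.Im z * complex.Re w.
Proof. by case: z w => a b []. Qed.
Lemma cReMr z x : complex.Re (z * x%:C) = complex.Re z * x.
Proof. by case: z => a b /=; rewrite mulr0 subr0. Qed.
Lemma cReJ z : complex.Re (cj z) = complex.Re z. Proof. by case: z. Qed.
Lemma cImJ z : complex.Im (cj z) = - complex.Im z. Proof. by case: z. Qed.

Lemma complexP z w : complex.Re z = complex.Re w ->
  complex.Im z = complex.Im w -> z = w.
Proof. by case: z w => a b [c d] /= -> ->. Qed.

Lemma RCD x y : (x + y)%:C = x%:C + y%:C :> R[i]. Proof. exact: rmorphD. Qed.
Lemma RCB x y : (x - y)%:C = x%:C - y%:C :> R[i]. Proof. exact: rmorphB. Qed.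
Lemma RCN x : (- x)%:C = - x%:C :> R[i]. Proof. exact: rmorphN. Qed.
Lemma RCM x y : (x * y)%:C = x%:C * y%:C :> R[i]. Proof. exact: rmorphM. Qed.
Lemma RCX x n : (x ^+ n)%:C = x%:C ^+ n :> R[i]. Proof. exact: rmorphXn. Qed.
Lemma RCV x : (x^-1)%:C = x%:C^-1 :> R[i]. Proof. exact: fmorphV. Qed.

Lemma conjC_D z w : cj (z + w) = cj z + cj w. Proof. exact: rmorphD. Qed.
Lemma conjC_B z w : cj (z - w) = cj z - cj w. Proof. exact: rmorphB. Qed.
Lemma conjC_M z w : cj (z * w) = cj z * cj w. Proof. exact: rmorphM. Qed.
Lemma conjC_X z n : cj (z ^+ n) = cj z ^+ n. Proof. exact: rmorphXn. Qed.
Lemma conjC_K z : cj (cj z) = z. Proof. exact: conjcK. Qed.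
Lemma conjC_R x : cj x%:C = x%:C. Proof. exact: conjc_real. Qed.

Lemma normcE_nrm z (x : R) : (`|z| = x%:C) <-> (nrm z = x).
Proof. by rewrite -nrmE; split => [/complexI|->]. Qed.

End ComplexNorm.

Arguments Normc.normc : simpl never.

(** * Pointwise continuity and Wirtinger derivatives *)

Section Continuity.
Context {R : realType}.
Implicit Types (f g : R[i] -> R[i]) (z w h : R[i]).

Definition ccont f z : Prop := forall e : R, 0 < e -> exists2 d : R, 0 < d &
  forall w, nrm (w - z) < d -> nrm (f w - f z) < e.

Lemma ltC0 (e : R[i]) : 0 < e -> exists2 r : R, 0 < r & e = r%:C.
Proof.
rewrite ltcE /= => /andP[/eqP e0 e1]; exists (complex.Re e) => //.
by apply: complexP; rewrite ?e0.
Qed.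

Lemma ccont_cst c z : ccont (fun=> c) z.
Proof. by move=> e e0; exists 1 => // w _; rewrite subrr nrm0. Qed.

Lemma ccont_id z : ccont id z.
Proof. by move=> e e0; exists e. Qed.

Lemma ccontD f g z : ccont f z -> ccont g z -> ccont (fun w => f w + g w) z.
Proof.
move=> cf cg e e0.
have e2 : 0 < e / 2 by rewrite divr_gt0.
have [d d0 Hd] := cf _ e2; have [d' d'0 Hd'] := cg _ e2.
exists (Num.min d d'); first by rewrite lt_min d0.
move=> w; rewrite lt_min => /andP[/Hd h1 /Hd' h2]; cbv beta.
rewrite [X in nrm X](_ : _ = (f w - f z) + (g w - g z)); last by ring.
by apply: le_lt_trans (nrmD _ _) _; rewrite [e]splitr ltrD.
Qed.

Lemma ccontN f z : ccont f z -> ccont (fun w => - f w) z.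
Proof.
move=> cf e /cf[d d0 H]; exists d => // w /H; cbv beta.
by rewrite [X in _ -> nrm X < _](_ : _ = - (f w - f z)) ?nrmN//; ring.
Qed.

Lemma ccontB f g z : ccont f z -> ccont g z -> ccont (fun w => f w - g w) z.
Proof. by move=> cf cg; exact: ccontD cf (ccontN cg). Qed.

Lemma ccontM f g z : ccont f z -> ccont g z -> ccont (fun w => f w * g w) z.
Proof.
move=> cf cg e e0.
pose K := nrm (f z) + nrm (g z) + 1.
have K1 : 1 <= K by rewrite lerDr addr_ge0 ?nrm_ge0.
have K0 : 0 < K by apply: lt_le_trans K1.
pose r := Num.min 1 (e / (2 * K)).
have r0 : 0 < r by rewrite lt_min ltr01 divr_gt0// mulr_gt0.
have [d d0 Hd] := cf _ r0; have [d' d'0 Hd'] := cg _ r0.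
exists (Num.min d d'); first by rewrite lt_min d0.
move=> w; rewrite lt_min => /andP[/Hd h1 /Hd' h2]; cbv beta.
rewrite [X in nrm X](_ : _ = (f w - f z) * (g w - g z) + (f w - f z) * g z +
  f z * (g w - g z)); last by ring.
apply: le_lt_trans (nrmD _ _) _; apply: le_lt_trans (lerD (nrmD _ _) (lexx _)) _.
rewrite !nrmM.
have r1 : r <= 1 by rewrite ge_min lexx.
have rK : r * (2 * K) <= e.
  by rewrite -ler_pdivlMr ?mulr_gt0// ge_min lexx orbT.
move: h1 h2 K1 r1 rK r0 (nrm_ge0 (f w - f z)) (nrm_ge0 (g w - g z)).
have := nrm_ge0 (f z); have := nrm_ge0 (g z); rewrite /K.
move: (nrm (f w - f z)) (nrm (g w - g z)) (nrm (f z)) (nrm (g z)) (r).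
by move=> a b c d1 t; nra.
Qed.

Lemma ccont_comp f g z : ccont f z -> ccont g (f z) -> ccont (fun w => g (f w)) z.
Proof.
move=> cf cg e /cg[d /cf[d' d'0 H'] H].
by exists d' => // w /H' /H.
Qed.

Lemma ccontX f z n : ccont f z -> ccont (fun w => f w ^+ n) z.
Proof.
elim: n => [|n IH] cf; first exact: ccont_cst.
rewrite (_ : (fun _ => _) = fun w => f w * f w ^+ n); last by apply/funext=> w; rewrite exprS.
exact: ccontM cf (IH cf).
Qed.

Lemma ccontJ f z : ccont f z -> ccont (fun w => cj (f w)) z.
Proof.
move=> cf e /cf[d d0 H]; exists d => // w /H; cbv beta.
by rewrite -conjC_B nrmJ.
Qed.

Lemma ccont_Re (p : R -> R) z : {for complex.Re z, continuous p} ->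
  ccont (fun w => (p (complex.Re w))%:C) z.
Proof.
move=> /cvgrPdist_lt cp e /cp /nbhs_normP[d /= d0 H].
exists d => // w wd; cbv beta. rewrite -RCB nrmR distrC; apply: H => /=.
by rewrite distrC -cReN -cReD; apply: le_lt_trans wd; exact: Re_le.
Qed.

Lemma ccont_real f (p : R -> R) z : {for complex.Re (f z), continuous p} ->
  ccont f z -> ccont (fun w => (p (complex.Re (f w)))%:C) z.
Proof. by move=> cp cf; exact: ccont_comp cf (ccont_Re cp). Qed.

Lemma ccont_Im f z : ccont f z -> ccont (fun w => (complex.Im (f w))%:C) z.
Proof.
move=> cf e /cf[d d0 H]; exists d => // w /H; cbv beta.
by rewrite -RCB nrmR -cImN -cImD; apply: le_lt_trans; exact: Im_le.
Qed.

Lemma ccont_nrm f z : ccont f z -> ccont (fun w => (nrm (f w))%:C) z.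
Proof.
move=> cf e /cf[d d0 H]; exists d => // w /H; cbv beta.
rewrite -RCB nrmR; apply: le_lt_trans.
have a := nrmD (f w - f z) (f z); have b := nrmD (f z - f w) (f w).
move: a b; rewrite !subrK (nrm_distC (f z)) ler_norml => a b.
by apply/andP; split; lra.
Qed.

(* Real differentiability in Caratheodory form; [A] and [B] are the Wirtinger
   derivatives of [f] at [z]. *)
Definition rdiff f z (A B : R[i]) : Prop := exists p q : R[i] -> R[i],
  [/\ forall h, f (z + h) - f z = p h * h + q h * cj h,
      ccont p 0, ccont q 0, p 0 = A & q 0 = B].

Lemma rdiff_cst c z : rdiff (fun=> c) z 0 0.
Proof.
exists (fun=> 0), (fun=> 0); split => //; [|exact: ccont_cst|exact: ccont_cst].
by move=> h; cbv beta; rewrite subrr !mul0r addr0.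
Qed.

Lemma rdiff_id z : rdiff id z 1 0.
Proof.
exists (fun=> 1), (fun=> 0); split => //; [|exact: ccont_cst|exact: ccont_cst].
by move=> h; cbv beta; rewrite addrAC subrr; ring.
Qed.

Lemma rdiffD f g z A B A' B' : rdiff f z A B -> rdiff g z A' B' ->
  rdiff (fun w => f w + g w) z (A + A') (B + B').
Proof.
move=> [p [q [e cp cq <- <-]]] [p' [q' [e' cp' cq' <- <-]]].
exists (fun h => p h + p' h), (fun h => q h + q' h).
split=> //; [|exact: ccontD|exact: ccontD].
move=> h; cbv beta.
rewrite [LHS](_ : _ = (f (z + h) - f z) + (g (z + h) - g z)); last by ring.
by rewrite e e'; ring.
Qed.

Lemma rdiffM f g z A B A' B' : rdiff f z A B -> rdiff g z A' B' ->
  rdiff (fun w => f w * g w) z (A * g z + f z * A') (B * g z + f z * B').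
Proof.
move=> [p [q [e cp cq <- <-]]] [p' [q' [e' cp' cq' <- <-]]].
have cf : ccont (fun h => f (z + h)) 0.
  rewrite (_ : (fun _ => _) = fun h => f z + (p h * h + q h * cj h)).
    apply: ccontD; first exact: ccont_cst.
    apply: ccontD; apply: ccontM => //; first exact: ccont_id.
    exact: ccontJ (ccont_id _).
  by apply/funext => h; rewrite -e; ring.
exists (fun h => p h * g z + f (z + h) * p' h),
  (fun h => q h * g z + f (z + h) * q' h).
have c1 (a b : R[i] -> R[i]) : ccont a 0 -> ccont b 0 ->
    ccont (fun h => a h * g z + f (z + h) * b h) 0.
  move=> ca cb; apply: ccontD; apply: ccontM => //; exact: ccont_cst.
split; [|exact: c1|exact: c1|by rewrite addr0|by rewrite addr0].
move=> h; cbv beta.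
rewrite [LHS](_ : _ = (f (z + h) - f z) * g z + f (z + h) * (g (z + h) - g z)); last by ring.
by rewrite e e'; ring.
Qed.

Lemma rdiffJ f z A B : rdiff f z A B -> rdiff (fun w => cj (f w)) z (cj B) (cj A).
Proof.
move=> [p [q [e cp cq <- <-]]].
exists (fun h => cj (q h)), (fun h => cj (p h)); split => //; [|exact: ccontJ|exact: ccontJ].
by move=> h; cbv beta; rewrite -conjC_B e conjC_D !conjC_M conjC_K addrC.
Qed.

Lemma rdiff_cont f z A B : rdiff f z A B -> ccont f z.
Proof.
move=> [p [q [e cp cq _ _]]].
have : ccont (fun h => f z + (p h * h + q h * cj h)) 0.
  apply: ccontD; first exact: ccont_cst.
  apply: ccontD; apply: ccontM => //; first exact: ccont_id.
  exact: ccontJ (ccont_id _).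
move=> c eps /c[d d0 H]; exists d => // w wd.
have := H (w - z); rewrite subr0 => /(_ wd).
rewrite -!e addr0 subrr addr0 [z + _](_ : _ = w); last by ring.
by rewrite [f z + _](_ : _ = f w)//; ring.
Qed.

(** The slopes of [g] are evaluated at the increment [k h] of [f], which is continuous with
    [k 0 = 0]; conjugating [k h] is what brings in [cj A] and [cj B]. *)
Lemma rdiff_comp f g z A B A' B' : rdiff f z A B -> rdiff g (f z) A' B' ->
  rdiff (fun w => g (f w)) z (A' * A + B' * cj B) (A' * B + B' * cj A).
Proof.
move=> [p [q [e cp cq <- <-]]] [p' [q' [e' cp' cq' <- <-]]].
pose k h := f (z + h) - f z.
have ck : ccont k 0.
  rewrite (_ : k = fun h => (p h * h + q h * cj h)).
    apply: ccontD; apply: ccontM => //; first exact: ccont_id.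
    exact: ccontJ (ccont_id _).
  by apply/funext => h; rewrite /k -e.
have k0 : k 0 = 0 by rewrite /k addr0 subrr.
have c1 (a : R[i] -> R[i]) : ccont a 0 -> ccont (fun h => a (k h)) 0.
  by move=> ca; apply: (ccont_comp ck); rewrite k0.
exists (fun h => p' (k h) * p h + q' (k h) * cj (q h)),
  (fun h => p' (k h) * q h + q' (k h) * cj (p h)).
split; [| | |by rewrite k0|by rewrite k0].
- move=> h; cbv beta; rewrite [f (z + h)](_ : _ = f z + k h); last by rewrite /k; ring.
  by rewrite e' {2 4}/k e conjC_D !conjC_M conjC_K; ring.
- by apply: ccontD; apply: ccontM => //; [exact: c1|exact: c1|exact: ccontJ].
- by apply: ccontD; apply: ccontM => //; [exact: c1|exact: c1|exact: ccontJ].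
Qed.

Lemma rdiff_eq f z A B A' B' : A = A' -> B = B' -> rdiff f z A B -> rdiff f z A' B'.
Proof. by move=> -> ->. Qed.

Lemma rdiff_shift f z w A B : rdiff f (z + w) A B -> rdiff (fun x => f (x + w)) z A B.
Proof.
move=> H; have h := rdiffD (rdiff_id z) (rdiff_cst w z).
apply: rdiff_eq (rdiff_comp h H).
  by rewrite !addr0 conjc0 mulr1 mulr0 addr0.
by rewrite !addr0 conjc1 mulr0 mulr1 add0r.
Qed.

Definition cderiv f z l := rdiff f z l 0.

(** A conjugate-linear slope with value 0 at 0 can be folded into the linear one, because [cj h / h]
    has modulus at most one. *)
Lemma cderiv_q f z l : cderiv f z l <->
  exists q : R[i] -> R[i], [/\ forall h, f (z + h) - f z = q h * h, ccont q 0 & q 0 = l].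
Proof.
split; last first.
  move=> [q [e cq <-]]; exists q, (fun=> 0); split => //; last exact: ccont_cst.
  by move=> h; rewrite e mul0r addr0.
move=> [p [q [e cp cq <- q0]]]; exists (fun h => p h + q h * (cj h / h)).
split=> [h||]; last by rewrite q0 mul0r addr0.
- rewrite e; have [->|h0] := eqVneq h 0; first by rewrite conjc0 !mulr0 addr0.
  by rewrite mulrDl mulrA divfK.
- apply: ccontD => // eps e0.
  move: cq => /(_ eps e0)[d d0 H]; exists d => // w /H.
  rewrite q0 mul0r !subr0 nrmM; apply: le_lt_trans.
  rewrite ler_piMr ?nrm_ge0// nrmM nrmJ nrmV.
  have [->|w0] := eqVneq w 0; first by rewrite nrm0 mul0r.
  by rewrite divff// nrm_eq0.
Qed.

Lemma cderivP f z l : cderiv f z l <-> forall e : R, 0 < e -> exists2 d : R, 0 < d &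
  forall h, nrm h < d -> nrm (f (z + h) - f z - l * h) <= e * nrm h.
Proof.
rewrite cderiv_q; split.
  move=> [q [e cq <-]] eps /cq[d d0 H]; exists d => // h; rewrite -{1}(subr0 h).
  by move=> /H hd; rewrite e -mulrBl nrmM ler_wpM2r ?nrm_ge0// ltW.
move=> H; exists (fun h => if h == 0 then l else (f (z + h) - f z) / h).
split; last by rewrite eqxx.
- by move=> h; case: eqVneq => [->|h0]; [rewrite addr0 subrr mulr0|rewrite divfK].
- move=> e e0; have [d d0 Hd] := H (e / 2) (divr_gt0 e0 (ltr0Sn R 1)).
  exists d => // h; rewrite subr0 eqxx.
  case: eqVneq => [->|h0] hd; first by rewrite subrr nrm0.
  have := Hd h hd; rewrite [X in nrm X](_ : _ = ((f (z + h) - f z) / h - l) * h).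
    by rewrite nrmM ler_pM2r ?nrm_gt0// => /le_lt_trans; apply; rewrite ltr_pdivrMr// ltr_pMr// ltr1n.
  by rewrite mulrBl divfK.
Qed.

(* Restates [entire] without the topology of the alias [R[i]^o]. *)
Definition holo f := forall z, exists l, cderiv f z l.

Lemma entireP f : entire f <-> holo f.
Proof.
split=> H z.
  have := H z; rewrite /derivable.
  set q := fun h : R[i] => _.
  move=> /cvg_ex[l /cvgrPdist_lt/= cl]; exists l; apply/cderivP => e e0.
  have : 0 < e%:C by rewrite ltcR.
  move=> /cl; rewrite /dnbhs /within /= => /nbhs_normP[d /= /ltC0[r r0 ->] Hr].
  exists r => // h hr.
  have [->|h0] := eqVneq h 0; first by rewrite addr0 subrr mulr0 subrr nrm0 mulr0.
  have := Hr h; rewrite /= sub0r normrN -!nrmE !ltcR => /(_ hr h0).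
  rewrite /q => /ltW; rewrite -(ler_pM2r (x := nrm h)) ?nrm_gt0// -nrmM.
  rewrite nrm_distC; congr (nrm _ <= _).
  by rewrite /GRing.scale /= mulr1 (addrC h z) mulrBl mulrAC mulVf// mul1r.
have [l /cderivP {}H] := H z.
apply/cvg_ex; exists l; apply/cvgrPdist_lt => /= _ /ltC0[e e0 ->].
have [d d0 Hd] := H (e / 2) (divr_gt0 e0 (ltr0Sn R 1)).
rewrite /dnbhs /within /=; apply/nbhs_normP; exists d%:C => /=; first by rewrite ltcR.
move=> h /=; rewrite sub0r normrN -!nrmE !ltcR => hd h0.
rewrite nrm_distC -(ltr_pM2r (x := nrm h)) ?nrm_gt0// -nrmM.
rewrite [X in nrm X](_ : _ = f (z + h) - f z - l * h); last first.
  by rewrite /GRing.scale /= mulr1 (addrC h z) mulrBl mulrAC mulVf// mul1r.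
apply: le_lt_trans (Hd h hd) _.
by rewrite ltr_pM2r ?nrm_gt0// ltr_pdivrMr// ltr_pMr// ltr1n.
Qed.

End Continuity.

(** * Difference quotients and comparison for real functions *)

Section RealCalculus.
Context {R : realType}.
Implicit Types (E : R -> R) (x t l : R).

Lemma is_derive_cara E x l : is_derive x 1 E l -> exists e : R -> R,
  [/\ forall t, E (x + t) - E x = e t * t, {for 0, continuous e} & e 0 = l].
Proof.
move=> [dE El]; exists (fun t => if t == 0 then l else (E (x + t) - E x) / t).
split; last by rewrite eqxx.
  by move=> t; case: eqVneq => [->|t0]; rewrite ?addr0 ?subrr ?mulr0// divfK.
have /cvgrPdist_lt H : (fun h => h^-1 *: (E (h *: 1 + x) - E x)) @ 0^' --> l.
  by rewrite -El; exact: dE.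
apply/cvgrPdist_lt => e e0; rewrite eqxx.
have := H e e0; rewrite /dnbhs /within /= => /nbhs_normP[d /= d0 Hd].
apply/nbhs_normP; exists d => // t /= td.
case: eqVneq => [_|t0]; first by rewrite subrr normr0.
have := Hd t td t0; rewrite /GRing.scale /= mulr1 (addrC t x).
by rewrite [X in l - X]mulrC.
Qed.

Lemma cara_is_derive E x l (e : R -> R) :
  (forall t, E (x + t) - E x = e t * t) -> {for 0, continuous e} -> e 0 = l ->
  is_derive x 1 E l.
Proof.
move=> Ee ce e0.
have H : (fun h => h^-1 *: (E (h *: 1 + x) - E x)) @ 0^' --> l.
  apply/cvgrPdist_lt => eps eps0.
  move: ce => /cvgrPdist_lt/(_ eps eps0)/nbhs_normP[d /= d0 Hd].
  rewrite /dnbhs /within /=; apply/nbhs_normP; exists d => // t /= td t0.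
  rewrite /GRing.scale /= mulr1 (addrC t x) Ee mulrC mulfK// -e0.
  exact: Hd.
split; first by apply/cvg_ex; exists l.
exact: cvg_lim H.
Qed.

Lemma is_derive_le (phi psi dphi dpsi : R -> R) a b : a <= b ->
  (forall t, a <= t <= b -> is_derive t 1 phi (dphi t)) ->
  (forall t, a <= t <= b -> is_derive t 1 psi (dpsi t)) ->
  (forall t, a <= t <= b -> dphi t <= dpsi t) ->
  phi b - phi a <= psi b - psi a.
Proof.
rewrite le_eqVlt => /predU1P[<- *|ab h1 h2 h3]; first by rewrite !subrr.
have h4 t : a <= t <= b -> is_derive t 1 (psi - phi) (dpsi t - dphi t).
  by move=> tab; have := h1 t tab; have := h2 t tab => ? ?; exact: is_deriveB.
have [|//|c cab] := @MVT R (psi - phi) (fun t => dpsi t - dphi t) a b ab.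
- move=> x; rewrite in_itv /= => /andP[ax xb]; apply: h4.
  by rewrite (ltW ax) (ltW xb).
- apply: derivable_within_continuous => x; rewrite in_itv /= => xab.
  by have [] := h4 x xab.
rewrite !fctE => e.
rewrite -subr_ge0 [X in 0 <= X](_ : _ = psi b - phi b - (psi a - phi a)); last by ring.
rewrite e mulr_ge0 ?subr_ge0 ?(ltW ab)//; apply: h3.
by move: cab; rewrite in_itv /= => /andP[ac cb]; rewrite (ltW ac) (ltW cb).
Qed.

Lemma is_derive_cMX (c x : R) n :
  is_derive x 1 (fun u => c * u ^+ n) (c * (n%:R * x ^+ n.-1)).
Proof.
have H : is_derive x 1 (fun u : R => u ^+ n) (n%:R * x ^+ n.-1).
  elim: n => [|n IH].
    rewrite mul0r (_ : (fun _ => _) = cst 1); first exact: is_derive_cst.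
    by apply/funext => u; rewrite expr0.
  rewrite (_ : (fun _ => _) = (id * (fun u : R => u ^+ n))); last first.
    by apply/funext => u; rewrite exprS.
  apply: (is_derive_eq (is_deriveM (is_derive_id x (1 : R)) IH)).
  rewrite /GRing.scale /= mulr1; case: n {IH} => [|n] /=; first by rewrite expr0; ring.
  by rewrite exprS (mulrS _ n.+1); ring.
apply: (is_derive_eq (is_deriveM (is_derive_cst c x (1 : R)) H)).
by rewrite /GRing.scale /= mulr0 addr0.
Qed.

End RealCalculus.

(** * Rules for complex derivatives and the mean value inequality *)

Section ComplexDerivative.
Context {R : realType}.
Implicit Types (f g : R[i] -> R[i]) (z w h l : R[i]).

Lemma rdiff_real (E : R -> R) (r : R[i] -> R) z A B (l : R) :
  rdiff (fun w => (r w)%:C) z A B -> is_derive (r z) 1 E l ->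
  rdiff (fun w => (E (r w))%:C) z (l%:C * A) (l%:C * B).
Proof.
move=> rr; have cr := rdiff_cont rr.
move: rr => [p [q [e cp cq <- <-]]] /is_derive_cara[k [ek ck <-]].
pose d h := r (z + h) - r z.
have cd : ccont (fun h => (k (d h))%:C) 0.
  have d0 : d 0 = 0 by rewrite /d addr0 subrr.
  apply: (@ccont_real R (fun h => (d h)%:C) k 0); first by rewrite /= d0.
  move=> eps /cr[dd dd0 H]; exists dd => // h; rewrite subr0 => hd.
  have := H (z + h); rewrite [z + h - z](_ : _ = h); last by ring.
  by move=> /(_ hd); rewrite -!RCB d0 subr0.
have d0 : d 0 = 0 by rewrite /d addr0 subrr.
exists (fun h => (k (d h))%:C * p h), (fun h => (k (d h))%:C * q h).
split; [|exact: ccontM|exact: ccontM|by rewrite d0|by rewrite d0].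
move=> h; rewrite -!mulrA -mulrDr -e -!RCB -/(d h) -RCM -ek.
by rewrite /d; congr ((E _ - _)%:C); ring.
Qed.

Lemma rdiff_ReC z : rdiff (fun w => (complex.Re w)%:C) z (2^-1) (2^-1).
Proof.
have H := rdiffM (rdiff_cst (2^-1 : R[i]) z) (rdiffD (rdiff_id z) (rdiffJ (rdiff_id z))).
rewrite (_ : (fun _ => _) = (fun w => 2^-1 * (w + cj w))).
  by apply: rdiff_eq H; rewrite ?conjc0 ?conjc1 mul0r add0r ?addr0 ?add0r mulr1.
by apply/funext => w; rewrite ReJ_add mulrC.
Qed.

Lemma rdiff_ImC z : rdiff (fun w => (complex.Im w)%:C) z (- ('i / 2)) ('i / 2).
Proof.
have H := rdiffM (rdiff_cst ('i / 2 : R[i]) z)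
  (rdiffD (rdiffJ (rdiff_id z)) (rdiffM (rdiff_cst (-1 : R[i]) z) (rdiff_id z))).
rewrite (_ : (fun _ => _) = (fun w => 'i / 2 * (cj w + -1 * w))).
  by apply: rdiff_eq H; rewrite ?conjc0 ?conjc1; ring.
by apply/funext => w; rewrite ImJ_sub mulN1r mulrC -mulrA [2^-1 * _]mulrC.
Qed.

Lemma rdiffZ f z c A B : rdiff f z A B -> rdiff (fun w => c * f w) z (c * A) (c * B).
Proof.
move=> H; have := rdiffM (rdiff_cst c z) H.
by apply: rdiff_eq; rewrite mul0r add0r.
Qed.

Lemma rdiff_nrm2 z w : rdiff (fun x => (nrm (x - w) ^+ 2)%:C) z (cj (z - w)) (z - w).
Proof.
rewrite (_ : (fun _ => _) = fun x => (x - w) * cj (x - w)); last first.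
  by apply/funext => x; rewrite mulcJ.
have h := rdiffD (rdiff_id z) (rdiff_cst (- w) z).
by apply: rdiff_eq (rdiffM h (rdiffJ h)); rewrite !addr0 ?conjc0 ?conjc1; ring.
Qed.

Lemma cderiv_cst c z : cderiv (fun=> c) z 0. Proof. exact: rdiff_cst. Qed.

Lemma cderiv_id z : cderiv id z 1. Proof. exact: rdiff_id. Qed.

Lemma cderivD f g z l l' : cderiv f z l -> cderiv g z l' ->
  cderiv (fun w => f w + g w) z (l + l').
Proof. by move=> a b; apply: rdiff_eq (rdiffD a b); rewrite ?addr0. Qed.

Lemma cderivM f g z l l' : cderiv f z l -> cderiv g z l' ->
  cderiv (fun w => f w * g w) z (l * g z + f z * l').
Proof. by move=> a b; apply: rdiff_eq (rdiffM a b); rewrite ?mul0r ?mulr0 ?addr0. Qed.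

Lemma cderivZ f z c l : cderiv f z l -> cderiv (fun w => c * f w) z (c * l).
Proof. by move=> a; apply: rdiff_eq (rdiffZ c a); rewrite ?mulr0. Qed.

Lemma cderivN f z l : cderiv f z l -> cderiv (fun w => - f w) z (- l).
Proof.
move=> /(cderivZ (-1)); rewrite mulN1r (_ : (fun _ => _) = fun w => - f w)//.
by apply/funext => w; rewrite mulN1r.
Qed.

Lemma cderivB f g z l l' : cderiv f z l -> cderiv g z l' ->
  cderiv (fun w => f w - g w) z (l - l').
Proof. by move=> a b; exact: cderivD a (cderivN b). Qed.

Lemma cderiv_comp f g z l l' : cderiv f z l -> cderiv g (f z) l' ->
  cderiv (fun w => g (f w)) z (l' * l).
Proof.
by move=> a b; apply: rdiff_eq (rdiff_comp a b); rewrite ?conjc0 ?mul0r ?mulr0 ?addr0.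
Qed.

Lemma cderiv_eq f z l l' : l = l' -> cderiv f z l -> cderiv f z l'.
Proof. by move=> ->. Qed.

Lemma cderivX z n : cderiv (fun w => w ^+ n) z (n%:R * z ^+ n.-1).
Proof.
elim: n => [|n IH]; first by rewrite mul0r; exact: cderiv_cst.
rewrite (_ : (fun _ => _) = fun w => w * w ^+ n).
  apply: cderiv_eq (cderivM (cderiv_id z) IH).
  case: n {IH} => [|n] /=; first by rewrite !expr0; ring.
  by rewrite exprS (mulrS _ n.+1); ring.
by apply/funext => w; rewrite exprS.
Qed.

Lemma cderiv_inv z : z != 0 -> cderiv (fun w => w^-1) z (- z^-1 ^+ 2).
Proof.
move=> z0; apply/cderivP => e e0; have m0 : 0 < nrm z by rewrite nrm_gt0.
set m := nrm z in m0 *.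
(* The first bound keeps [|z + h|] above [m / 2]; the second then gives [|h| <= e |z|^2 |z + h|],
   the error being [h^2 / (z^2 (z + h))]. *)
exists (Num.min (m / 2) (e * m ^+ 3 / 2)).
  by rewrite lt_min !divr_gt0// mulr_gt0// exprn_gt0.
move=> h; rewrite lt_min => /andP[h1 h2].
have zh : m / 2 < nrm (z + h).
  have := nrmBD (z + h) z 0; rewrite !subr0 -/m.
  by rewrite [z - _](_ : _ = - h) ?nrmN; [lra|ring].
have zh0 : z + h != 0 by rewrite -nrm_gt0; apply: lt_trans zh; rewrite divr_gt0.
rewrite [X in nrm X](_ : _ = h * h / (z ^+ 2 * (z + h))); last first.
  by field; rewrite zh0 z0.
rewrite !nrmM nrmV nrmM nrmX -/m mulrAC -subr_ge0 -mulrBl mulr_ge0 ?nrm_ge0// subr_ge0.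
rewrite ler_pdivrMr; last by rewrite mulr_gt0 ?nrm_gt0// exprn_gt0.
apply: ltW; apply: lt_trans h2 _.
rewrite [X in X < _](_ : _ = (e * m ^+ 2) * (m / 2)); last by rewrite !exprS; field.
by rewrite [X in _ < X]mulrA ltr_pM2l// mulr_gt0// exprn_gt0.
Qed.

Lemma cderivV f z l : f z != 0 -> cderiv f z l ->
  cderiv (fun w => (f w)^-1) z (- (l / f z ^+ 2)).
Proof.
move=> fz h; apply: cderiv_eq (cderiv_comp h (cderiv_inv fz)).
by rewrite exprVn mulNr mulrC.
Qed.

Lemma cderiv_cont f z l : cderiv f z l -> ccont f z.
Proof. exact: rdiff_cont. Qed.

Lemma cderiv_shift f z w l : cderiv f (z + w) l -> cderiv (fun x => f (x + w)) z l.
Proof. exact: rdiff_shift. Qed.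

Lemma cderiv_uniq f z l l' : cderiv f z l -> cderiv f z l' -> l = l'.
Proof.
move=> /cderivP h1 /cderivP h2; apply/eqP; rewrite -subr_eq0 -nrm_eq0 eq_le nrm_ge0 andbT.
rewrite leNgt; apply/negP => e0.
have e4 : 0 < nrm (l - l') / 4 by rewrite divr_gt0.
have [d d0 H] := h1 _ e4; have [d' d'0 H'] := h2 _ e4.
pose t := Num.min d d' / 2; have t0 : 0 < t by rewrite divr_gt0// lt_min d0.
have tt : nrm t%:C = t by rewrite nrmR ger0_norm ?ltW.
have m : t < Num.min d d' by rewrite ltr_pdivrMr// ltr_pMr ?ltr1n// lt_min d0.
have := H t%:C; have := H' t%:C; rewrite tt; move: m; rewrite lt_min => /andP[m m'].
move=> /(_ m') a /(_ m) b.
have : nrm ((l - l') * t%:C) <= nrm (l - l') / 2 * t.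
  rewrite [X in nrm X](_ : _ = (f (z + t%:C) - f z - l' * t%:C) - (f (z + t%:C) - f z - l * t%:C)); last by ring.
  apply: le_trans (nrmB _ _) _; lra.
by rewrite nrmM tt ler_pM2r// leNgt ltr_pdivrMr// ltr_pMr// ltr1n.
Qed.

Lemma cderiv_local f g z l (d : R) : 0 < d ->
  (forall w, nrm (w - z) < d -> f w = g w) -> cderiv f z l -> cderiv g z l.
Proof.
move=> d0 H /cderivP h; apply/cderivP => e /h[r r0 Hr].
exists (Num.min r d); first by rewrite lt_min r0.
move=> k; rewrite lt_min => /andP[kr kd]; rewrite -!H ?subrr ?nrm0//; first exact: Hr.
by rewrite [z + k - z](_ : _ = k)//; ring.
Qed.

(** Multiplication by the unit [c = cj D / |D|] turns the increment [D] into its modulus, so the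
    real comparison [is_derive_le] applies to the real part of [c * (f - f z)] along the segment. *)
Lemma cderiv_mvt f (df : R[i] -> R[i]) z h (psi dpsi : R -> R) (b : R) : 0 <= b ->
  (forall t, 0 <= t <= b -> cderiv f (z + t%:C * h) (df (z + t%:C * h))) ->
  (forall t, 0 <= t <= b -> is_derive t 1 psi (dpsi t)) ->
  (forall t, 0 <= t <= b -> nrm (df (z + t%:C * h) * h) <= dpsi t) ->
  nrm (f (z + b%:C * h) - f z) <= psi b - psi 0.
Proof.
move=> b0 H1 H2 H3.
have [e|fz] := eqVneq (nrm (f (z + b%:C * h) - f z)) 0.
  rewrite e -[X in X <= _](subrr (0 : R)).
  apply: (@is_derive_le R (cst 0) psi (cst 0) dpsi 0 b) => // t tb.
  by apply: le_trans (H3 t tb); exact: nrm_ge0.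
set D := f _ - f z in fz *; pose c := cj D / (nrm D)%:C.
have D0 : (nrm D)%:C != 0 by rewrite -nrm_eq0 nrmR normr_eq0.
have cD : complex.Re (c * D) = nrm D.
  rewrite /c mulrAC (mulrC (cj D)) mulcJ -[_ / _](_ : (nrm D)%:C = _)//.
  by rewrite RCX expr2 mulfK.
have nc : nrm c = 1 by rewrite /c nrmM nrmJ nrmV nrmR ger0_norm ?nrm_ge0// divff.
pose phi t := complex.Re (c * (f (z + t%:C * h) - f z)).
rewrite -cD [X in X <= _](_ : _ = phi b - phi 0); last first.
  by rewrite /phi mul0r addr0 subrr mulr0 subr0.
apply: (@is_derive_le R phi psi
   (fun t => complex.Re (c * (df (z + t%:C * h) * h))) dpsi) => // t tb; last first.
  apply: le_trans (H3 t tb); apply: le_trans (ler_norm _) _.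
  by apply: le_trans (Re_le _) _; rewrite nrmM nc mul1r.
have /cderiv_q[q [e cq q0]] := H1 t tb.
apply: (@cara_is_derive R _ _ _ (fun s => complex.Re (c * (q (s%:C * h) * h)))).
- move=> s; rewrite /phi -cReN -cReD.
  rewrite [X in complex.Re X](_ : _ = c * (f (z + (t + s)%:C * h) - f (z + t%:C * h))); last by ring.
  by rewrite RCD mulrDl addrA e -cReMr; congr complex.Re; ring.
- apply/cvgrPdist_lt => eps eps0.
  have K0 : 0 < nrm h + 1 by rewrite ltr_wpDl ?nrm_ge0.
  have [d d0 Hd] := cq _ (divr_gt0 eps0 K0).
  apply/nbhs_normP; exists (d / (nrm h + 1)); first by rewrite /= divr_gt0.
  move=> s /=; rewrite sub0r normrN ltr_pdivlMr// => sd.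
  rewrite -cReN -cReD; apply: le_lt_trans (Re_le _) _.
  rewrite [X in nrm X](_ : _ = - (c * ((q (s%:C * h) - q (0%:C * h)) * h))); last by ring.
  rewrite nrmN nrmM nc mul1r nrmM mul0r.
  have : nrm (q (s%:C * h) - q 0) < eps / (nrm h + 1).
    apply: Hd; rewrite subr0 nrmM nrmR; apply: le_lt_trans sd.
    by rewrite ler_wpM2l// lerDl.
  rewrite ltr_pdivlMr// => /(le_lt_trans _); apply.
  by rewrite ler_wpM2l ?nrm_ge0// lerDl.
- by rewrite mul0r q0.
Qed.

Lemma cderiv_lip f (df : R[i] -> R[i]) z h (K : R) :
  (forall t, 0 <= t <= 1 -> cderiv f (z + t%:C * h) (df (z + t%:C * h))) ->
  (forall t, 0 <= t <= 1 -> nrm (df (z + t%:C * h)) <= K) ->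
  nrm (f (z + h) - f z) <= K * nrm h.
Proof.
move=> H1 H2.
have := @cderiv_mvt f df z h (fun t => (K * nrm h) * t) (fun=> K * nrm h) 1 ler01 H1.
rewrite mul1r mulr1 mulr0 subr0; apply.
- move=> t _; apply: (@cara_is_derive R _ _ _ (fun=> K * nrm h)) => //.
    by move=> s; rewrite mulrDr addrAC subrr add0r.
  exact: cst_continuous.
- by move=> t tb; rewrite nrmM ler_wpM2r ?nrm_ge0// H2.
Qed.

Lemma cderiv0_cst f : (forall z, cderiv f z 0) -> forall z w, f z = f w.
Proof.
move=> H z w; apply/eqP; rewrite -subr_eq0 -nrm_eq0 eq_le nrm_ge0 andbT.
have := @cderiv_lip f (fun=> 0) w (z - w) 0.
rewrite mul0r [w + _](_ : _ = z); last by ring.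
by apply => // t _; rewrite nrm0.
Qed.

Lemma holo_ccont f z : holo f -> ccont f z.
Proof. by move=> /(_ z)[l /cderiv_cont]. Qed.

Lemma holo_cst (c : R[i]) : holo (fun=> c).
Proof. by move=> z; exists 0; exact: cderiv_cst. Qed.

Lemma holo_D f g : holo f -> holo g -> holo (fun z => f z + g z).
Proof.
move=> ef eg; move=> z.
by have [l h] := ef z; have [l' h'] := eg z; exists (l + l'); exact: cderivD.
Qed.

Lemma holo_M f g : holo f -> holo g -> holo (fun z => f z * g z).
Proof.
move=> ef eg; move=> z.
by have [l h] := ef z; have [l' h'] := eg z; eexists; exact: (cderivM h h').
Qed.

Lemma holo_comp f g : holo f -> holo g -> holo (fun z => g (f z)).
Proof.
move=> ef eg; move=> z.
by have [l h] := ef z; have [l' h'] := eg (f z); eexists; exact: (cderiv_comp h h').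
Qed.

Lemma holo_X f n : holo f -> holo (fun z => f z ^+ n).
Proof.
move=> ef; apply: (holo_comp ef (g := fun z => z ^+ n)); move=> z.
by eexists; exact: cderivX.
Qed.

Lemma holo_B f g : holo f -> holo g -> holo (fun z => f z - g z).
Proof.
move=> ef eg; move=> z.
by have [l h] := ef z; have [l' h'] := eg z; exists (l - l'); exact: cderivB.
Qed.

Lemma holo_V f : holo f -> (forall z, f z != 0) -> holo (fun z => (f z)^-1).
Proof.
move=> ef f0; move=> z.
by have [l h] := ef z; eexists; exact: (cderivV (f0 z) h).
Qed.

Lemma holo_affine (a b : R[i]) : holo (fun z => a * z + b).
Proof.
apply: holo_D; last exact: holo_cst.
by apply: holo_M; [exact: holo_cst|move=> z; eexists; exact: cderiv_id].
Qed.

End ComplexDerivative.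

(** * The complex exponential and its Taylor remainder *)

Section ComplexExp.
Context {R : realType}.
Implicit Types (z w h l : R[i]).

Definition cexp z : R[i] :=
  (expR (complex.Re z))%:C * ((cos (complex.Im z))%:C + 'i * (sin (complex.Im z))%:C).

Lemma cexpD z w : cexp (z + w) = cexp z * cexp w.
Proof.
rewrite /cexp cReD cImD expRD cosD sinD RCB RCD !RCM.
have i2 : 'i * 'i = -1 :> R[i] by rewrite -expr2 sqr_i.
rewrite -!mulrA; apply: (@eq_trans _ _ ((expR (complex.Re z))%:C * (expR (complex.Re w))%:C *
  ((cos (complex.Im z))%:C * (cos (complex.Im w))%:C + ('i * 'i) * ((sin (complex.Im z))%:C * (sin (complex.Im w))%:C) + 'i * ((sin (complex.Im z))%:C * (cos (complex.Im w))%:C +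
   (cos (complex.Im z))%:C * (sin (complex.Im w))%:C)))); last by ring.
by rewrite i2; ring.
Qed.

Lemma cexp0 : cexp 0 = 1.
Proof. by rewrite /cexp /= expR0 cos0 sin0 mulr0 addr0 mulr1. Qed.

Lemma cexpN z : cexp (- z) = (cexp z)^-1.
Proof.
have h : cexp z * cexp (- z) = 1 by rewrite -cexpD subrr cexp0.
have z0 : cexp z != 0.
  by apply/eqP => e; move: h; rewrite e mul0r => /eqP; rewrite eq_sym oner_eq0.
by apply: (mulfI z0); rewrite h divff.
Qed.

Lemma cexp_neq0 z : cexp z != 0.
Proof.
apply/eqP => e; have : cexp z * cexp (- z) = 1 by rewrite -cexpD subrr cexp0.
by rewrite e mul0r => /eqP; rewrite eq_sym oner_eq0.
Qed.

Lemma nrm_cexp z : nrm (cexp z) = expR (complex.Re z).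
Proof.
rewrite /cexp nrmM nrmR ger0_norm ?expR_ge0// [X in _ * nrm X](_ : _ = (cos (complex.Im z)) +i* (sin (complex.Im z))).
  by rewrite /Normc.normc cos2Dsin2 sqrtr1 mulr1.
by rewrite complexDE.
Qed.

Lemma cexp_le z : nrm (cexp z) <= expR (nrm z).
Proof. by rewrite nrm_cexp ler_expR (le_trans (ler_norm _) (Re_le _)). Qed.

Lemma cexpR (x : R) : cexp x%:C = (expR x)%:C.
Proof. by rewrite /cexp /= cos0 sin0 mulr0 addr0 mulr1. Qed.

Lemma cexpJ z : cj (cexp z) = cexp (cj z).
Proof.
rewrite /cexp cReJ cImJ conjC_M conjC_R conjC_D conjC_M !conjC_R cosN sinN.
by congr (_ * (_ + _)); rewrite RCN mulrN -mulNr; congr (_ * _); apply: complexP; rewrite /= ?oppr0.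
Qed.

Lemma cexpX z n : cexp z ^+ n = cexp (n%:R * z).
Proof.
elim: n => [|n IH]; first by rewrite mul0r cexp0.
by rewrite exprS IH -cexpD; congr cexp; rewrite mulrS; ring.
Qed.

Lemma cderiv_cexp z : cderiv cexp z (cexp z).
Proof.
have e1 := rdiff_real (rdiff_ReC z) (is_derive_expR (complex.Re z)).
have e2 := rdiff_real (rdiff_ImC z) (is_derive_cos (complex.Im z)).
have e3 := rdiff_real (rdiff_ImC z) (is_derive_sin (complex.Im z)).
have := rdiffM e1 (rdiffD e2 (rdiffZ 'i e3)).
have i2 : 'i * 'i = -1 :> R[i] by rewrite -expr2 sqr_i.
apply: rdiff_eq; rewrite /cexp RCN; set E := (expR _)%:C; set C := (cos _)%:C; set S := (sin _)%:C.
  rewrite (_ : 'i * (C * - ('i / 2)) = - ('i * 'i) * C / 2); last by field.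
  by rewrite i2; field.
rewrite (_ : 'i * (C * ('i / 2)) = ('i * 'i) * C / 2); last by field.
by rewrite i2; field.
Qed.

Lemma holo_cexp : holo cexp.
Proof. by move=> z; eexists; exact: cderiv_cexp. Qed.

Lemma holo_cexp_comp (f : R[i] -> R[i]) : holo f -> holo (fun z => cexp (f z)).
Proof. by move=> ef; exact: holo_comp ef holo_cexp. Qed.

(** Induction on [n]: the remainder of order [n.+1] has the remainder of order [n] as derivative;
    along the segment the latter is at most [K * t ^+ n], whose primitive supplies the new factor
    [1 / n.+1]. *)
Lemma cexp_taylor n z :
  nrm (cexp z - \sum_(k < n) (k`!%:R)^-1 * z ^+ k) <= nrm z ^+ n / n`!%:R * expR (nrm z).
Proof.
pose S n z := \sum_(k < n) (k`!%:R)^-1 * z ^+ k : R[i].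
have S0 m : S m.+1 0 = 1.
  rewrite /S big_ord_recl expr0 fact0 invr1 mulr1 big1 ?addr0// => i _.
  by rewrite expr0n mulr0.
have dS m w : cderiv (S m.+1) w (S m w).
  elim: m => [|m IH].
    rewrite /S big_ord0 (_ : (fun _ => _) = fun=> 1); first exact: cderiv_cst.
    by apply/funext => v; rewrite big_ord1 expr0 mulr1 fact0 invr1.
  rewrite (_ : S m.+2 = fun v => S m.+1 v + (m.+1`!%:R)^-1 * v ^+ m.+1).
    have := cderivD IH (cderivZ (m.+1`!%:R)^-1 (cderivX w m.+1)).
    apply: cderiv_eq; rewrite {2}/S big_ord_recr /= -/(S m w); congr (_ + _).
    rewrite factS natrM invfM mulrA; congr (_ * _).
    have n0 : m.+1%:R != 0 :> R[i] by rewrite pnatr_eq0.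
    by rewrite mulrAC mulVf ?mul1r.
  by apply/funext => v; rewrite /S big_ord_recr.
elim: n z => [|n IH] z.
  by rewrite big_ord0 subr0 expr0 fact0 invr1 mulr1 mul1r cexp_le.
rewrite -/(S n.+1 z).
have n0 : (n.+1)%:R != 0 :> R by rewrite pnatr_eq0.
have f0 : (n`!)%:R != 0 :> R by rewrite pnatr_eq0 -lt0n fact_gt0.
pose K := nrm z ^+ n.+1 / n`!%:R * expR (nrm z).
have := @cderiv_mvt R (fun v => cexp v - S n.+1 v) (fun v => cexp v - S n v) 0 z
  (fun t => K / n.+1%:R * t ^+ n.+1) (fun t => K * t ^+ n) 1 ler01.
rewrite add0r mul1r cexp0 S0 !subrr !subr0 expr1n expr0n mulr0 subr0 mulr1.
rewrite [X in _ -> _ -> _ -> _ <= X](_ : _ = nrm z ^+ n.+1 / n.+1`!%:R * expR (nrm z)); last first.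
  by rewrite /K factS natrM; move: (_.+1%:R) n0 => N n0; field; rewrite n0 f0.
apply.
- by move=> t _; apply: cderivB; [exact: cderiv_cexp|exact: dS].
- move=> t _.
  rewrite [X in is_derive _ _ _ X](_ : _ = K / n.+1%:R * (n.+1%:R * t ^+ n)).
    exact: is_derive_cMX.
  by rewrite mulrA divfK.
- move=> t /andP[t0 t1]; rewrite add0r nrmM.
  have := IH (t%:C * z); rewrite -/(S n _) => h.
  apply: le_trans (ler_wpM2r (nrm_ge0 z) h) _.
  rewrite nrmM nrmR ger0_norm// exprMn /K exprS.
  rewrite [leLHS](_ : _ = (t ^+ n * nrm z ^+ n * nrm z / n`!%:R) * expR (t * nrm z)); last by ring.
  rewrite [leRHS](_ : _ = (t ^+ n * nrm z ^+ n * nrm z / n`!%:R) * expR (nrm z)); last by ring.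
  rewrite ler_wpM2l ?mulr_ge0 ?exprn_ge0 ?nrm_ge0 ?invr_ge0//.
  by rewrite ler_expR ler_piMl ?nrm_ge0.
Qed.

End ComplexExp.

(** * Integration over the plane *)

Section RealIntegral.
Context {R : realType}.
Implicit Types (F G : R[i] -> R) (z w : R[i]).

Local Notation T := (R * R)%type.

Definition mea F := measurable_fun [set: T] (fun x => F (toC x)).

Definition itg F := (@area R).-integrable [set: T] (fun x => (F (toC x))%:E).

Definition Int F : R := \int[@area R]_x F (toC x).

Lemma itg_mea F : itg F -> mea F.
Proof. by move=> /measurable_int/measurable_EFinP. Qed.

Lemma toCD (v w : T) : toC v - toC w = (v.1 - w.1) +i* (v.2 - w.2).
Proof. by []. Qed.

Lemma mea_cont F : (forall z, ccont (fun w => (F w)%:C) z) -> mea F.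
Proof.
move=> cF mD; apply: (measurability _ (RGenOInfty.measurableE R)) => //.
move=> /= _ [_ [a ->] <-]; rewrite setTI.
apply: box_open_measurable => w /=; rewrite in_itv/= andbT => aw.
have [|d d0 H] := cF (toC w) (F (toC w) - a); first by rewrite subr_gt0.
exists (d / 2); first by rewrite divr_gt0.
move=> v v1 v2; rewrite in_itv/= andbT.
have : nrm (toC v - toC w) < d.
  by apply: le_lt_trans (nrm_le _) _; rewrite toCD /= [d]splitr ltrD.
move=> /H; rewrite -RCB nrmR ltr_distl => /andP[+ _].
by rewrite opprB addrC subrK.
Qed.

Lemma mea_cst (c : R) : mea (fun=> c).
Proof. exact: measurable_cst. Qed.

Lemma meaD F G : mea F -> mea G -> mea (fun z => F z + G z).
Proof. by move=> a b; exact: measurable_funD. Qed.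

Lemma meaB F G : mea F -> mea G -> mea (fun z => F z - G z).
Proof. by move=> a b; exact: measurable_funB. Qed.

Lemma meaM F G : mea F -> mea G -> mea (fun z => F z * G z).
Proof. by move=> a b; exact: measurable_funM. Qed.

Lemma meaX F n : mea F -> mea (fun z => F z ^+ n).
Proof. by move=> a; exact: measurable_funX. Qed.

Lemma mea_sqrt F : mea F -> mea (fun z => Num.sqrt (F z)).
Proof. by move=> a; apply: measurableT_comp => //; apply: continuous_measurable_fun; exact: sqrt_continuous. Qed.

Lemma mea_expR F : mea F -> mea (fun z => expR (F z)).
Proof. by move=> a; exact: measurableT_comp. Qed.

Lemma mea_cvg (u : nat -> R[i] -> R) F : (forall n, mea (u n)) ->
  (forall z, u ^~ z @ \oo --> F z) -> mea F.
Proof.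
move=> mu uF; apply: (@measurable_fun_cvg _ _ _ setT (fun n x => u n (toC x))).
- by [].
- by move=> x _; exact: uF.
Qed.

Lemma eq_mea F G : F =1 G -> mea F -> mea G.
Proof. by move=> /funext ->. Qed.

Lemma itg_le F G : mea F -> (forall z, `|F z| <= G z) -> itg G -> itg F.
Proof.
move=> mF FG; apply: le_integrable => //; first exact/measurable_EFinP.
by move=> x _; rewrite /= lee_fin; apply: le_trans (FG _) (ler_norm _).
Qed.

Lemma eq_itg F G : F =1 G -> itg F -> itg G.
Proof. by move=> /funext ->. Qed.

Lemma itgD F G : itg F -> itg G -> itg (fun z => F z + G z).
Proof. by move=> a b; exact: (integrableD measurableT a b). Qed.

Lemma itgB F G : itg F -> itg G -> itg (fun z => F z - G z).
Proof. by move=> a b; exact: (integrableB measurableT a b). Qed.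

Lemma itgZ c F : itg F -> itg (fun z => c * F z).
Proof. by move=> a; exact: (integrableZl measurableT c a). Qed.

Lemma itg_abs F : itg F -> itg (fun z => `|F z|).
Proof. by move=> a; exact: (integrable_abse a). Qed.

Lemma itg0 : itg (fun=> 0).
Proof. exact: integrable0. Qed.

Lemma eq_Int F G : F =1 G -> Int F = Int G.
Proof. by move=> /funext ->. Qed.

Lemma IntD F G : itg F -> itg G -> Int (fun z => F z + G z) = Int F + Int G.
Proof. by move=> a b; exact: RintegralD. Qed.

Lemma IntB F G : itg F -> itg G -> Int (fun z => F z - G z) = Int F - Int G.
Proof. by move=> a b; exact: RintegralB. Qed.

Lemma IntZ c F : itg F -> Int (fun z => c * F z) = c * Int F.
Proof. by move=> a; exact: RintegralZl. Qed.

Lemma IntN F : itg F -> Int (fun z => - F z) = - Int F.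
Proof.
by move=> a; rewrite -[RHS]mulN1r -IntZ//; apply: eq_Int => z; rewrite mulN1r.
Qed.

Lemma Int0 : Int (fun=> 0) = 0.
Proof. by rewrite /Int Rintegral_cst// mul0r. Qed.

Lemma le_Int F G : itg F -> itg G -> (forall z, F z <= G z) -> Int F <= Int G.
Proof. by move=> a b FG; apply: le_Rintegral => //. Qed.

Lemma Int_ge0 F : (forall z, 0 <= F z) -> 0 <= Int F.
Proof. by move=> F0; apply: Rintegral_ge0. Qed.

Lemma Int_fineK F : itg F -> (Int F)%:E = (\int[@area R]_x (F (toC x))%:E)%E.
Proof. by move=> a; rewrite /Int /Rintegral fineK//; exact: integrable_fin_num. Qed.

Lemma itg_ltyP F : mea F -> (forall z, 0 <= F z) ->
  (\int[@area R]_x (F (toC x))%:E < +oo)%E -> itg F.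
Proof.
move=> mF F0 lt; apply/integrableP; split; first exact/measurable_EFinP.
by under eq_integral do rewrite /= ger0_norm//.
Qed.

Lemma itg_lty F : (forall z, 0 <= F z) -> itg F ->
  (\int[@area R]_x (F (toC x))%:E < +oo)%E.
Proof. by move=> F0 /integrable_fin_num/fin_numPlt/andP[]. Qed.

Lemma Int_dominated (u : nat -> R[i] -> R) F G : (forall n, mea (u n)) ->
  (forall z, u ^~ z @ \oo --> F z) -> itg G -> (forall n z, `|u n z| <= G z) ->
  itg F /\ Int (u n) @[n --> \oo] --> Int F.
Proof.
move=> mu uF iG uG.
have mF : mea F by apply: mea_cvg uF.
have [] := @dominated_convergence _ _ R (@area R) setT measurableT
  (fun n x => (u n (toC x))%:E) (fun x => (F (toC x))%:E) (fun x => (G (toC x))%:E).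
- by move=> n; apply/measurable_EFinP; exact: mu.
- exact/measurable_EFinP.
- by apply: aeW => x _; apply: cvg_EFin; [exact: nearW|exact: uF].
- exact: iG.
- by apply: aeW => x n _; rewrite lee_fin.
move=> iF _ H; split => //.
have iu n : itg (u n) by apply: itg_le iG.
by move: H; rewrite -Int_fineK// => /fine_cvgP[].
Qed.

Lemma Int_fatou (u : nat -> R[i] -> R) F C : (forall n, itg (u n)) ->
  (forall n z, 0 <= u n z) -> (forall z, u ^~ z @ \oo --> F z) ->
  (forall n, Int (u n) <= C) -> itg F /\ Int F <= C.
Proof.
move=> iu u0 uF uC.
have mF : mea F by apply: mea_cvg uF => n; exact: itg_mea.
have F0 z : 0 <= F z.
  rewrite -(cvg_lim _ (uF z))//; apply: limr_ge; first exact: cvgP (uF z).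
  exact: nearW.
have FC : (\int[@area R]_x (F (toC x))%:E <= C%:E)%E.
  have H := @fatou _ _ R (@area R) setT measurableT (fun n x => (u n (toC x))%:E) _ _.
  apply: (@le_trans _ _ (\int[@area R]_x limn_einf (fun n => (u n (toC x))%:E))%E).
    rewrite le_eqVlt; apply/orP; left; apply/eqP; apply: eq_integral => x _.
    have E : (fun n => (u n (toC x))%:E) @ \oo --> (F (toC x))%:E.
      by apply: cvg_EFin; [exact: nearW|exact: uF].
    by have [-> _] := cvg_limn_einf_sup E.
  apply: le_trans (H _ _) _.
  - by move=> n; apply/measurable_EFinP; exact: itg_mea.
  - by move=> n x _; rewrite lee_fin.
  rewrite limn_einf_lim; apply: lime_le; first exact: is_cvg_einfs.
  apply: nearW => n; apply: (@le_trans _ _ (\int[@area R]_x (u n (toC x))%:E)%E).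
    by apply: ereal_inf_lbound; exists n => //=.
  by rewrite -Int_fineK// lee_fin.
have iF : itg F by apply: itg_ltyP => //; apply: le_lt_trans FC _; rewrite ltry.
by split => //; rewrite -lee_fin Int_fineK.
Qed.

Lemma integral_gauss1 (b m : R) : 0 < b ->
  (\int[lebesgue_measure]_x (expR (- (b * (x - m) ^+ 2)))%:E = (Num.sqrt (pi / b))%:E)%E.
Proof.
(* [s] is the standard deviation for which the normal density of mean [m] is proportional to the
   integrand; its total mass one gives the integral. *)
move=> b0; pose s := (Num.sqrt (b *+ 2))^-1 : R.
have s0 : s != 0 by rewrite invr_eq0 sqrtr_eq0 -ltNge pmulrn_lgt0.
have s2 : s ^+ 2 = (b *+ 2)^-1 by rewrite exprVn sqr_sqrtr// mulrn_wge0// ltW.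
have E x : expR (- (b * (x - m) ^+ 2)) = Num.sqrt (pi / b) * normal_pdf m s x.
  rewrite normal_pdfE// /normal_peak s2.
  have -> : (b *+ 2)^-1 * pi *+ 2 = pi / b.
    move: (pi : R) => p; rewrite -[LHS]mulr_natr -(mulr_natr b) invfM.
    by rewrite (mulrC p) mulrAC divfK// mulrC.
  rewrite mulVKf; last by rewrite sqrtr_eq0 -ltNge divr_gt0// pi_gt0.
  rewrite /normal_fun; congr expR; rewrite s2 -(mulr_natr b) -(mulr_natr (_^-1)).
  have -> : (b * 2)^-1 * 2 = b^-1 by rewrite invfM -mulrA mulVf// mulr1.
  by rewrite invrK mulNr mulrC.
under eq_integral do rewrite E EFinM.
rewrite integralZl//; last exact: integrable_normal_pdf.
by rewrite integral_normal_pdf mule1.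
Qed.

Lemma cont_gauss (b : R) w z : ccont (fun x => (expR (- (b * nrm (x - w) ^+ 2)))%:C) z.
Proof.
apply: (@ccont_real R (fun x => (- (b * nrm (x - w) ^+ 2))%:C) expR).
  exact: continuous_expR.
rewrite (_ : (fun _ => _) = fun x => - (b%:C * (nrm (x - w))%:C ^+ 2)); last first.
  by apply/funext => x; rewrite RCN RCM RCX.
apply/ccontN/ccontM; first exact: ccont_cst.
by apply/ccontX/ccont_nrm/ccontB; [exact: ccont_id|exact: ccont_cst].
Qed.

Lemma gauss_int (b : R) w : 0 < b ->
  itg (fun z => expR (- (b * nrm (z - w) ^+ 2))) /\
  Int (fun z => expR (- (b * nrm (z - w) ^+ 2))) = pi / b.
Proof.
move=> b0; set F := fun z => _.
have mF : mea F by apply: mea_cont => z; exact: cont_gauss.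
have mG m : measurable_fun [set: R] (fun y : R => (expR (- (b * (y - m) ^+ 2)))%:E).
  apply/measurable_EFinP; apply: measurableT_comp => //.
  apply: measurableT_comp => //; apply: measurable_funM => //.
  by apply: measurable_funX; exact: measurable_funB.
have E : (\int[@area R]_x (F (toC x))%:E = (pi / b)%:E)%E.
  rewrite /area fubini_tonelli1; [|exact/measurable_EFinP|]; last first.
    by move=> x; rewrite lee_fin expR_ge0.
  have pb : 0 <= pi / b :> R by rewrite divr_ge0 ?pi_ge0// ltW.
  pose r := Num.sqrt (pi / b : R).
  transitivity (\int[@lebesgue_measure R]_x (r%:E * (expR (- (b * (x - complex.Re w) ^+ 2)))%:E))%E.
    apply: eq_integral => x _; rewrite /fubini_F /=.
    transitivity (\int[@lebesgue_measure R]_y ((expR (- (b * (x - complex.Re w) ^+ 2)))%:E * (expR (- (b * (y - complex.Im w) ^+ 2)))%:E))%E.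
      apply: eq_integral => y _; rewrite -EFinM -expRD /F nrm_sqr; congr ((expR _)%:E).
      by rewrite !cReD !cImD !cReN !cImN /=; ring.
    rewrite ge0_integralZl//; try exact: mG; try by move=> ? _; rewrite lee_fin expR_ge0.
    by rewrite integral_gauss1// muleC.
  rewrite ge0_integralZl//; try exact: mG; try by move=> ? _; rewrite lee_fin expR_ge0.
    by rewrite integral_gauss1// -EFinM -expr2 sqr_sqrtr.
  by rewrite lee_fin sqrtr_ge0.
have iF : itg F.
  by apply: itg_ltyP => //; [move=> z; exact: expR_ge0|rewrite E ltry].
by split => //; apply/EFin_inj; rewrite Int_fineK.
Qed.

End RealIntegral.

(** * Integrals and limits of complex-valued functions *)

Section ComplexIntegral.
Context {R : realType}.
Implicit Types (f F G : R[i] -> R[i]) (z w c l m : R[i]).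

Definition cmea F := mea (fun z => complex.Re (F z)) /\ mea (fun z => complex.Im (F z)).

Definition citg F := itg (fun z => complex.Re (F z)) /\ itg (fun z => complex.Im (F z)).

Lemma cintE F : cintegral F = Int (fun z => complex.Re (F z)) +i* Int (fun z => complex.Im (F z)).
Proof. by []. Qed.

Lemma cmea_cont F : (forall z, ccont F z) -> cmea F.
Proof.
move=> cF; split; apply: mea_cont => z.
  apply: (@ccont_real R F id) => //; exact: cF.
exact: ccont_Im.
Qed.

Lemma holo_cmea F : holo F -> cmea F.
Proof. by move=> eF; apply: cmea_cont => z; exact: holo_ccont. Qed.

Lemma cmea_real (F : R[i] -> R) : mea F -> cmea (fun z => (F z)%:C).
Proof. by move=> mF; split => //; exact: mea_cst. Qed.

Lemma cmeaM F G : cmea F -> cmea G -> cmea (fun z => F z * G z).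
Proof.
move=> [a b] [c d]; split.
  by apply: eq_mea (meaB (meaM a c) (meaM b d)) => z; rewrite cReM.
by apply: eq_mea (meaD (meaM a d) (meaM b c)) => z; rewrite cImM.
Qed.

Lemma mea_nrm F : cmea F -> mea (fun z => nrm (F z)).
Proof.
move=> [a b]; rewrite (_ : (fun _ => _) = fun z => Num.sqrt (complex.Re (F z) ^+ 2 + complex.Im (F z) ^+ 2)).
  by exact: mea_sqrt (meaD (meaX 2 a) (meaX 2 b)).
by apply/funext => z; rewrite -nrm_sqr sqrtr_sqr ger0_norm ?nrm_ge0.
Qed.

Lemma cmeaJ F : cmea F -> cmea (fun z => cj (F z)).
Proof.
move=> [a b]; split; first by apply: eq_mea a => z; rewrite cReJ.
by apply: eq_mea (meaM (mea_cst (-1)) b) => z; rewrite cImJ mulN1r.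
Qed.

Lemma citg_cmea F : citg F -> cmea F.
Proof. by move=> [a b]; split; exact: itg_mea. Qed.

Lemma citg_le F (G : R[i] -> R) : cmea F -> itg G -> (forall z, nrm (F z) <= G z) -> citg F.
Proof.
move=> [a b] iG FG; split; (apply: (itg_le _ _ iG) => // z); apply: le_trans (FG z).
  exact: Re_le.
exact: Im_le.
Qed.

Lemma citg_nrm F : citg F -> itg (fun z => nrm (F z)).
Proof.
move=> h; have [a b] := h.
apply: (@itg_le R _ (fun z => `|complex.Re (F z)| + `|complex.Im (F z)|)).
- by apply: mea_nrm; exact: citg_cmea.
- by move=> z; rewrite ger0_norm ?nrm_ge0// nrm_le.
- by apply: itgD; exact: itg_abs.
Qed.

Lemma citgP F : citg F <-> cmea F /\ itg (fun z => nrm (F z)).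
Proof.
split=> [h|[m i]]; first by split; [exact: citg_cmea|exact: citg_nrm].
exact: citg_le m i _.
Qed.

Lemma citg_real (F : R[i] -> R) : itg F -> citg (fun z => (F z)%:C).
Proof. by move=> h; split => //; exact: itg0. Qed.

Lemma citgD F G : citg F -> citg G -> citg (fun z => F z + G z).
Proof.
move=> [a b] [c d]; split.
  by apply: eq_itg (itgD a c) => z; rewrite cReD.
by apply: eq_itg (itgD b d) => z; rewrite cImD.
Qed.

Lemma citgZ c F : citg F -> citg (fun z => c * F z).
Proof.
move=> [a b]; split.
  by apply: eq_itg (itgB (itgZ (complex.Re c) a) (itgZ (complex.Im c) b)) => z; rewrite cReM.
by apply: eq_itg (itgD (itgZ (complex.Re c) b) (itgZ (complex.Im c) a)) => z; rewrite cImM.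
Qed.

Lemma eq_citg F G : F =1 G -> citg F -> citg G.
Proof. by move=> /funext ->. Qed.

Lemma citgB F G : citg F -> citg G -> citg (fun z => F z - G z).
Proof.
move=> a /(citgZ (-1)) b; apply: eq_citg (citgD a b) => z.
by rewrite mulN1r.
Qed.

Lemma eq_cint F G : F =1 G -> cintegral F = cintegral G.
Proof. by move=> /funext ->. Qed.

Lemma cintD F G : citg F -> citg G ->
  cintegral (fun z => F z + G z) = cintegral F + cintegral G.
Proof.
move=> [a b] [c d]; rewrite !cintE; apply: complexP => /=.
  by rewrite -IntD//; apply: eq_Int => z; rewrite cReD.
by rewrite -IntD//; apply: eq_Int => z; rewrite cImD.
Qed.

Lemma cintZ c F : citg F -> cintegral (fun z => c * F z) = c * cintegral F.
Proof.
move=> [a b]; rewrite !cintE; apply: complexP; rewrite ?cReM ?cImM /=.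
  by rewrite -!IntZ// -IntB; [|exact: itgZ|exact: itgZ]; apply: eq_Int => z; rewrite cReM.
by rewrite -!IntZ// -IntD; [|exact: itgZ|exact: itgZ]; apply: eq_Int => z; rewrite cImM.
Qed.

Lemma cintB F G : citg F -> citg G ->
  cintegral (fun z => F z - G z) = cintegral F - cintegral G.
Proof.
move=> a b; rewrite -mulN1r -cintZ// -cintD//; last exact: citgZ.
by apply: eq_cint => z; rewrite mulN1r.
Qed.

Lemma cintJ F : citg F -> cintegral (fun z => cj (F z)) = cj (cintegral F).
Proof.
move=> [a b]; rewrite !cintE; apply: complexP => /=.
  by apply: eq_Int => z; rewrite cReJ.
by rewrite -IntN//; apply: eq_Int => z; rewrite cImJ.
Qed.

Lemma cint_real (F : R[i] -> R) : cintegral (fun z => (F z)%:C) = (Int F)%:C.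
Proof. by rewrite cintE /= Int0. Qed.

(** As in [cderiv_mvt], a unit [c] rotates the integral onto the positive axis, and only the real
    part of [c * F] has to be estimated. *)
Lemma nrm_cint F : citg F -> nrm (cintegral F) <= Int (fun z => nrm (F z)).
Proof.
move=> iF; have [e|D0] := eqVneq (cintegral F) 0.
  by rewrite e nrm0 Int_ge0// => z; exact: nrm_ge0.
set D := cintegral F in D0 *; pose c := cj D / (nrm D)%:C.
have nD : nrm D != 0 by rewrite nrm_eq0.
have nD0 : (nrm D)%:C != 0 :> R[i] by rewrite -nrm_eq0 nrmR normr_eq0.
have cD : c * D = (nrm D)%:C.
  by rewrite /c mulrAC (mulrC (cj D)) mulcJ RCX expr2 mulfK.
have nc : nrm c = 1 by rewrite /c nrmM nrmJ nrmV nrmR ger0_norm ?nrm_ge0// divff.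
rewrite -[leLHS]/(complex.Re (nrm D)%:C) -cD -cintZ// cintE /=.
have [a _] := citgZ c iF.
apply: le_Int => //; first exact: citg_nrm.
move=> z; apply: le_trans (ler_norm _) _; apply: le_trans (Re_le _) _.
by rewrite nrmM nc mul1r.
Qed.

Definition ccvg (u : nat -> R[i]) (l : R[i]) := forall e : R, 0 < e ->
  exists N, forall n, (N <= n)%N -> nrm (u n - l) < e.

Lemma ccvg_Re u l : ccvg u l -> complex.Re (u n) @[n --> \oo] --> complex.Re l.
Proof.
move=> H; apply/cvgrPdist_lt => e /H[N HN]; exists N => // n /= /HN.
by rewrite distrC -cReN -cReD; apply: le_lt_trans; exact: Re_le.
Qed.

Lemma ccvg_Im u l : ccvg u l -> complex.Im (u n) @[n --> \oo] --> complex.Im l.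
Proof.
move=> H; apply/cvgrPdist_lt => e /H[N HN]; exists N => // n /= /HN.
by rewrite distrC -cImN -cImD; apply: le_lt_trans; exact: Im_le.
Qed.

Lemma ccvg_ReIm u l : complex.Re (u n) @[n --> \oo] --> complex.Re l ->
  complex.Im (u n) @[n --> \oo] --> complex.Im l -> ccvg u l.
Proof.
move=> /cvgrPdist_lt h1 /cvgrPdist_lt h2 e e0.
have e2 : 0 < e / 2 by rewrite divr_gt0.
have [N _ H] := h1 _ e2; have [M _ H'] := h2 _ e2.
exists (maxn N M) => n; rewrite geq_max => /andP[/H /= a /H' /= b].
apply: le_lt_trans (nrm_le _) _; rewrite cReD cImD cReN cImN [e]splitr.
by rewrite distrC (distrC (complex.Im _)) ltrD.
Qed.

Lemma ccvg_uniq u l l' : ccvg u l -> ccvg u l' -> l = l'.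
Proof.
move=> h h'; apply: complexP.
  by apply: cvg_unique (ccvg_Re h) (ccvg_Re h').
by apply: cvg_unique (ccvg_Im h) (ccvg_Im h').
Qed.

Lemma ccvg_nrm u l : ccvg u l -> nrm (u n) @[n --> \oo] --> nrm l.
Proof.
move=> H; apply/cvgrPdist_lt => e /H[N HN]; exists N => // n /= /HN h.
rewrite ltr_distl; have := nrmBD l (u n) 0; have := nrmBD (u n) l 0.
by rewrite !subr0 (nrm_distC l) => a b; apply/andP; split; lra.
Qed.

Lemma ccvg_eq u v l : (forall n, u n = v n) -> ccvg u l -> ccvg v l.
Proof. by move=> /funext ->. Qed.

Lemma ccvg_cst c : ccvg (fun=> c) c.
Proof. by move=> e e0; exists 0%N => n _; rewrite subrr nrm0. Qed.

Lemma ccvg_real (a : nat -> R) (l : R) : a @ \oo --> l -> ccvg (fun n => (a n)%:C) l%:C.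
Proof. by move=> h; apply: ccvg_ReIm => //=; exact: cvg_cst. Qed.

Lemma ccvgD u v l m : ccvg u l -> ccvg v m -> ccvg (fun n => u n + v n) (l + m).
Proof.
move=> h1 h2; apply: ccvg_ReIm.
  under eq_fun do rewrite cReD; rewrite cReD; apply: cvgD; exact: ccvg_Re.
under eq_fun do rewrite cImD; rewrite cImD; apply: cvgD; exact: ccvg_Im.
Qed.

Lemma ccvgM u v l m : ccvg u l -> ccvg v m -> ccvg (fun n => u n * v n) (l * m).
Proof.
move=> h1 h2; have a := ccvg_Re h1; have b := ccvg_Im h1.
have c := ccvg_Re h2; have d := ccvg_Im h2; apply: ccvg_ReIm.
  by under eq_fun do rewrite cReM; rewrite cReM; apply: cvgB; apply: cvgM.
by under eq_fun do rewrite cImM; rewrite cImM; apply: cvgD; apply: cvgM.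
Qed.

Lemma ccvgZ c v m : ccvg v m -> ccvg (fun n => c * v n) (c * m).
Proof. by move=> h; apply: ccvgM => //; exact: ccvg_cst. Qed.

Lemma ccvgN v m : ccvg v m -> ccvg (fun n => - v n) (- m).
Proof.
move=> /(ccvgZ (-1)); rewrite mulN1r; apply: ccvg_eq => n; exact: mulN1r.
Qed.

Lemma ccvgB u v l m : ccvg u l -> ccvg v m -> ccvg (fun n => u n - v n) (l - m).
Proof. by move=> h1 /ccvgN h2; exact: ccvgD. Qed.

Lemma ccvg_shift u l N : ccvg u l -> ccvg (fun n => u (n + N)%N) l.
Proof. by move=> h e /h[M H]; exists M => n nM; apply: H; exact: leq_trans nM (leq_addr _ _). Qed.

Lemma ccvg_le u l (C : R) : ccvg u l -> (forall n, nrm (u n) <= C) -> nrm l <= C.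
Proof.
move=> /ccvg_nrm h H; rewrite -(cvg_lim _ h)//; apply: limr_le; first exact: cvgP h.
exact: nearW.
Qed.

Lemma cint_dominated (u : nat -> R[i] -> R[i]) F (G : R[i] -> R) :
  (forall n, cmea (u n)) -> (forall z, ccvg (u ^~ z) (F z)) -> itg G ->
  (forall n z, nrm (u n z) <= G z) ->
  citg F /\ ccvg (fun n => cintegral (u n)) (cintegral F).
Proof.
move=> mu uF iG uG.
have [i1 c1] := @Int_dominated R (fun n z => complex.Re (u n z)) (fun z => complex.Re (F z)) G
  (fun n => (mu n).1) (fun z => ccvg_Re (uF z)) iG (fun n z => le_trans (Re_le _) (uG n z)).
have [i2 c2] := @Int_dominated R (fun n z => complex.Im (u n z)) (fun z => complex.Im (F z)) G
  (fun n => (mu n).2) (fun z => ccvg_Im (uF z)) iG (fun n z => le_trans (Im_le _) (uG n z)).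
by split; [split|apply: ccvg_ReIm].
Qed.

End ComplexIntegral.

(** * The Gaussian mean value property *)

Section Bisection.
Context {R : realType}.

(** [P x y s] speaks of the square of side [s] with lower left corner [(x, y)]. If it failed, it
    would fail on some quarter, and so on nested squares shrinking to a point [(a, b)], against the
    local hypothesis there. The principle serves both as compactness and as Goursat's
    subdivision. *)
Lemma bisection (P : R -> R -> R -> Prop) (x0 y0 s0 : R) : 0 < s0 ->
  (forall x y s, 0 < s -> P x y (s / 2) -> P (x + s / 2) y (s / 2) ->
    P x (y + s / 2) (s / 2) -> P (x + s / 2) (y + s / 2) (s / 2) -> P x y s) ->
  (forall a b, exists2 d : R, 0 < d & forall x y s, 0 < s < d ->
    x <= a <= x + s -> y <= b <= y + s -> P x y s) ->
  P x0 y0 s0.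
Proof.
move=> s00 step loc; apply: contrapT => nP.
pose Q (s : R) (p q : R * R) := [/\ p.1 <= q.1 <= p.1 + s / 2,
  p.2 <= q.2 <= p.2 + s / 2 & ~ P q.1 q.2 (s / 2)].
have ex s p : exists q, 0 < s -> ~ P p.1 p.2 s -> Q s p q.
  have [[sp np]|H] := pselect (0 < s /\ ~ P p.1 p.2 s); last first.
    by exists p => sp np; case: H.
  have h0 : 0 <= s / 2 by rewrite divr_ge0// ltW.
  have bl (x : R) : x <= x <= x + s / 2 by rewrite lexx lerDl.
  have br (x : R) : x <= x + s / 2 <= x + s / 2 by rewrite lexx lerDl h0.
  apply: contrapT => H; apply: np; apply: step => //; apply: contrapT => n1; apply: H.
  - by exists p.
  - by exists (p.1 + s / 2, p.2).
  - by exists (p.1, p.2 + s / 2).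
  - by exists (p.1 + s / 2, p.2 + s / 2).
have [nx nxP] : exists nx : R -> R * R -> R * R,
    forall s p, 0 < s -> ~ P p.1 p.2 s -> Q s p (nx s p).
  have [f fP] := choice (fun sp : R * (R * R) => ex sp.1 sp.2).
  by exists (fun s p => f (s, p)) => s p; exact: (fP (s, p)).
pose sd n : R := s0 / 2 ^+ n.
have sd0 n : 0 < sd n by rewrite divr_gt0// exprn_gt0.
have sdS n : sd n.+1 = sd n / 2 by rewrite /sd exprSr invfM mulrA.
pose pt := fix pt n := if n is m.+1 then nx (sd m) (pt m) else (x0, y0).
have ptP n : ~ P (pt n).1 (pt n).2 (sd n).
  elim: n => [|n IH]; first by rewrite /sd expr0 divr1.
  by rewrite sdS /=; case: (nxP _ _ (sd0 n) IH).
have ptQ n : Q (sd n) (pt n) (pt n.+1) by exact: nxP.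
have lim (c : nat -> R) : (forall n, c n <= c n.+1 <= c n + sd n / 2) ->
    exists a, forall n, c n <= a <= c n + sd n.
  move=> cP.
  have nd n k : c n <= c (n + k)%N.
    elim: k => [|k IH]; first by rewrite addn0.
    by rewrite addnS; apply: le_trans IH _; case/andP: (cP (n + k)%N).
  have ni n k : c (n + k)%N + sd (n + k)%N <= c n + sd n.
    elim: k => [|k IH]; first by rewrite addn0.
    rewrite addnS; apply: le_trans IH; have /andP[_ h] := cP (n + k)%N.
    by rewrite sdS [leRHS](_ : _ = c (n + k)%N + sd (n + k)%N / 2 + sd (n + k)%N / 2);
      [rewrite lerD2r|rewrite -addrA -splitr].
  have ub n m : c m <= c n + sd n.
    have [nm|mn] := leqP n m.
      rewrite -(subnKC nm); apply: le_trans (ni n (m - n)%N).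
      by rewrite lerDl ltW.
    by rewrite -(subnKC (ltnW mn)); apply: le_trans (nd m (n - m)%N) _; rewrite lerDl ltW.
  have hs : has_sup (range c).
    split; first by exists (c 0%N), 0%N.
    by exists (c 0%N + sd 0%N) => _ [m _ <-].
  exists (sup (range c)) => n; apply/andP; split.
    by apply: ub_le_sup; [case: hs|exists n].
  by apply: ge_sup; [case: hs|move=> _ [m _ <-]].
have [a aP] : exists a, forall n, (pt n).1 <= a <= (pt n).1 + sd n.
  by apply: lim => n; case: (ptQ n).
have [b bP] : exists b, forall n, (pt n).2 <= b <= (pt n).2 + sd n.
  by apply: lim => n; case: (ptQ n).
have [d d0 dP] := loc a b.
have [n nd] : exists n, sd n < d.
  exists (Num.Def.archi_bound (s0 / d)); rewrite /sd ltr_pdivrMr ?exprn_gt0//.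
  by rewrite mulrC -ltr_pdivrMr//; exact: upper_nthrootP.
by apply: (ptP n); apply: dP; rewrite ?sd0 ?nd ?aP ?bP.
Qed.

End Bisection.

(** * Green's theorem on a square *)

Section Green.
Context {R : realType}.

Lemma Rintegral_est d (T : measurableType d) (mu : {measure set T -> \bar R})
    (D : set T) (f : T -> R) (c K m : R) : measurable D -> mu D = m%:E ->
  mu.-integrable D (EFin \o f) -> (forall x, D x -> `|f x - c| <= K) ->
  `|\int[mu]_(x in D) f x - c * m| <= K * m.
Proof.
move=> mD muD iD fc.
have ic r : mu.-integrable D (EFin \o (fun=> r)).
  apply: measurable_bounded_integrable => //; first by rewrite muD ltry.
  by exists `|r|; split; [exact: num_real|move=> x rx w _; exact: ltW].
have -> : m = fine (mu D) by rewrite muD.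
rewrite -!Rintegral_cst// -RintegralB//.
have ifc : mu.-integrable D (EFin \o (fun x => f x - c)) by exact: (integrableB mD iD (ic c)).
apply: le_trans (le_normr_Rintegral mD ifc) _; apply: le_Rintegral => //.
exact: integrable_norm.
Qed.

Lemma lebesgue_oc (a b : R) : a <= b -> lebesgue_measure `]a, b] = (b - a)%:E.
Proof.
move=> ab; rewrite lebesgue_measure_itv /= lte_fin; case: ltP => //= ba.
by rewrite (_ : b - a = 0)//; apply/eqP; rewrite subr_eq0 eq_le ab ba.
Qed.

Definition J (g : R -> R) (a b : R) := \int[@lebesgue_measure R]_(y in `]a, b]) g y.

Lemma J_integrable g a b : continuous g ->
  (@lebesgue_measure R).-integrable `]a, b] (EFin \o g).
Proof.
move=> cg.
have := continuous_compact_integrable (@segment_compact R a b) (continuous_subspaceT cg).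
by apply: integrableS => //; apply: subset_itvr; rewrite bnd_simp.
Qed.

Lemma J_add g a b c : continuous g -> a <= b -> b <= c -> J g a c = J g a b + J g b c.
Proof.
move=> cg ab bc.
have := @Rintegral_itvB R g (BRight a) (BRight c) b.
rewrite !bnd_simp -/(J g a c) -/(J g a b) -/(J g b c) => <- //.
  by rewrite addrC subrK.
exact: J_integrable.
Qed.

Lemma J_est g a b c K : continuous g -> a <= b ->
  (forall y, a <= y <= b -> `|g y - c| <= K) -> `|J g a b - c * (b - a)| <= K * (b - a).
Proof.
move=> cg ab H; apply: (@Rintegral_est _ _ (@lebesgue_measure R)) => //.
- exact: lebesgue_oc.
- exact: J_integrable.
- by move=> y; rewrite /= in_itv /= => /andP[ay yb]; apply: H; rewrite (ltW ay).
Qed.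

Lemma J0 g a b : (forall y, g y = 0) -> J g a b = 0.
Proof.
move=> g0; rewrite /J (_ : g = cst 0) ?Rintegral_cst ?mul0r//.
exact/funext.
Qed.

(** Half-open, so that adjacent rectangles are disjoint with a union of the same form, and the area
    integral is exactly additive under subdivision. *)
Definition rect (x1 x2 y1 y2 : R) : set (R * R) := `]x1, x2] `*` `]y1, y2].

Lemma rect_measurable x1 x2 y1 y2 : measurable (rect x1 x2 y1 y2).
Proof. by apply: measurableX; exact: measurable_itv. Qed.

Lemma area_rect x1 x2 y1 y2 : x1 <= x2 -> y1 <= y2 ->
  (@area R (rect x1 x2 y1 y2) = ((x2 - x1) * (y2 - y1))%:E)%E.
Proof.
move=> h1 h2; rewrite /area /rect product_measure1E; [|exact: measurable_itv|exact: measurable_itv].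
by rewrite EFinM; congr (_ * _)%E; exact: lebesgue_oc.
Qed.

Section Cell.
Variables (k : R * R -> R) (K : R).
Hypothesis mk : measurable_fun [set: R * R] k.
Hypothesis kK : forall w, `|k w| <= K.

Definition A2 x1 x2 y1 y2 := \int[@area R]_(w in rect x1 x2 y1 y2) k w.

Lemma A2_integrable x1 x2 y1 y2 : x1 <= x2 -> y1 <= y2 ->
  (@area R).-integrable (rect x1 x2 y1 y2) (EFin \o k).
Proof.
move=> h1 h2; apply: measurable_bounded_integrable.
- exact: rect_measurable.
- by apply: le_lt_trans (ltry ((x2 - x1) * (y2 - y1))); rewrite le_eqVlt; apply/orP; left; apply/eqP; exact: area_rect.
- exact: measurable_funS mk.
- exists K; split; first exact: num_real.
  by move=> x Kx w _; apply: le_trans (kK w) (ltW Kx).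
Qed.

Lemma A2_addx x1 x2 x3 y1 y2 : x1 <= x2 -> x2 <= x3 -> y1 <= y2 ->
  A2 x1 x3 y1 y2 = A2 x1 x2 y1 y2 + A2 x2 x3 y1 y2.
Proof.
move=> h1 h2 h3; rewrite /A2.
have E : rect x1 x3 y1 y2 = rect x1 x2 y1 y2 `|` rect x2 x3 y1 y2.
  apply/seteqP; split => [w|w] /=; rewrite /rect /= !in_itv /=.
    move=> [/andP[a b] c]; have [wx|wx] := leP w.1 x2; [left|right];
    by rewrite ?a ?b ?wx.
  move=> [] [/andP[a b] c]; split => //.
    by rewrite a (le_trans b h2).
  by rewrite b (le_lt_trans h1 a).
rewrite E Rintegral_setU//; try exact: rect_measurable.
  by rewrite -E; apply: A2_integrable => //; apply: le_trans h2.
rewrite disj_set2E; apply/eqP/seteqP; split => // w /=; rewrite /rect /= !in_itv /=.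
by move=> [[/andP[_ a] _] [/andP[b _] _]]; move: (lt_le_trans b a); rewrite ltxx.
Qed.

Lemma A2_addy x1 x2 y1 y2 y3 : x1 <= x2 -> y1 <= y2 -> y2 <= y3 ->
  A2 x1 x2 y1 y3 = A2 x1 x2 y1 y2 + A2 x1 x2 y2 y3.
Proof.
move=> h1 h2 h3; rewrite /A2.
have E : rect x1 x2 y1 y3 = rect x1 x2 y1 y2 `|` rect x1 x2 y2 y3.
  apply/seteqP; split => [w|w] /=; rewrite /rect /= !in_itv /=.
    move=> [c /andP[a b]]; have [wx|wx] := leP w.2 y2; [left|right];
    by rewrite ?a ?b ?wx.
  move=> [] [c /andP[a b]]; split => //.
    by rewrite a (le_trans b h3).
  by rewrite b (le_lt_trans h2 a).
rewrite E Rintegral_setU//; try exact: rect_measurable.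
  by rewrite -E; apply: A2_integrable => //; apply: le_trans h3.
rewrite disj_set2E; apply/eqP/seteqP; split => // w /=; rewrite /rect /= !in_itv /=.
by move=> [[_ /andP[_ a]] [_ /andP[b _]]]; move: (lt_le_trans b a); rewrite ltxx.
Qed.

Lemma A2_est x1 x2 y1 y2 c e : x1 <= x2 -> y1 <= y2 ->
  (forall w, x1 <= w.1 <= x2 -> y1 <= w.2 <= y2 -> `|k w - c| <= e) ->
  `|A2 x1 x2 y1 y2 - c * ((x2 - x1) * (y2 - y1))| <= e * ((x2 - x1) * (y2 - y1)).
Proof.
move=> h1 h2 H; apply: (@Rintegral_est _ _ (@area R)).
- exact: rect_measurable.
- exact: area_rect.
- exact: A2_integrable.
- by move=> w [/=]; rewrite !in_itv /= => /andP[a b] /andP[c1 d]; apply: H;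
    rewrite ?(ltW a) ?(ltW c1) ?b ?d.
Qed.

End Cell.

(* Goursat's bisection argument: the derivatives of [L] and [M] need not be
   continuous, only the divergence is. *)
Lemma green (L M k : R -> R -> R) (N K : R) : 0 < N ->
  (forall x, continuous (L x)) -> (forall y, continuous (M^~ y)) ->
  measurable_fun [set: R * R] (fun w => k w.1 w.2) ->
  (forall x y, `|k x y| <= K) ->
  (forall a b e, 0 < e -> exists2 d : R, 0 < d & exists l1 l2 m1 m2 : R,
    [/\ l1 + m2 = k a b,
      forall x y, `|x - a| < d -> `|y - b| < d -> `|k x y - k a b| <= e,
      forall x y, `|x - a| < d -> `|y - b| < d ->
        `|L x y - L a b - l1 * (x - a) - l2 * (y - b)| <= e * (`|x - a| + `|y - b|) &
      forall x y, `|x - a| < d -> `|y - b| < d ->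
        `|M x y - M a b - m1 * (x - a) - m2 * (y - b)| <= e * (`|x - a| + `|y - b|)]) ->
  (forall y, L (- N) y = 0) -> (forall y, L N y = 0) ->
  (forall x, M x (- N) = 0) -> (forall x, M x N = 0) ->
  \int[@area R]_(w in rect (- N) N (- N) N) k w.1 w.2 = 0.
Proof.
move=> N0 cL cM mk kK H L1 L2 M1 M2.
pose kk (w : R * R) := k w.1 w.2.
have kkK w : `|kk w| <= K by exact: kK.
pose gL x1 x2 y := L x2 y - L x1 y.
pose gM y1 y2 x := M x y2 - M x y1.
have cgL x1 x2 : continuous (gL x1 x2).
  by move=> y; apply: cvgB; exact: cL.
have cgM y1 y2 : continuous (gM y1 y2).
  by move=> x; apply: cvgB; exact: cM.
(* Boundary flux minus area integral. It is additive under subdivision, so a bound [e * s ^+ 2] on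
   small squares propagates to the large one. *)
pose I x1 x2 y1 y2 := J (gL x1 x2) y1 y2 + J (gM y1 y2) x1 x2 - A2 kk x1 x2 y1 y2.
have JD (g h : R -> R) a b : continuous g -> continuous h ->
    J (fun y => g y + h y) a b = J g a b + J h a b.
  by move=> cg ch; rewrite /J RintegralD//; exact: J_integrable.
have Ix x1 x2 x3 y1 y2 : x1 <= x2 -> x2 <= x3 -> y1 <= y2 ->
    I x1 x3 y1 y2 = I x1 x2 y1 y2 + I x2 x3 y1 y2.
  move=> h1 h2 h3; rewrite /I (A2_addx mk kkK h1 h2 h3) (J_add _ h1 h2)//.
  rewrite [J (gL x1 x3) y1 y2](_ : _ = J (gL x1 x2) y1 y2 + J (gL x2 x3) y1 y2); last first.
    by rewrite -JD//; congr (J _ _ _); apply/funext => y; rewrite /gL; ring.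
  ring.
have Iy x1 x2 y1 y2 y3 : x1 <= x2 -> y1 <= y2 -> y2 <= y3 ->
    I x1 x2 y1 y3 = I x1 x2 y1 y2 + I x1 x2 y2 y3.
  move=> h1 h2 h3; rewrite /I (A2_addy mk kkK h1 h2 h3) (J_add _ h2 h3)//.
  rewrite [J (gM y1 y3) x1 x2](_ : _ = J (gM y1 y2) x1 x2 + J (gM y2 y3) x1 x2); last first.
    by rewrite -JD//; congr (J _ _ _); apply/funext => x; rewrite /gM; ring.
  ring.
have Ie e : 0 < e -> `|I (- N) N (- N) N| <= e * (2 * N) ^+ 2.
  move=> e0.
  pose P x y s := `|I x (x + s) y (y + s)| <= e * s ^+ 2.
  have : P (- N) (- N) (2 * N); last first.
    by rewrite /P [- N + _](_ : _ = N)//; ring.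
  apply: (@bisection R P).
  - by rewrite mulr_gt0.
  - move=> x y s s0; rewrite /P => p1 p2 p3 p4.
    move: p1 p2 p3 p4; pose h := s / 2; rewrite -/h => p1 p2 p3 p4.
    have h0 : 0 <= h by rewrite divr_ge0// ltW.
    have sh : s = h + h by exact: splitr.
    have le1 (t : R) : t <= t + h by rewrite lerDl.
    have le2 (t : R) : t <= t + h + h by exact: le_trans (le1 t) (le1 _).
    have -> : I x (x + s) y (y + s) =
        (I x (x + h) y (y + h) + I x (x + h) (y + h) (y + h + h)) +
        (I (x + h) (x + h + h) y (y + h) + I (x + h) (x + h + h) (y + h) (y + h + h)).
      have ax (t : R) : t + s = t + h + h by rewrite sh addrA.
      rewrite (ax x) (ax y) (Ix x (x + h) (x + h + h) y _ (le1 _) (le1 _) (le2 _)).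
      rewrite (Iy x (x + h) y (y + h) _ (le1 _) (le1 _) (le1 _)).
      by rewrite (Iy (x + h) (x + h + h) y (y + h) _ (le1 _) (le1 _) (le1 _)).
    have -> : e * s ^+ 2 = (e * h ^+ 2 + e * h ^+ 2) + (e * h ^+ 2 + e * h ^+ 2).
      by rewrite sh; ring.
    by apply: le_trans (ler_normD _ _) _; apply: lerD; apply: le_trans (ler_normD _ _) _;
      apply: lerD.
  - move=> a b.
    (* Each of the two flux terms contributes [4 * e'] and the area term [e'], times [s ^+ 2]: nine
       in all. *)
    have e9 : 0 < e / 9 by rewrite divr_gt0.
    have [d d0 [l1 [l2 [m1 [m2 [kab kd Ld Md]]]]]] := H a b _ e9.
    exists d => // x y s /andP[s0 sd] /andP[xa ax] /andP[yb by_].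
    have close (t c u : R) : c <= u -> u <= c + s -> c <= t -> t <= c + s -> `|t - u| <= s.
      by move=> *; rewrite ler_norml; apply/andP; split; lra.
    have [xs ys] : x <= x + s /\ y <= y + s by rewrite !lerDl ltW.
    set e' := e / 9 in e9 kd Ld Md.
    have cl2 (t u : R) : x <= t <= x + s -> y <= u <= y + s ->
        [/\ `|t - a| < d, `|u - b| < d & `|t - a| + `|u - b| <= 2 * s].
      move=> /andP[t1 t2] /andP[u1 u2].
      have c1 := close t x a xa ax t1 t2; have c2 := close u y b yb by_ u1 u2.
      by split; [apply: le_lt_trans sd|apply: le_lt_trans sd|lra].
    have f1 : `|J (gL x (x + s)) y (y + s) - (l1 * s) * (y + s - y)| <= (4 * e' * s) * (y + s - y).
      apply: J_est => // t tP.
      have [p1 p2 p3] : [/\ `|x + s - a| < d, `|t - b| < d & `|x + s - a| + `|t - b| <= 2 * s].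
        by apply: cl2 => //; rewrite xs lexx.
      have [q1 q2 q3] : [/\ `|x - a| < d, `|t - b| < d & `|x - a| + `|t - b| <= 2 * s].
        by apply: cl2 => //; rewrite xs lexx.
      have A := Ld _ _ p1 p2; have B := Ld _ _ q1 q2.
      have := ler_wpM2l (ltW e9) p3; have := ler_wpM2l (ltW e9) q3 => C D.
      rewrite /gL [X in `|X|](_ : _ = (L (x + s) t - L a b - l1 * (x + s - a) - l2 * (t - b)) - (L x t - L a b - l1 * (x - a) - l2 * (t - b))); last by ring.
      apply: le_trans (ler_normB _ _) _; lra.
    have f2 : `|J (gM y (y + s)) x (x + s) - (m2 * s) * (x + s - x)| <= (4 * e' * s) * (x + s - x).
      apply: J_est => // t tP.
      have [p1 p2 p3] : [/\ `|t - a| < d, `|y + s - b| < d & `|t - a| + `|y + s - b| <= 2 * s].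
        by apply: cl2 => //; rewrite ys lexx.
      have [q1 q2 q3] : [/\ `|t - a| < d, `|y - b| < d & `|t - a| + `|y - b| <= 2 * s].
        by apply: cl2 => //; rewrite ys lexx.
      have A := Md _ _ p1 p2; have B := Md _ _ q1 q2.
      have := ler_wpM2l (ltW e9) p3; have := ler_wpM2l (ltW e9) q3 => C D.
      rewrite /gM [X in `|X|](_ : _ = (M t (y + s) - M a b - m1 * (t - a) - m2 * (y + s - b)) - (M t y - M a b - m1 * (t - a) - m2 * (y - b))); last by ring.
      apply: le_trans (ler_normB _ _) _; lra.
    have f3 : `|A2 kk x (x + s) y (y + s) - k a b * ((x + s - x) * (y + s - y))| <= e' * ((x + s - x) * (y + s - y)).
      apply: (A2_est mk kkK) => // w w1 w2.
      by have [p1 p2 _] := cl2 _ _ w1 w2; exact: kd.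
    have sx (t : R) : t + s - t = s by ring.
    move: f1 f2 f3; rewrite !sx -kab /P /I => f1 f2 f3.
    rewrite [X in `|X|](_ : _ = (J (gL x (x + s)) y (y + s) - l1 * s * s) + (J (gM y (y + s)) x (x + s) - m2 * s * s) - (A2 kk x (x + s) y (y + s) - (l1 + m2) * (s * s))); last by ring.
    apply: le_trans (ler_normB _ _) _.
    apply: le_trans (lerD (ler_normD _ _) (lexx _)) _.
    have -> : e * s ^+ 2 = 4 * e' * s * s + 4 * e' * s * s + e' * (s * s).
      by rewrite /e'; field.
    by rewrite !lerD.
have I0 : I (- N) N (- N) N = 0.
  apply/eqP; rewrite -normr_eq0 eq_le normr_ge0 andbT leNgt; apply/negP => i0.
  have q0 : 0 < (2 * N) ^+ 2 by rewrite exprn_gt0// mulr_gt0.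
  have := Ie (`|I (- N) N (- N) N| / (2 * (2 * N) ^+ 2)) _.
  rewrite divr_gt0// ?mulr_gt0// => /(_ isT).
  move: i0 q0; set a := `|_|; set q := _ ^+ 2 => i0 q0.
  have -> : a / (2 * q) * q = a / 2 by field; rewrite gt_eqF.
  lra.
move: I0; rewrite /I !J0; last 2 first.
- by move=> y; rewrite /gM M1 M2 subrr.
- by move=> y; rewrite /gL L1 L2 subrr.
by rewrite addr0 add0r => /eqP; rewrite oppr_eq0 => /eqP.
Qed.

End Green.

(** * Vanishing integrals of compactly supported dbar-derivatives *)

Section Pompeiu.
Context {R : realType}.
Implicit Types (u b f : R[i] -> R[i]) (z w h : R[i]).

Lemma nrmi : nrm ('i : R[i]) = 1.
Proof. by rewrite /Normc.normc expr0n add0r expr1n sqrtr1. Qed.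

Lemma rdiff_eps f z A B (e : R) : rdiff f z A B -> 0 < e -> exists2 d : R, 0 < d &
  forall h, nrm h < d -> nrm (f (z + h) - f z - A * h - B * cj h) <= e * nrm h.
Proof.
move=> [p [q [E cp cq <- <-]]] e0; have e2 : 0 < e / 2 by rewrite divr_gt0.
have [d d0 H] := cp _ e2; have [d' d'0 H'] := cq _ e2.
exists (Num.min d d'); first by rewrite lt_min d0.
move=> h; have := H h; have := H' h; rewrite !subr0 => h1 h2.
rewrite lt_min => /andP[/h2 {}h2 /h1 {}h1].
rewrite E [X in nrm X](_ : _ = (p h - p 0) * h + (q h - q 0) * cj h); last by ring.
apply: le_trans (nrmD _ _) _; rewrite !nrmM nrmJ -mulrDl ler_wpM2r ?nrm_ge0//.
by rewrite [e]splitr lerD// ltW.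
Qed.

(** Boundedness on a square is inherited from its quarters and holds near each point by continuity,
    so bisection gives it on the whole square. *)
Lemma box_bounded b N : 0 < N -> (forall z, ccont b z) -> exists K : R,
  forall z, nrm z < N -> nrm (b z) <= K.
Proof.
move=> N0 cb.
pose P x y s := exists K : R, forall z, x <= complex.Re z <= x + s ->
  y <= complex.Im z <= y + s -> nrm (b z) <= K.
have : P (- N) (- N) (2 * N).
  apply: (@bisection R P); first by rewrite mulr_gt0.
  - move=> x y s s0 [K1 H1] [K2 H2] [K3 H3] [K4 H4].
    exists (Num.max (Num.max K1 K2) (Num.max K3 K4)) => z xz yz.
    have h2 (t : R) : t + s / 2 + s / 2 = t + s by rewrite -addrA -splitr.
    move: xz yz => /andP[x1 x2] /andP[y1 y2]; rewrite -(h2 x) in x2; rewrite -(h2 y) in y2.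
    have [xs|/ltW xs] := leP (complex.Re z) (x + s / 2);
      have [ys|/ltW ys] := leP (complex.Im z) (y + s / 2); rewrite !le_max.
    + by rewrite H1 ?x1 ?xs ?y1 ?ys.
    + by rewrite H3 ?orbT ?x1 ?xs ?ys ?y2.
    + by rewrite H2 ?orbT ?xs ?x2 ?y1 ?ys.
    + by rewrite H4 ?orbT ?xs ?x2 ?ys ?y2.
  - move=> a c; have [d d0 H] := cb (a +i* c) 1 ltr01.
    exists (d / 2); first by rewrite divr_gt0.
    move=> x y s /andP[s0 sd] /andP[xa ax] /andP[yc cy].
    exists (nrm (b (a +i* c)) + 1) => z /andP[z1 z2] /andP[z3 z4].
    have : nrm (z - a +i* c) < d.
      apply: le_lt_trans (nrm_le _) _; rewrite !cReD !cImD !cReN !cImN /=.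
      have h1 : `|complex.Re z - a| <= s by rewrite ler_norml; apply/andP; split; lra.
      have h2 : `|complex.Im z - c| <= s by rewrite ler_norml; apply/andP; split; lra.
      lra.
    move=> /H h1; have := nrmBD (b z) (b (a +i* c)) 0; have := nrmBD (b (a +i* c)) (b z) 0.
    by rewrite !subr0 => h2 h3; move: h1 h2 h3 => *; apply: le_trans (nrm_ge0 _) _ || lra.
move=> [K H]; exists K => z zN.
have h1 := le_lt_trans (Re_le z) zN; have h2 := le_lt_trans (Im_le z) zN.
move: h1 h2; rewrite !ltr_norml => /andP[a1 a2] /andP[c1 c2].
by apply: H; rewrite [- N + _](_ : _ = N) ?(ltW a1) ?(ltW a2) ?(ltW c1) ?(ltW c2)//; ring.
Qed.

Lemma green_complex u b (N : R) : 0 < N ->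
  (forall z, exists A, rdiff u z A (b z)) -> (forall z, ccont b z) ->
  (forall z, N <= nrm z -> u z = 0 /\ b z = 0) -> citg b /\ cintegral b = 0.
Proof.
move=> N0 du cb supp.
have [K HK] : exists K : R, forall z, nrm (b z) <= K.
  have [K HK] := box_bounded N0 cb; exists (Num.max K 0) => z.
  have [zN|zN] := ltP (nrm z) N; first by rewrite le_max HK.
  by rewrite (supp z zN).2 nrm0 le_max lexx orbT.
have K0 : 0 <= K by apply: le_trans (HK 0); exact: nrm_ge0.
have ib : citg b.
  (* A Gaussian serves as the integrable majorant: [exp (N^2 - |z|^2)] is at least 1 on the support
     of [b]. *)
  apply: (@citg_le R b (fun z => (K * expR (N ^+ 2)) * expR (- (1 * nrm (z - 0) ^+ 2)))).
  - exact: cmea_cont.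
  - by apply: itgZ; have [] := @gauss_int R 1 0 ltr01.
  - move=> z; rewrite subr0 mul1r -mulrA -expRD.
    have [zN|zN] := ltP (nrm z) N; last first.
      by rewrite (supp z zN).2 nrm0 mulr_ge0 ?expR_ge0.
    apply: le_trans (HK z) _; rewrite -[leLHS]mulr1 ler_wpM2l// -expR0 ler_expR.
    by rewrite subr_ge0 lerXn2r ?nnegrE ?nrm_ge0 ?ltW.
split => //.
have cu z : ccont u z by have [A /rdiff_cont] := du z.
have lin_cont (l : R[i] -> R) : (forall z, `|l z| <= nrm z) -> (forall z w, l (z - w) = l z - l w) ->
    (forall x, continuous (fun y => l (u (x +i* y)))) /\
    (forall y, continuous (fun x => l (u (x +i* y)))).
  move=> l1 l2; split => x y.
    apply/cvgrPdist_lt => e e0; have [d d0 H] := cu (x +i* y) e e0.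
    apply/nbhs_normP; exists d => // t /= td; rewrite -l2.
    apply: le_lt_trans (l1 _) _; rewrite nrm_distC; apply: H.
    rewrite [X in nrm X](_ : _ = 'i * (t - y)%:C); first by rewrite nrmM nrmR distrC nrmi mul1r.
    by apply: complexP; rewrite /= ?mul0r ?mul1r ?mulr0 ?subrr ?subr0 ?add0r ?addr0.
  apply/cvgrPdist_lt => e e0; have [d d0 H] := cu (y +i* x) e e0.
  apply/nbhs_normP; exists d => // t /= td; rewrite -l2.
  apply: le_lt_trans (l1 _) _; rewrite nrm_distC; apply: H.
  rewrite [X in nrm X](_ : _ = (t - y)%:C); first by rewrite nrmR distrC.
  by apply: complexP; rewrite /= ?subrr.
(* The field [(l u, m u)] has divergence [kap b]. It is used twice: with [u = u1 + i u2], twice the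
   real part of the dbar-derivative is [d_x u1 - d_y u2], and twice its imaginary part is
   [d_x u2 + d_y u1]. *)
have aux (l m kap : R[i] -> R) :
    (forall z, `|l z| <= nrm z) -> (forall z w, l (z - w) = l z - l w) ->
    (forall z, `|m z| <= nrm z) -> (forall z w, m (z - w) = m z - m w) ->
    (forall z, `|kap z| <= 2 * nrm z) -> (forall z w, kap (z - w) = kap z - kap w) ->
    (forall A B, exists l1 l2 m1 m2 : R, [/\ l1 + m2 = kap B,
      forall x y, l (A * (x +i* y) + B * cj (x +i* y)) = l1 * x + l2 * y &
      forall x y, m (A * (x +i* y) + B * cj (x +i* y)) = m1 * x + m2 * y]) ->
    Int (fun z => kap (b z)) = 0.
  move=> lb ls mb ms kb ks H.
  have [cL _] := lin_cont _ lb ls; have [_ cM] := lin_cont _ mb ms.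
  pose k x y := kap (b (x +i* y)).
  have u0 x y : N <= `|x| \/ N <= `|y| -> u (x +i* y) = 0.
    move=> h; apply: (supp _ _).1; case: h => h; apply: le_trans h _.
      exact: (Re_le (x +i* y)).
    exact: (Im_le (x +i* y)).
  have l0 : l 0 = 0 by rewrite -(subrr 0) ls subrr.
  have m0 : m 0 = 0 by rewrite -(subrr 0) ms subrr.
  have k0 : kap 0 = 0 by rewrite -(subrr 0) ks subrr.
  have NN : `|N| = N by rewrite ger0_norm// ltW.
  have G : \int[@area R]_(w in rect (- N) N (- N) N) k w.1 w.2 = 0.
    apply: (@green R (fun x y => l (u (x +i* y))) (fun x y => m (u (x +i* y))) k N (2 * K)) => //.
    - apply: (@mea_cont R (fun z => kap (b z))) => z e e0.
      have e2 : 0 < e / 2 by rewrite divr_gt0.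
      have [d d0 Hd] := cb z _ e2; exists d => // w /Hd h; rewrite -RCB nrmR -ks.
      by apply: le_lt_trans (kb _) _; rewrite mulrC -ltr_pdivlMr.
    - by move=> x y; apply: le_trans (kb _) _; rewrite ler_wpM2l.
    - move=> x y e e0.
      have [A dA] := du (x +i* y); have [l1 [l2 [m1 [m2 [lk ll lm]]]]] := H A (b (x +i* y)).
      have e2 : 0 < e / 2 by rewrite divr_gt0.
      have [d d0 Hd] := rdiff_eps dA e0; have [d' d'0 Hd'] := cb (x +i* y) _ e2.
      exists (Num.min d d' / 2); first by rewrite divr_gt0// lt_min d0.
      exists l1, l2, m1, m2.
      have cl s t : `|s - x| < Num.min d d' / 2 -> `|t - y| < Num.min d d' / 2 ->
          [/\ nrm ((s - x) +i* (t - y)) <= `|s - x| + `|t - y|,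
             nrm ((s - x) +i* (t - y)) < d & nrm ((s - x) +i* (t - y)) < d'].
        move=> h1 h2; have h3 := nrm_le ((s - x) +i* (t - y)).
        have : nrm ((s - x) +i* (t - y)) < Num.min d d'.
          by apply: le_lt_trans h3 _; rewrite [X in _ < X]splitr ltrD.
        by rewrite lt_min => /andP[].
      have E s t : s +i* t = (x +i* y) + ((s - x) +i* (t - y)).
        by apply: complexP; rewrite /= addrC subrK.
      split => // s t h1 h2; have [c1 c2 c3] := cl s t h1 h2.
      + rewrite /k -ks; apply: le_trans (kb _) _; rewrite mulrC -ler_pdivlMr//.
        apply/ltW/Hd'; rewrite E [X in nrm X](_ : _ = ((s - x) +i* (t - y)))//; ring.
      + have := Hd _ c2; rewrite -E => h.
        apply: le_trans (le_trans _ (ler_wpM2l (ltW e0) c1)); last exact: h.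
        apply: le_trans (lb _); rewrite le_eqVlt; apply/orP; left; apply/eqP; congr `|_|.
        by rewrite -addrA -opprD -ll -!ls; congr l; ring.
      + have := Hd _ c2; rewrite -E => h.
        apply: le_trans (le_trans _ (ler_wpM2l (ltW e0) c1)); last exact: h.
        apply: le_trans (mb _); rewrite le_eqVlt; apply/orP; left; apply/eqP; congr `|_|.
        by rewrite -addrA -opprD -lm -!ms; congr m; ring.
    - by move=> y; rewrite u0// normrN NN; left.
    - by move=> y; rewrite u0// NN; left.
    - by move=> y; rewrite u0// normrN NN; right.
    - by move=> y; rewrite u0// NN; right.
  rewrite -G /Int [RHS]Rintegral_mkcond; apply: eq_Rintegral => w _.
  rewrite patchE; case: ifPn => // /negP wn.
  apply/eqP; apply: contraT => kw; exfalso; apply: wn; rewrite inE /rect /= !in_itv /=.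
  have wN : nrm (toC w) < N.
    rewrite ltNge; apply/negP => h; move: kw; rewrite (supp _ h).2 k0 eqxx.
    by [].
  have h1 := le_lt_trans (Re_le _) wN; have h2 := le_lt_trans (Im_le _) wN.
  move: h1 h2; rewrite /toC /= !ltr_norml => /andP[-> /ltW ->] /andP[-> /ltW ->].
  by [].
have r1 : Int (fun z => 2 * complex.Re (b z)) = 0.
  apply: (aux (@complex.Re R) (fun z => - complex.Im z) (fun z => 2 * complex.Re z)).
  - exact: Re_le.
  - by move=> z w; rewrite cReD cReN.
  - by move=> z; rewrite normrN Im_le.
  - by move=> z w; rewrite cImD cImN opprD.
  - by move=> z; rewrite normrM ger0_norm// ler_wpM2l// Re_le.
  - by move=> z w; rewrite cReD cReN mulrBr.
  - move=> [a1 a2] [b1 b2]; exists (a1 + b1), (b2 - a2), (- a2 - b2), (b1 - a1).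
    by split => [|x y|x y] /=; ring.
have r2 : Int (fun z => 2 * complex.Im (b z)) = 0.
  apply: (aux (@complex.Im R) (@complex.Re R) (fun z => 2 * complex.Im z)).
  - exact: Im_le.
  - by move=> z w; rewrite cImD cImN.
  - exact: Re_le.
  - by move=> z w; rewrite cReD cReN.
  - by move=> z; rewrite normrM ger0_norm// ler_wpM2l// Im_le.
  - by move=> z w; rewrite cImD cImN mulrBr.
  - move=> [a1 a2] [b1 b2]; exists (a2 + b2), (a1 - b1), (a1 + b1), (b2 - a2).
    by split => [|x y|x y] /=; ring.
move: ib r1 r2 => [i1 i2]; rewrite !IntZ// => /eqP r1 /eqP r2.
rewrite cintE; apply: complexP => /=; apply/eqP.
  by move: r1; rewrite mulf_eq0 pnatr_eq0.
by move: r2; rewrite mulf_eq0 pnatr_eq0.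
Qed.

End Pompeiu.

(** * Radial test forms and the mean value property *)

Section MeanValue.
Context {R : realType}.
Implicit Types (f : R[i] -> R[i]) (z w h : R[i]).

(* The test form is [f(z) E(|z - w|^2) / (z - w)], whose [dbar]-derivative is
   [f(z) E'(|z - w|^2)]; at [z = w] the junk value [1 / 0 = 0] is the right one. *)
Lemma radial_test f w (E dE : R -> R) (N : R) : holo f -> 0 < N ->
  (forall s : R, is_derive s 1 E (dE s)) -> continuous dE -> E 0 = 0 ->
  (forall s, N <= s -> E s = 0 /\ dE s = 0) ->
  citg (fun z => f z * (dE (nrm (z - w) ^+ 2))%:C) /\
  cintegral (fun z => f z * (dE (nrm (z - w) ^+ 2))%:C) = 0.
Proof.
move=> ef N0 dE_ cdE E0 suppE.
pose u z := f z * ((E (nrm (z - w) ^+ 2))%:C / (z - w)).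
(* Beyond the radius [N + 1 + |w|] one has [|z - w| >= N + 1], hence [|z - w|^2 >= N], and the test
   form vanishes. *)
have N1 : 0 < N + 1 + nrm w by rewrite ltr_wpDr ?nrm_ge0// addr_gt0.
have far z : N + 1 + nrm w <= nrm z -> N <= nrm (z - w) ^+ 2.
  move=> zN; have := nrmD (z - w) w; rewrite subrK => h.
  have h3 : N + 1 <= nrm (z - w) by lra.
  nra.
have cn z : ccont (fun x => (nrm (x - w) ^+ 2)%:C) z by exact: rdiff_cont (rdiff_nrm2 z w).
apply: (@green_complex R u _ (N + 1 + nrm w)) => //.
- move=> z; have [l fl] := ef z.
  have [zw|zw] := eqVneq z w; last first.
    have h1 := rdiff_real (rdiff_nrm2 z w) (dE_ (nrm (z - w) ^+ 2)).
    have zw0 : z - w != 0 by rewrite subr_eq0.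
    have h2 := @cderivV R (fun x => x - w) z _ zw0 (cderivB (cderiv_id z) (cderiv_cst w z)).
    have h := rdiffM fl (rdiffM h1 h2).
    eexists; apply: rdiff_eq h; first by reflexivity.
    by rewrite mul0r mulr0 addr0 add0r mulfK.
  (* At the singular point [E s = e s * s] and [|h|^2 / h = cj h], so the quotient is
     [e (|h|^2) * cj h]: linear slope zero, continuous conjugate-linear slope. *)
  subst z; have [e [ee ce e0]] := is_derive_cara (dE_ 0).
  have h : rdiff (fun z => (E (nrm (z - w) ^+ 2))%:C / (z - w)) w 0 (dE 0)%:C.
    exists (fun=> 0), (fun h => (e (nrm h ^+ 2))%:C); split => //.
    + move=> h; rewrite subrr invr0 mulr0 subr0 mul0r add0r.
      rewrite [w + h - w](_ : _ = h); last by ring.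
      have := ee (nrm h ^+ 2); rewrite add0r E0 subr0 => ->.
      rewrite RCM -mulcJ; have [->|h0] := eqVneq h 0; first by rewrite !mul0r !mulr0 ?mul0r conjc0 mulr0.
      by rewrite [h * _]mulrC !mulrA mulfK.
    + exact: ccont_cst.
    + apply: (@ccont_real R (fun h => (nrm h ^+ 2)%:C) e); first by rewrite /= nrm0 expr0n.
      have := rdiff_cont (rdiff_nrm2 0 (0 : R[i])); congr (ccont _ _).
      by apply/funext => x; rewrite subr0.
    + by rewrite nrm0 expr0n e0.
  have := rdiffM fl h; rewrite subrr nrm0 expr0n /= => h'.
  by eexists; apply: rdiff_eq h'; [reflexivity|rewrite mul0r add0r].
- move=> z; apply: ccontM; first exact: holo_ccont.
  apply: (@ccont_real R (fun x => (nrm (x - w) ^+ 2)%:C) dE); last exact: cn.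
  exact: cdE.
- by move=> z /far /suppE[e1 e2]; rewrite /u e1 e2 mul0r !mulr0.
Qed.

Lemma is_derive_quad (E : R -> R) (x l K : R) :
  (forall t, `|E (x + t) - E x - l * t| <= K * t ^+ 2) -> is_derive x 1 E l.
Proof.
move=> H; have K0 : 0 <= K.
  by have := le_trans (normr_ge0 _) (H 1); rewrite expr1n mulr1.
apply: (@cara_is_derive R _ _ _ (fun t => if t == 0 then l else (E (x + t) - E x) / t)).
- by move=> t; case: eqVneq => [->|t0]; rewrite ?addr0 ?subrr ?mulr0// divfK.
- apply/cvgrPdist_lt => e e0; rewrite eqxx; apply/nbhs_normP.
  have K1 : 0 < K + 1 by rewrite ltr_wpDl.
  exists (e / (K + 1)); first by rewrite /= divr_gt0.
  move=> t /=; rewrite sub0r normrN ltr_pdivlMr// => te.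
  case: eqVneq => [_|t0]; first by rewrite subrr normr0.
  have t0' : 0 < `|t| by rewrite normr_gt0.
  rewrite distrC -(ltr_pM2r t0') -normrM mulrBl divfK//.
  apply: le_lt_trans (H t) _; rewrite -real_normK ?num_real// expr2 mulrA ltr_pM2r//.
  by apply: le_lt_trans te; rewrite mulrC ler_wpM2l// lerDl.
- by rewrite eqxx.
Qed.

Lemma is_derive_expRc (c x : R) :
  is_derive x 1 (fun u => expR (c * u)) (c * expR (c * x)).
Proof.
have h1 : is_derive x 1 (fun u : R => c * u) c.
  by apply: is_derive_eq (is_derive_cMX c x 1) _; rewrite expr0 !mulr1.
have := @is_derive1_comp R expR (fun u => c * u) x _ _ (is_derive_expR (c * x)) h1.
by move=> h; apply: is_derive_eq h _; rewrite mulrC.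
Qed.

(** The positive part. Its square is continuously differentiable, which makes [pp (1 - a * s) ^+ 2],
    zero once [a * s >= 1], a cutoff profile to which [radial_test] applies. *)
Definition pp (x : R) := (x + `|x|) / 2.

Lemma ppE x : pp x = if 0 <= x then x else 0.
Proof.
rewrite /pp; case: ifPn => [x0|]; first by rewrite ger0_norm//; field.
by rewrite -ltNge => x0; rewrite ltr0_norm// subrr mul0r.
Qed.

Lemma pp_ge0 x : 0 <= pp x. Proof. by rewrite ppE; case: ifP. Qed.

Lemma pp_le_expR x : pp (1 - x) <= expR (- x).
Proof. by rewrite ppE; case: ifP => _; [exact: expR_ge1Dx|exact: expR_ge0]. Qed.

Lemma pp_continuous : continuous pp.
Proof.
move=> x; apply: cvgM; last exact: cvg_cst.
by apply: cvgD; [exact: cvg_id|apply: cvg_norm; exact: cvg_id].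
Qed.

Lemma is_derive_pp2 (a s : R) : 0 <= a ->
  is_derive s 1 (fun s => pp (1 - a * s) ^+ 2) (- (2 * a * pp (1 - a * s))).
Proof.
move=> a0; apply: (@is_derive_quad _ _ _ (a ^+ 2)) => t.
rewrite [1 - a * (s + t)](_ : _ = (1 - a * s) - a * t); last by ring.
set x := 1 - a * s; set y := a * t.
rewrite [X in `|X|](_ : _ = pp (x - y) ^+ 2 - pp x ^+ 2 + 2 * pp x * y); last by rewrite /y; ring.
rewrite -exprMn -/y !ppE; case: ifPn => [xy|]; case: ifPn => [x0|];
  rewrite -?ltNge ler_norml => *; apply/andP; split; nra.
Qed.

(** [radial_test] is applied to [g = f - f w] with a Gaussian profile cut off at a large radius,
    minus a narrow bump that enforces [E 0 = 0]. The derivative of the bump concentrates at [w],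
    where [g] vanishes; hence the Gaussian integral of [g] is zero, and that of the constant [f w]
    is explicit. *)
Lemma gauss_mean f w (al : R) : 0 < al -> holo f ->
  citg (fun z => f z * (expR (- (al * nrm (z - w) ^+ 2)))%:C) ->
  cintegral (fun z => f z * (expR (- (al * nrm (z - w) ^+ 2)))%:C) = f w * (pi / al)%:C.
Proof.
move=> al0 ef iF; pose e s := expR (- (al * s)).
pose g z := f z - f w.
have eg : holo g by exact: holo_B ef (holo_cst _).
have [ig Ig] := gauss_int w al0.
have ige : citg (fun z => g z * (e (nrm (z - w) ^+ 2))%:C).
  apply: eq_citg (citgB iF (citgZ (f w) (citg_real ig))) => z.
  by rewrite /g /e; ring.
pose ws n s := (al * pp (1 - n.+1%:R^-1 * s) ^+ 2 + 2 * n.+1%:R^-1 * pp (1 - n.+1%:R^-1 * s)) * e s.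
pose vs n s := 2 * n.+1%:R * pp (1 - n.+1%:R * s) : R.
have n1 n : 0 < n.+1%:R :> R by [].
have n2 n : 0 < n.+1%:R^-1 :> R by rewrite invr_gt0.
have ws_ge0 n s : 0 <= ws n s.
  apply: mulr_ge0 (expR_ge0 _); apply: addr_ge0.
    by apply: mulr_ge0 (sqr_ge0 _); exact: ltW.
  by apply: mulr_ge0 (pp_ge0 _); apply: mulr_ge0 => //; exact: ltW.
have pp1 n s : 0 <= s -> 0 <= pp (1 - n.+1%:R^-1 * s) <= 1.
  move=> s0; rewrite pp_ge0 /= ppE; case: ifP => _; last exact: ler01.
  by rewrite gerBl mulr_ge0// ltW.
have ws_le n s : 0 <= s -> ws n s <= (al + 2) * e s.
  move=> s0; rewrite ler_wpM2r ?expR_ge0//.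
  have /andP[h1 h2] := pp1 n s s0; apply: lerD.
    by rewrite ler_piMr ?(ltW al0)// exprn_ile1.
  rewrite -mulrA ler_piMr// mulr_ile1// ?(ltW (n2 n))//.
  by rewrite invf_le1// ler1n.
have ws_lim s : ws n s @[n --> \oo] --> al * e s.
  have h : (fun n => n.+1%:R^-1 : R) @ \oo --> (0 : R) by exact: cvg_harmonic.
  have h1 : (fun n => pp (1 - n.+1%:R^-1 * s)) @ \oo --> (1 : R).
    have p1 : pp (1 - 0 * s) = 1 by rewrite mul0r subr0 ppE ler01.
    rewrite -[X in _ --> X]p1.
    apply: continuous_cvg; first exact: pp_continuous.
    by apply: cvgB; [exact: cvg_cst|apply: cvgM => //; exact: cvg_cst].
  have -> : al * e s = (al * (1 * 1) + 2 * 0 * 1) * e s by rewrite !mulr1 mulr0 addr0.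
  apply: cvgM; last exact: cvg_cst.
  apply: cvgD.
    apply: cvgM; first exact: cvg_cst.
    by under eq_fun do rewrite expr2; exact: cvgM.
  by apply: cvgM => //; apply: cvgM => //; exact: cvg_cst.
have cnr z : ccont (fun x => (nrm (x - w) ^+ 2)%:C) z by exact: rdiff_cont (rdiff_nrm2 z w).
have cpp (a : R) : continuous (fun s => pp (1 - a * s)).
  move=> s; apply: continuous_cvg; first exact: pp_continuous.
  by apply: cvgB; [exact: cvg_cst|apply: cvgM; [exact: cvg_cst|exact: cvg_id]].
have ce : continuous e.
  move=> s; apply: continuous_cvg; first exact: continuous_expR.
  by apply: cvgN; apply: cvgM; [exact: cvg_cst|exact: cvg_id].
have cpp2 (a : R) : continuous (fun s => pp (1 - a * s) ^+ 2).
  by move=> s; under eq_fun do rewrite expr2; apply: cvgM; exact: cpp.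
have cws n : continuous (ws n).
  move=> s; apply: cvgM; last exact: ce.
  by apply: cvgD; (apply: cvgM; first exact: cvg_cst); [exact: cpp2|exact: cpp].
have cvs n : continuous (vs n).
  by move=> s; apply: cvgM; [exact: cvg_cst|exact: cpp].
have cm (q : R -> R) : continuous q -> cmea (fun z => g z * (q (nrm (z - w) ^+ 2))%:C).
  move=> cq; apply: cmea_cont => z; apply: ccontM; first exact: holo_ccont.
  by apply: (@ccont_real R (fun x => (nrm (x - w) ^+ 2)%:C) q) => //; exact: cq.
have itG : itg (fun z => (al + 2) * nrm (g z * (e (nrm (z - w) ^+ 2))%:C)).
  by apply: itgZ; exact: citg_nrm.
have ws_dom n z : nrm (g z * (ws n (nrm (z - w) ^+ 2))%:C) <= (al + 2) * nrm (g z * (e (nrm (z - w) ^+ 2))%:C).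
  rewrite !nrmM !nrmR !ger0_norm ?expR_ge0// [X in _ <= X]mulrCA ler_wpM2l ?nrm_ge0// ws_le//.
  exact: sqr_ge0.
have iws n : citg (fun z => g z * (ws n (nrm (z - w) ^+ 2))%:C).
  exact: citg_le (cm _ (cws n)) itG (ws_dom n).
have [_ cvI] := @cint_dominated R (fun n z => g z * (ws n (nrm (z - w) ^+ 2))%:C)
  (fun z => g z * (al * e (nrm (z - w) ^+ 2))%:C) _ (fun n => cm _ (cws n))
  (fun z => ccvgZ (g z) (ccvg_real (ws_lim (nrm (z - w) ^+ 2)))) itG ws_dom.
set L := cintegral _ in cvI.
(* For large [m], [vs m] is supported where [|g| < eps], and it is bounded by
   [2 m exp (- m |z - w|^2)], whose integral is [2 * pi] for every [m]. *)
have small (eps : R) : 0 < eps -> nrm L <= eps * (2 * pi).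
  move=> eps0; have [d d0 Hd] := holo_ccont w eg eps0.
  have [N HN] : exists N, N.+1%:R^-1 < d ^+ 2.
    have d2 : 0 <= (d ^+ 2)^-1 by rewrite invr_ge0 sqr_ge0.
    exists (Num.Def.archi_bound (d ^+ 2)^-1).
    rewrite invf_plt ?posrE ?exprn_gt0//.
    by apply: lt_trans (archi_boundP d2) _; rewrite ltr_nat.
  apply: ccvg_le (ccvg_shift N cvI) _ => n; set m := (n + N)%N.
  have md : m.+1%:R^-1 < d ^+ 2.
    apply: le_lt_trans HN; rewrite lef_pV2 ?posrE// ler_nat ltnS.
    exact: leq_addl.
  have vs_dom z : nrm (g z * (vs m (nrm (z - w) ^+ 2))%:C) <=
      (eps * (2 * m.+1%:R)) * expR (- (m.+1%:R * nrm (z - w) ^+ 2)).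
    have [zd|zd] := ltP (nrm (z - w)) d.
      have : nrm (g z) < eps by have := Hd z zd; rewrite /g subrr subr0.
      move=> ge; rewrite nrmM nrmR ger0_norm; last first.
        by apply: mulr_ge0 (pp_ge0 _); exact: mulr_ge0.
      rewrite /vs -[X in _ <= X]mulrA; apply: ler_pM; rewrite ?nrm_ge0//.
      - by apply: mulr_ge0 (pp_ge0 _).
      - exact: ltW.
      - by rewrite ler_wpM2l// pp_le_expR.
    rewrite (_ : vs m _ = 0) ?mulr0 ?nrm0; last first.
      rewrite /vs ppE; case: ifPn => [h|]; rewrite ?mulr0//.
      exfalso; move: h; rewrite subr_ge0 -ler_pdivlMl// mulr1 leNgt => /negP; apply.
      by apply: lt_le_trans md _; rewrite lerXn2r ?nnegrE ?nrm_ge0// ltW.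
    by rewrite !mulr_ge0 ?expR_ge0// ltW.
  have [i1 i2] := gauss_int w (n1 m).
  have ivs : citg (fun z => g z * (vs m (nrm (z - w) ^+ 2))%:C).
    by apply: citg_le (cm _ (cvs m)) (itgZ _ i1) vs_dom.
  have := @radial_test g w (fun s => pp (1 - m.+1%:R^-1 * s) ^+ 2 * e s - pp (1 - m.+1%:R * s) ^+ 2)
    (fun s => vs m s - ws m s) m.+1%:R eg (n1 m).
  have e1 : citg (fun z => g z * (ws m (nrm (z - w) ^+ 2))%:C) by exact: iws.
  move=> [].
  - move=> s.
    have d1 := is_derive_pp2 s (ltW (n2 m)); have d2 := is_derive_pp2 s (ltW (n1 m)).
    have d3 : is_derive s 1 e (- al * e s).
      have -> : e = (fun u => expR (- al * u)) by apply/funext => u; rewrite /e mulNr.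
      exact: is_derive_expRc.
    apply: (is_derive_eq (is_deriveB (is_deriveM d1 d3) d2)).
    by rewrite /GRing.scale /= /vs /ws; ring.
  - by move=> s; apply: cvgB; [exact: cvs|exact: cws].
  - by rewrite !mulr0 /e mulr0 oppr0 expR0 mulr1 subrr.
  - move=> s ms; have m1 : 1 <= m.+1%:R :> R by rewrite ler1n.
    have s1 : pp (1 - m.+1%:R^-1 * s) = 0.
      rewrite ppE; case: ifPn => //; rewrite subr_ge0 ler_pdivrMl// mulr1 => sm.
      by rewrite (_ : s = m.+1%:R) ?mulVf ?subrr//; apply/eqP; rewrite eq_le sm ms.
    have s2 : pp (1 - m.+1%:R * s) = 0.
      rewrite ppE; case: ifPn => //; rewrite subr_ge0 => sm.
      by apply/eqP; rewrite eq_le subr_ge0 sm andbT subr_le0; nra.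
    by rewrite /vs /ws s1 s2 !expr0n !mulr0 mul0r addr0 mul0r !subr0.
  move=> _; rewrite (eq_cint (G := fun z => g z * (vs m (nrm (z - w) ^+ 2))%:C - g z * (ws m (nrm (z - w) ^+ 2))%:C)); last first.
    by move=> z; rewrite RCB mulrBr.
  rewrite cintB// => /eqP; rewrite subr_eq0 => /eqP <-.
  apply: le_trans (nrm_cint ivs) _.
  apply: le_trans (le_Int (citg_nrm ivs) (itgZ _ i1) vs_dom) _.
  rewrite IntZ// i2 (_ : _ * (pi / _) = eps * (2 * pi))//.
  by rewrite -!mulrA; congr (_ * (_ * _)); rewrite mulrCA divff ?mulr1// gt_eqF.
have L0 : L = 0.
  apply/eqP; rewrite -nrm_eq0 eq_le nrm_ge0 andbT leNgt; apply/negP => h.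
  have p2 : 0 < 2 * pi :> R by rewrite mulr_gt0// pi_gt0.
  have := small (nrm L / (2 * (2 * pi))) _.
  rewrite divr_gt0 ?mulr_gt0 ?pi_gt0// => /(_ isT).
  move: h p2; move: (nrm L) (2 * pi) => a q h p2.
  have -> : a / (2 * q) * q = a / 2 by field; rewrite gt_eqF.
  lra.
move: L0; rewrite /L (eq_cint (G := fun z => al%:C * (g z * (e (nrm (z - w) ^+ 2))%:C))); last first.
  by move=> z; rewrite RCM mulrCA.
rewrite cintZ// => /eqP; rewrite mulf_eq0 => /orP[/eqP[/eqP]|/eqP]; first by rewrite gt_eqF.
rewrite (eq_cint (G := fun z => f z * (e (nrm (z - w) ^+ 2))%:C - f w * (e (nrm (z - w) ^+ 2))%:C)); last first.
  by move=> z; rewrite /g mulrBl.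
rewrite cintB//; last by apply: citgZ; exact: citg_real.
rewrite cintZ; last exact: citg_real.
by rewrite cint_real Ig => /eqP; rewrite subr_eq0 => /eqP.
Qed.

End MeanValue.

(** * The Fock space *)

Section Growth.
Context {R : realType}.
Implicit Types (v f g : R[i] -> R[i]) (z w p : R[i]) (c al : R).

Definition gr c v := exists2 C : R, 0 <= C & forall z, nrm (v z) <= C * expR (c * nrm z ^+ 2).

Lemma gr_mono c c' v : c <= c' -> gr c v -> gr c' v.
Proof.
move=> cc [C C0 H]; exists C => // z; apply: le_trans (H z) _.
by rewrite ler_wpM2l// ler_expR ler_wpM2r// sqr_ge0.
Qed.

Lemma grM c c' v g : gr c v -> gr c' g -> gr (c + c') (fun z => v z * g z).
Proof.
move=> [C C0 H] [C' C'0 H']; exists (C * C'); first exact: mulr_ge0.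
move=> z; rewrite nrmM mulrDl expRD mulrACA; apply: ler_pM; rewrite ?nrm_ge0//.
Qed.

Lemma gr_cst c (a : R[i]) : 0 <= c -> gr c (fun=> a).
Proof.
move=> c0; exists (nrm a); first exact: nrm_ge0.
by move=> z; rewrite ler_peMr ?nrm_ge0// -expR0 ler_expR mulr_ge0// sqr_ge0.
Qed.

(** Completing the square. A linear exponent is absorbed by an arbitrarily small quadratic one, so
    kernels and polynomials satisfy [gr c] for every positive [c]. *)
Lemma exp_lin_quad (b c x : R) : 0 < c -> b * x <= b ^+ 2 / (4 * c) + c * x ^+ 2.
Proof.
move=> c0; rewrite -subr_ge0.
have -> : b ^+ 2 / (4 * c) + c * x ^+ 2 - b * x = c * (x - b / (2 * c)) ^+ 2.
  by field; rewrite gt_eqF.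
by rewrite mulr_ge0 ?sqr_ge0 ?ltW.
Qed.

Lemma gr_lin c v (b C : R) : 0 < c -> 0 <= C ->
  (forall z, nrm (v z) <= C * expR (b * nrm z)) -> gr c v.
Proof.
move=> c0 C0 H; exists (C * expR (b ^+ 2 / (4 * c))); first by rewrite mulr_ge0 ?expR_ge0.
move=> z; apply: le_trans (H z) _; rewrite -mulrA -expRD ler_wpM2l// ler_expR.
exact: exp_lin_quad.
Qed.

Lemma gr_cexp c (a b : R[i]) : 0 < c -> gr c (fun z => cexp (a * z + b)).
Proof.
move=> c0; apply: (@gr_lin _ _ (nrm a) (expR (nrm b))) => // z.
apply: le_trans (cexp_le _) _; rewrite -expRD ler_expR addrC.
by apply: le_trans (nrmD _ _) _; rewrite nrmM.
Qed.

Lemma gr_sub c p : 0 < c -> gr c (fun z => z - p).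
Proof.
move=> c0; apply: (@gr_lin _ _ 1 (expR (nrm p))) => // z.
rewrite -expRD mul1r; apply: le_trans (nrmB _ _) _; rewrite addrC.
by apply: le_trans (expR_ge1Dx _); rewrite lerDr.
Qed.

Lemma grX c v n : gr c v -> gr (n%:R * c) (fun z => v z ^+ n).
Proof.
move=> h; elim: n => [|n IH]; first by rewrite mul0r; exact: (@gr_cst 0 1).
rewrite mulrS mulrDl mul1r; have := grM h IH.
by rewrite (_ : (fun z => v z * v z ^+ n) = fun z => v z ^+ n.+1)//; apply/funext => z; rewrite exprS.
Qed.

Lemma gr_pow c p n : 0 < c -> gr c (fun z => (z - p) ^+ n).
Proof.
move=> c0; have n0 : 0 < n.+1%:R :> R by [].
(* Each factor gets the share [c / n.+1] of the growth; dividing by [n.+1] rather than [n] covers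
   [n = 0]. *)
have h : gr (c / n.+1%:R) (fun z => z - p) by apply: gr_sub; rewrite divr_gt0.
apply: gr_mono (grX n h); rewrite mulrCA ler_piMr ?(ltW c0)//.
by rewrite ler_pdivrMr// mul1r ler_nat.
Qed.

Lemma grJ c v : gr c v -> gr c (fun z => cj (v z)).
Proof. by move=> [C C0 H]; exists C => // z; rewrite nrmJ. Qed.

Lemma gauss0 al z : gauss al z = expR (- (al * nrm (z - 0) ^+ 2)).
Proof. by rewrite subr0. Qed.

Lemma gauss_ge0 al z : 0 <= gauss al z. Proof. exact: expR_ge0. Qed.

Lemma mea_gauss al : mea (gauss al).
Proof. by apply: eq_mea (mea_cont (cont_gauss al 0)) => z; rewrite -gauss0. Qed.

Lemma itg_gauss al : 0 < al -> itg (gauss al) /\ Int (gauss al) = pi / al.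
Proof.
move=> al0; have [h1 h2] := gauss_int 0 al0; split.
  by apply: eq_itg h1 => z; rewrite -gauss0.
by rewrite -h2; apply: eq_Int => z; rewrite -gauss0.
Qed.

Lemma gaussD al c z : expR (c * nrm z ^+ 2) * gauss al z = gauss (al - c) z.
Proof. by rewrite /gauss -expRD; congr expR; ring. Qed.

Lemma itg_gr (F : R[i] -> R) (C c al : R) : c < al -> mea F ->
  (forall z, `|F z| <= C * expR (c * nrm z ^+ 2)) ->
  itg (fun z => F z * gauss al z) /\ Int (fun z => F z * gauss al z) <= C * (pi / (al - c)).
Proof.
move=> cal mF H.
have ac : 0 < al - c by rewrite subr_gt0.
have [i1 i2] := itg_gauss ac.
have dom z : `|F z * gauss al z| <= C * gauss (al - c) z.
  by rewrite normrM (ger0_norm (gauss_ge0 _ _)) -gaussD mulrA ler_wpM2r ?gauss_ge0.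
have iF : itg (fun z => F z * gauss al z).
  apply: (itg_le _ dom); last exact: itgZ.
  by apply: meaM => //; exact: mea_gauss.
split => //; rewrite -i2 -IntZ//; apply: le_Int => //; first exact: itgZ.
by move=> z; apply: le_trans (ler_norm _) (dom z).
Qed.

Lemma citg_gr v (c al : R) : c < al -> cmea v -> gr c v -> citg (fun z => v z * (gauss al z)%:C).
Proof.
move=> cal mv [C C0 H].
have mn : mea (fun z => nrm (v z)) by exact: mea_nrm.
have [|i1 _] := @itg_gr (fun z => nrm (v z)) C c al cal mn.
  by move=> z; rewrite ger0_norm ?nrm_ge0.
apply: citg_le i1 _.
  by apply: cmeaM => //; apply: cmea_real; exact: mea_gauss.
by move=> z; rewrite nrmM nrmR ger0_norm ?gauss_ge0.
Qed.

Lemma cderiv_quad f z l (K : R) : 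
  (forall h, nrm h <= 1 -> nrm (f (z + h) - f z - l * h) <= K * nrm h ^+ 2) -> cderiv f z l.
Proof.
move=> H; apply/cderivP => e e0.
have K0 : 0 <= K.
  by have := le_trans (nrm_ge0 _) (H 1 _); rewrite nrm1 expr1n mulr1; exact.
have K1 : 0 < K + 1 by rewrite ltr_wpDl.
exists (Num.min 1 (e / (K + 1))); first by rewrite lt_min ltr01 divr_gt0.
move=> h; rewrite lt_min ltr_pdivlMr// => /andP[h1 h2].
apply: le_trans (H h (ltW h1)) _; rewrite expr2 mulrA ler_wpM2r ?nrm_ge0//.
apply: ltW; apply: le_lt_trans h2; rewrite mulrC ler_wpM2l ?nrm_ge0// lerDl.
exact: ler01.
Qed.

(** The second-order case of [cexp_taylor], with [|h| <= 1] used to remove [h] from the exponent.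
    The remaining factor dominates the differentiation under the integral in [cderiv_tr]. *)
Lemma tr_bound n (y x h : R[i]) : nrm h <= 1 ->
  nrm (x ^+ n * cexp y * (cexp (h * x) - \sum_(k < 2) (k`!%:R)^-1 * (h * x) ^+ k)) <=
  nrm h ^+ 2 * (nrm x ^+ n.+2 * expR (nrm y + nrm x)).
Proof.
move=> h1; have T := cexp_taylor 2 (h * x); rewrite [nrm (h * x)]nrmM in T.
have hx : nrm h * nrm x <= nrm x by rewrite ler_piMl ?nrm_ge0.
rewrite nrmM [nrm (x ^+ n * _)]nrmM nrmX.
have -> : nrm h ^+ 2 * (nrm x ^+ n.+2 * expR (nrm y + nrm x)) =
    (nrm x ^+ n * expR (nrm y)) * ((nrm h * nrm x) ^+ 2 * expR (nrm x)).
  by rewrite expRD -[n.+2]addn2 exprD; ring.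
have hx0 : 0 <= (nrm h * nrm x) ^+ 2 by exact: sqr_ge0.
apply: ler_pM.
- by apply: mulr_ge0; [apply: exprn_ge0; exact: nrm_ge0|exact: nrm_ge0].
- exact: nrm_ge0.
- by apply: ler_wpM2l; [apply: exprn_ge0; exact: nrm_ge0|exact: cexp_le].
apply: le_trans T _; apply: ler_pM.
- by apply: divr_ge0.
- exact: expR_ge0.
- by apply: ler_piMr => //; rewrite invf_le1 ?ler1n.
- by rewrite ler_expR.
Qed.

(* The [n]-th derivative of [w |-> \int v(z) exp(al w (z - p)^* ) dmu]. *)
Definition tr al p v n w :=
  cintegral (fun z => v z * ((al%:C * cj (z - p)) ^+ n * cexp (al%:C * w * cj (z - p))) * (gauss al z)%:C).

Lemma holo_sub p : holo (fun z : R[i] => z - p).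
Proof. by apply: holo_B; [move=> z; eexists; exact: cderiv_id|exact: holo_cst]. Qed.

Lemma gr_tr al p n w c : 0 < c ->
  gr c (fun z => (al%:C * cj (z - p)) ^+ n * cexp (al%:C * w * cj (z - p))) /\
  cmea (fun z => (al%:C * cj (z - p)) ^+ n * cexp (al%:C * w * cj (z - p))).
Proof.
move=> c0; have c2 : 0 < c / 2 by rewrite divr_gt0.
have E : (fun z => (al%:C * cj (z - p)) ^+ n * cexp (al%:C * w * cj (z - p))) =
   (fun z => cj ((al%:C ^+ n * (z - p) ^+ n) * cexp (al%:C * cj w * z + - (al%:C * cj w * p)))).
  apply/funext => z; rewrite conjC_M -exprMn conjC_X conjC_M conjC_R cexpJ; congr (_ * cexp _).
  by rewrite -mulrBr conjC_M conjC_M conjC_K conjC_R.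
rewrite E; split.
  apply: grJ; rewrite [c]splitr; apply: grM; last exact: gr_cexp.
  by rewrite -[c / 2]add0r; apply: grM; [exact: gr_cst|exact: gr_pow].
apply: cmeaJ; apply: holo_cmea; apply: holo_M.
  by apply: holo_M; [exact: holo_cst|apply: holo_X; exact: holo_sub].
by apply: holo_cexp_comp; exact: holo_affine.
Qed.

Lemma citg_tr al p v n w c : c < al -> cmea v -> gr c v ->
  citg (fun z => v z * ((al%:C * cj (z - p)) ^+ n * cexp (al%:C * w * cj (z - p))) * (gauss al z)%:C).
Proof.
move=> cal mv gv; have e0 : 0 < (al - c) / 2 by rewrite divr_gt0// subr_gt0.
have [g1 m1] := gr_tr al p n w e0.
apply: (@citg_gr _ (c + (al - c) / 2)); [lra|exact: cmeaM|exact: grM].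
Qed.

Lemma cderiv_tr al p v n w c : 0 < al -> c < al -> cmea v -> gr c v ->
  cderiv (tr al p v n) w (tr al p v n.+1 w).
Proof.
move=> al0 cal mv gv.
pose k (n : nat) (w z : R[i]) := (al%:C * cj (z - p)) ^+ n * cexp (al%:C * w * cj (z - p)).
(* [B] majorizes the quadratic remainder uniformly in [|h| <= 1]. The power and the exponential each
   spend a quarter of the margin [al - c], so [B] still grows more slowly than the weight decays. *)
pose B z : R := nrm (v z) * (nrm (al%:C * cj (z - p)) ^+ n.+2 * expR (al * (nrm w + 1) * nrm (z - p))).
have [C C0 Hv] := gv.
have e0 : 0 < (al - c) / 4 by rewrite divr_gt0// subr_gt0.
have gB : exists C' : R, forall z, `|B z| <= C' * expR ((c + (al - c) / 2) * nrm z ^+ 2).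
  have [C1 C10 H1] := grM (gr_cst (al%:C ^+ n.+2) (lexx 0)) (gr_pow p n.+2 e0).
  have h2 : gr ((al - c) / 4) (fun z => (expR (al * (nrm w + 1) * nrm (z - p)))%:C).
    apply: (@gr_lin _ _ (al * (nrm w + 1)) (expR (al * (nrm w + 1) * nrm p))) => // z.
    rewrite nrmR ger0_norm ?expR_ge0// -expRD ler_expR -mulrDr ler_wpM2l//.
      by rewrite mulr_ge0 ?(ltW al0)// addr_ge0 ?nrm_ge0.
    by apply: le_trans (nrmB _ _) _; rewrite addrC.
  have [C2 C20 H2] := h2.
  exists (C * (C1 * C2)) => z.
  have B0 : 0 <= B z.
    by apply: mulr_ge0; [exact: nrm_ge0|apply: mulr_ge0; [apply: exprn_ge0; exact: nrm_ge0|exact: expR_ge0]].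
  rewrite (ger0_norm B0) /B.
  have -> : C * (C1 * C2) * expR ((c + (al - c) / 2) * nrm z ^+ 2) =
     (C * expR (c * nrm z ^+ 2)) * ((C1 * expR ((0 + (al - c) / 4) * nrm z ^+ 2)) * (C2 * expR ((al - c) / 4 * nrm z ^+ 2))).
    rewrite (_ : (c + (al - c) / 2) * _ = c * nrm z ^+ 2 + ((0 + (al - c) / 4) * nrm z ^+ 2 + (al - c) / 4 * nrm z ^+ 2)).
      by rewrite !expRD; ring.
    by field.
  have N0 : 0 <= nrm (al%:C * cj (z - p)) ^+ n.+2 by apply: exprn_ge0; exact: nrm_ge0.
  apply: ler_pM; [exact: nrm_ge0| |exact: Hv|].
    by apply: mulr_ge0; [exact: N0|exact: expR_ge0].
  apply: ler_pM; [exact: N0|exact: expR_ge0| |].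
    by have := H1 z; rewrite nrmM !nrmX nrmM exprMn nrmJ.
  by have := H2 z; rewrite nrmR ger0_norm ?expR_ge0.
have mB : mea B.
  apply: meaM; first exact: mea_nrm.
  have m1 : cmea (fun z => al%:C * cj (z - p)).
    apply: cmeaM; first by apply: holo_cmea; exact: holo_cst.
    by apply: cmeaJ; apply: holo_cmea; exact: holo_sub.
  apply: meaM; first by apply: meaX; exact: mea_nrm.
  apply: mea_expR; apply: meaM; first exact: mea_cst.
  by apply: mea_nrm; apply: holo_cmea; exact: holo_sub.
have [C' HC'] := gB.
have cal2 : c + (al - c) / 2 < al by lra.
have [iB _] := itg_gr cal2 mB HC'.
apply: (@cderiv_quad _ _ _ (Int (fun z => B z * gauss al z))) => h h1.
have i0 m x := citg_tr p m x cal mv gv.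
rewrite [tr _ _ _ n.+1 w * h]mulrC /tr -cintB// -cintZ// -cintB; last 2 first.
- exact: citgB.
- exact: citgZ.
set F := fun z => _ - _.
have iF : citg F by apply: citgB; [exact: citgB|exact: citgZ].
apply: le_trans (nrm_cint iF) _; rewrite mulrC -IntZ//.
apply: le_Int; [exact: citg_nrm|exact: itgZ|move=> z].
have -> : F z = v z * ((al%:C * cj (z - p)) ^+ n * cexp (al%:C * w * cj (z - p)) *
    (cexp (h * (al%:C * cj (z - p))) - \sum_(k < 2) (k`!%:R)^-1 * (h * (al%:C * cj (z - p))) ^+ k)) * (gauss al z)%:C.
  rewrite !big_ord_recl big_ord0 addr0 /= !fact0 factS fact0 muln1 invr1 !mul1r expr0 expr1 /F.
  rewrite [al%:C * (w + h) * _](_ : _ = al%:C * w * cj (z - p) + h * (al%:C * cj (z - p))); last by ring.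
  by rewrite cexpD exprS; ring.
rewrite nrmM nrmR (ger0_norm (gauss_ge0 _ _)) [leRHS]mulrA; apply: ler_wpM2r; first exact: gauss_ge0.
rewrite nrmM /B [leRHS]mulrCA; apply: ler_wpM2l; first exact: nrm_ge0.
apply: le_trans (tr_bound n (al%:C * w * cj (z - p)) (al%:C * cj (z - p)) h1) _.
rewrite ler_wpM2l ?exprn_ge0 ?nrm_ge0// ler_wpM2l ?exprn_ge0 ?nrm_ge0// ler_expR.
rewrite !nrmM nrmJ nrmR (ger0_norm (ltW al0)) le_eqVlt; apply/orP; left; apply/eqP; ring.
Qed.

End Growth.

(** * Inner product, reproducing kernels and pointwise limits *)

Section FockBasics.
Context {R : realType}.
Variable al : R.
Hypothesis al0 : 0 < al.
Implicit Types (f g : fock al) (z w p c : R[i]).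

(* Reads the values of [f] in [R[i]] instead of its alias [R[i]^o]. *)
Definition fv f : R[i] -> R[i] := fun z => f z.

Lemma fvD f g z : fv (f + g) z = fv f z + fv g z. Proof. by []. Qed.
Lemma fvZ c f z : fv (c *: f) z = c * fv f z. Proof. by []. Qed.
Lemma fv0 z : fv 0 z = 0. Proof. by []. Qed.
Lemma fvN f z : fv (- f) z = - fv f z. Proof. by []. Qed.
Lemma fvB f g z : fv (f - g) z = fv f z - fv g z. Proof. by []. Qed.

Lemma fv_sum (I : Type) (r : seq I) (P : pred I) (F : I -> fock al) z :
  fv (\sum_(k <- r | P k) F k) z = \sum_(k <- r | P k) fv (F k) z.
Proof. exact: (big_morph (fun f => fv f z)). Qed.

Lemma fv_inj f g : fv f =1 fv g -> f = g.
Proof. by move=> e; apply: val_inj; apply/funext. Qed.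

Definition inF (v : R[i] -> R[i]) := holo v /\ itg (fun z => nrm (v z) ^+ 2 * gauss al z).

Lemma sq_gauss_ge0 (v : R[i] -> R[i]) z : 0 <= nrm (v z) ^+ 2 * gauss al z.
Proof. by rewrite mulr_ge0 ?sqr_ge0 ?gauss_ge0. Qed.

Lemma mea_sq_gauss (v : R[i] -> R[i]) : cmea v -> mea (fun z => nrm (v z) ^+ 2 * gauss al z).
Proof. by move=> mv; apply: meaM; [apply: meaX; exact: mea_nrm|exact: mea_gauss]. Qed.

Lemma fv_inF f : inF (fv f).
Proof.
case: f => f /=; move=> fP; have := fP; rewrite inE /= => -[/entireP ef If].
split; first exact: ef.
apply: itg_ltyP; [by apply: mea_sq_gauss; exact: holo_cmea|exact: sq_gauss_ge0|exact: If].
Qed.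

Lemma holo_fv f : holo (fv f). Proof. by case: (fv_inF f). Qed.

Lemma mkF (v : R[i] -> R[i]) : inF v -> exists f, fv f =1 v.
Proof.
move=> [hv iv].
have fP : (v : R[i] -> R[i]^o) \in @fock_pred R al.
  rewrite inE /=; split; first by apply/entireP.
  exact: (itg_lty (sq_gauss_ge0 v) iv).
by exists (Fock fP).
Qed.

Definition prd (u v : R[i] -> R[i]) z := u z * cj (v z) * (gauss al z)%:C.

Lemma citg_prd (u v : R[i] -> R[i]) : cmea u -> cmea v ->
  itg (fun z => nrm (u z) ^+ 2 * gauss al z) ->
  itg (fun z => nrm (v z) ^+ 2 * gauss al z) -> citg (prd u v).
Proof.
move=> mu mv iu iv; apply: citg_le (itgD iu iv) _.
  apply: cmeaM; last by apply: cmea_real; exact: mea_gauss.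
  by apply: cmeaM => //; exact: cmeaJ.
move=> z; rewrite /prd !nrmM nrmJ nrmR ger0_norm ?gauss_ge0// -mulrDl ler_wpM2r ?gauss_ge0//.
have := sqr_ge0 (nrm (u z) - nrm (v z)); have := sqr_ge0 (nrm (u z)); have := sqr_ge0 (nrm (v z)).
rewrite sqrrB => h1 h2 h3; nra.
Qed.

Lemma citg_fv f g : citg (prd (fv f) (fv g)).
Proof.
have [hf i1] := fv_inF f; have [hg i2] := fv_inF g.
by apply: citg_prd => //; exact: holo_cmea.
Qed.

Definition dot f g : R[i] := fock_dot al f g.

Lemma dotE f g : dot f g = (al / pi)%:C * cintegral (prd (fv f) (fv g)).
Proof. by []. Qed.

Lemma dotDl f g h : dot (f + g) h = dot f h + dot g h.
Proof.
rewrite !dotE -mulrDr -cintD; [|exact: citg_fv|exact: citg_fv].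
by congr (_ * _); apply: eq_cint => z; rewrite /prd fvD; ring.
Qed.

Lemma dotZl c f h : dot (c *: f) h = c * dot f h.
Proof.
rewrite !dotE [RHS]mulrCA; congr (_ * _); rewrite -cintZ; last exact: citg_fv.
by apply: eq_cint => z; rewrite /prd fvZ; ring.
Qed.

Lemma dotC f g : dot g f = cj (dot f g).
Proof.
rewrite !dotE conjC_M conjC_R -cintJ; last exact: citg_fv.
by congr (_ * _); apply: eq_cint => z; rewrite /prd !conjC_M conjC_K conjC_R; ring.
Qed.

Lemma dotZr c f h : dot h (c *: f) = cj c * dot h f.
Proof. by rewrite dotC dotZl conjC_M -dotC. Qed.

Lemma dotNl f h : dot (- f) h = - dot f h.
Proof. by rewrite -scaleN1r dotZl mulN1r. Qed.

Lemma dotBl f g h : dot (f - g) h = dot f h - dot g h.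
Proof. by rewrite dotDl dotNl. Qed.

Lemma dotBr f g h : dot h (f - g) = dot h f - dot h g.
Proof. by rewrite dotC dotBl conjC_B -!dotC. Qed.

Lemma dot_suml (I : Type) (r : seq I) (P : pred I) (F : I -> fock al) h :
  dot (\sum_(k <- r | P k) F k) h = \sum_(k <- r | P k) dot (F k) h.
Proof.
apply: (big_morph (fun f => dot f h)) => [f g|]; first exact: dotDl.
by rewrite -[0 : fock al](scale0r 0) dotZl mul0r.
Qed.

Definition nn f : R := al / pi * Int (fun z => nrm (fv f z) ^+ 2 * gauss al z).

Lemma dot_self f : dot f f = (nn f)%:C.
Proof.
rewrite dotE /nn [RHS]RCM -cint_real; congr (_ * _).
by apply: eq_cint => z; rewrite /prd mulcJ -RCM.
Qed.

Lemma pi_neq0 : (pi : R) != 0. Proof. by rewrite gt_eqF// pi_gt0. Qed.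

Lemma al_neq0 : al != 0. Proof. by rewrite gt_eqF. Qed.

Lemma alpiK : al / pi * (pi / al) = 1.
Proof. by have := pi_neq0; move: (pi : R) => P P0; field; rewrite P0 al_neq0. Qed.

Lemma alpi_ge0 : 0 <= al / pi. Proof. by rewrite divr_ge0 ?pi_ge0// ltW. Qed.

Lemma nn_ge0 f : 0 <= nn f.
Proof. by rewrite mulr_ge0 ?alpi_ge0//; apply: Int_ge0 => z; exact: sq_gauss_ge0. Qed.

Lemma nnZ c f : nn (c *: f) = nrm c ^+ 2 * nn f.
Proof.
rewrite /nn [RHS]mulrCA; congr (_ * _); rewrite -IntZ; last by case: (fv_inF f).
by apply: eq_Int => z; rewrite fvZ nrmM; ring.
Qed.

Lemma nnB f g : nn (f - g) = nn f - 2 * complex.Re (dot f g) + nn g.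
Proof.
have : complex.Re (dot (f - g) (f - g)) = nn (f - g) by rewrite dot_self.
move=> <-; rewrite dotBl !dotBr !dot_self (dotC f g).
by rewrite !cReD !cReN !cReD !cReN cReJ /=; ring.
Qed.

Definition hn f : R := hnorm (@fock_dot R al) f.

Lemma hnE f : hn f = Num.sqrt (nn f).
Proof. by rewrite /hn /hnorm -/(dot f f) dot_self. Qed.

Lemma hn_sqr f : hn f ^+ 2 = nn f.
Proof. by rewrite hnE sqr_sqrtr ?nn_ge0. Qed.

Lemma hn_ge0 f : 0 <= hn f. Proof. by rewrite hnE sqrtr_ge0. Qed.

Lemma hnZ c f : hn (c *: f) = nrm c * hn f.
Proof. by rewrite !hnE nnZ sqrtrM ?sqr_ge0// sqrtr_sqr ger0_norm ?nrm_ge0. Qed.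

Lemma cauchy_schwarz f g : nrm (dot f g) <= hn f * hn g.
Proof.
set c := dot f g.
suff H : nrm c ^+ 2 <= nn f * nn g.
  rewrite -(@ler_pXn2r _ 2) ?nnegrE ?nrm_ge0 ?mulr_ge0 ?hn_ge0//.
  by rewrite exprMn !hn_sqr.
have key (t : R) : 0 <= nn f - 2 * t * nrm c ^+ 2 + t ^+ 2 * nrm c ^+ 2 * nn g.
  have := nn_ge0 (f - (t%:C * c) *: g); rewrite nnB nnZ dotZr -/c conjC_M conjC_R.
  rewrite nrmM nrmR exprMn real_normK ?num_real//.
  have -> : complex.Re (t%:C * cj c * c) = t * nrm c ^+ 2.
    by rewrite mulrC mulrCA mulrC mulcJ cReMr /= mulrC.
  by rewrite mulrA.
have [g0|g0] := ltrP 0 (nn g).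
  have := key (nn g)^-1.
  have -> : nn f - 2 / nn g * nrm c ^+ 2 + (nn g)^-1 ^+ 2 * nrm c ^+ 2 * nn g =
    nn f - nrm c ^+ 2 / nn g by field; rewrite gt_eqF.
  by rewrite subr_ge0 ler_pdivrMr.
have {}g0 : nn g = 0 by apply/eqP; rewrite eq_le g0 nn_ge0.
rewrite g0 mulr0 leNgt; apply/negP => c0.
(* When [nn g = 0] the expression in [key] is affine in [t], and this [t] gives it the value
   [- 1]. *)
have := key ((nn f + 1) / (2 * nrm c ^+ 2)); rewrite g0 mulr0 addr0.
rewrite (_ : 2 * _ * _ = nn f + 1); last by field; move: c0; rewrite exprn_even_gt0.
lra.
Qed.

Lemma nnD f g : nn (f + g) = nn f + 2 * complex.Re (dot f g) + nn g.
Proof.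
have := nnB f (- g); rewrite opprK => ->.
rewrite -(scaleN1r g) nnZ dotZr nrmN nrm1 expr1n mul1r.
by rewrite (_ : cj (-1) = - 1) ?mulN1r ?cReN ?mulrN ?opprK// rmorphN1.
Qed.

Lemma hnD f g : hn (f + g) <= hn f + hn g.
Proof.
rewrite -(@ler_pXn2r _ 2) ?nnegrE ?addr_ge0 ?hn_ge0// sqrrD !hn_sqr.
rewrite nnD.
have := cauchy_schwarz f g; have := Re_le (dot f g); have := ler_norm (complex.Re (dot f g)).
move=> h1 h2 h3; lra.
Qed.

Lemma hnN f : hn (- f) = hn f.
Proof. by rewrite -scaleN1r hnZ nrmN nrm1 mul1r. Qed.

Lemma hnB f g : hn (f - g) <= hn f + hn g.
Proof. by rewrite -(hnN g); exact: hnD. Qed.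

(** The usual way into the space: the squared bound leaves a Gaussian of parameter [al - 2 * c],
    whose normalized integral [al / (al - 2 * c)] is the square of the norm factor. *)
Lemma growth_fock (v : R[i] -> R[i]) (C c : R) : holo v -> 2 * c < al -> 0 <= C ->
  (forall z, nrm (v z) <= C * expR (c * nrm z ^+ 2)) ->
  exists2 f, fv f =1 v & hn f <= C * Num.sqrt (al / (al - 2 * c)).
Proof.
move=> hv cal C0 H.
have ac : 0 < al - 2 * c by rewrite subr_gt0.
have m2 : mea (fun z => nrm (v z) ^+ 2) by apply: meaX; apply: mea_nrm; exact: holo_cmea.
have b2 z : `|nrm (v z) ^+ 2| <= C ^+ 2 * expR (2 * c * nrm z ^+ 2).
  rewrite ger0_norm ?sqr_ge0// -mulrA.
  rewrite [2 * (_ * _)](_ : _ = c * nrm z ^+ 2 + c * nrm z ^+ 2); last by ring.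
  rewrite expRD -expr2 -exprMn.
  by rewrite ler_pXn2r ?nnegrE ?nrm_ge0// mulr_ge0// expR_ge0.
have [i1 i2] := itg_gr cal m2 b2.
have [f fE] := mkF (conj hv i1); exists f => //.
rewrite hnE -[C]ger0_norm// -sqrtr_sqr -sqrtrM ?sqr_ge0// ler_wsqrtr//.
have -> : nn f = al / pi * Int (fun z => nrm (v z) ^+ 2 * gauss al z).
  by congr (_ * _); apply: eq_Int => z; rewrite fE.
have -> : C ^+ 2 * (al / (al - 2 * c)) = al / pi * (C ^+ 2 * (pi / (al - 2 * c))).
  by have := pi_neq0; move: (pi : R) => P P0; field; rewrite P0 gt_eqF.
by rewrite ler_wpM2l ?alpi_ge0.
Qed.

Definition kf w z : R[i] := cexp (al%:C * cj w * z).

Lemma kf_gr c w : 0 < complex.Re c -> gr (complex.Re c) (kf w).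
Proof.
move=> c0; have := @gr_cexp R _ (al%:C * cj w) 0 c0.
by rewrite (_ : (fun z => _) = kf w)//; apply/funext => z; rewrite addr0.
Qed.

Lemma holo_kf w : holo (kf w).
Proof. by apply: holo_cexp_comp; apply: holo_M; [exact: holo_cst|move=> z; eexists; exact: cderiv_id]. Qed.

Lemma kf_sym z w : kf w z = cj (kf z w).
Proof. by rewrite /kf cexpJ !conjC_M conjC_K conjC_R; congr cexp; ring. Qed.

Lemma nrm_kfE w z :
  nrm (kf w z) = expR (al * (complex.Re w * complex.Re z + complex.Im w * complex.Im z)).
Proof. by rewrite /kf nrm_cexp; congr expR; case: w z => [a b] [c d] /=; ring. Qed.

Lemma kf_inF w : inF (kf w).
Proof.
have c0 : 0 < al / 4 by rewrite divr_gt0.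
have [C C0 H] := @kf_gr (al / 4)%:C w c0.
have [|f fE _] := growth_fock (holo_kf w) _ C0 H; first by rewrite /=; lra.
have := fv_inF f; rewrite (_ : fv f = kf w)//; exact/funext.
Qed.

Definition ker w : fock al := sval (cid (mkF (kf_inF w))).

Lemma fv_ker w z : fv (ker w) z = kf w z.
Proof. by rewrite /ker; case: cid => /=. Qed.

Lemma kf_diag w : kf w w = (expR (al * nrm w ^+ 2))%:C.
Proof. by rewrite /kf -mulrA [cj w * w]mulrC mulcJ -RCM cexpR. Qed.

Lemma gauss_shift z w : (expR (- (al * nrm (z - w) ^+ 2)))%:C =
  (gauss al z)%:C * (expR (- (al * nrm w ^+ 2)))%:C * (kf w z * cj (kf w z)).
Proof.
have E : nrm (kf w z) ^+ 2 = expR (2 * complex.Re (al%:C * cj w * z)).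
  by rewrite /kf nrm_cexp expr2 -expRD; congr expR; ring.
rewrite mulcJ -!RCM E /gauss -!expRD !nrm_sqr; congr (expR _)%:C.
by clear E; case: z w => [a b] [c d] /=; ring.
Qed.

(** [gauss_mean] at the centre [w] is applied to [F = f K_(-w) exp (al |w|^2)]. The shifted Gaussian
    is the weight times [|K_w|^2 exp (- al |w|^2)], and [K_(-w) K_w = 1], so the integrand becomes
    [f cj(K_w)] times the weight, while [F w = f w]. *)
Lemma reproducing f w : dot f (ker w) = fv f w.
Proof.
have [hf _] := fv_inF f.
pose F z := fv f z * (kf (- w) z * (expR (al * nrm w ^+ 2))%:C).
have hF : holo F by apply: holo_M => //; apply: holo_M; [exact: holo_kf|exact: holo_cst].
have E z : F z * (expR (- (al * nrm (z - w) ^+ 2)))%:C = prd (fv f) (fv (ker w)) z.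
  rewrite gauss_shift /F /prd fv_ker.
  have e1 : (expR (al * nrm w ^+ 2))%:C * (expR (- (al * nrm w ^+ 2)))%:C = 1 :> R[i].
    by rewrite -RCM -expRD subrr expR0.
  have e2 : kf (- w) z * kf w z = 1.
    rewrite /kf -cexpD rmorphN mulrN mulNr addNr; exact: cexp0.
  have -> : forall a b c d e h : R[i], a * (b * c) * (d * e * (h * cj h)) = (c * e) * (b * h) * (a * cj h * d).
    by move=> *; ring.
  by rewrite e1 e2 !mul1r.
have i1 : citg (fun z => F z * (expR (- (al * nrm (z - w) ^+ 2)))%:C).
  by apply: eq_citg (citg_fv f (ker w)) => z; rewrite E.
have := gauss_mean al0 hF i1; rewrite (eq_cint E) dotE => ->.
rewrite /F; have -> : kf (- w) w = (expR (- (al * nrm w ^+ 2)))%:C.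
  by rewrite /kf rmorphN mulrN mulNr -mulrA [cj w * w]mulrC mulcJ -RCM -RCN cexpR.
rewrite -RCM -expRD addNr expR0 mulr1 mulrCA -RCM.
by rewrite alpiK mulr1.
Qed.

Lemma hn_ker w : hn (ker w) ^+ 2 = expR (al * nrm w ^+ 2).
Proof.
have := dot_self (ker w); rewrite reproducing fv_ker kf_diag hn_sqr => e.
by have := congr1 (@complex.Re R) e.
Qed.

Lemma hn_ker_eq w : hn (ker w) = expR (al / 2 * nrm w ^+ 2).
Proof.
apply/eqP; rewrite -(@eqrXn2 _ 2) ?hn_ge0 ?expR_ge0// hn_ker [X in _ == X]expr2 -expRD; apply/eqP; congr expR; by field.
Qed.

Lemma fv_le f w : nrm (fv f w) <= hn f * expR (al / 2 * nrm w ^+ 2).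
Proof. by rewrite -reproducing -hn_ker_eq; exact: cauchy_schwarz. Qed.

Lemma hn_eq0 f : hn f <= 0 -> f = 0.
Proof.
move=> f0; apply: fv_inj => z; rewrite fv0; apply/eqP; rewrite -nrm_eq0 eq_le nrm_ge0 andbT.
by apply: le_trans (fv_le f z) _; rewrite mulr_le0_ge0 ?expR_ge0.
Qed.

Lemma dot_ext f g : (forall h, dot f h = dot g h) -> f = g.
Proof. by move=> H; apply: fv_inj => z; rewrite -!reproducing H. Qed.

Lemma half_lt : al / 2 < al. Proof. by rewrite ltr_pdivrMr// ltr_pMr// ltr1n. Qed.

(** [cj (K_w z)] splits as [K_p w] times [exp (al w cj (z - p))], whose derivatives in [w] bring
    down powers of [cj (z - p)]. So [f / K_p] has explicit derivatives, adapted to the basis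
    [(z - p)^n K_p]. *)
Lemma fv_tr f p w :
  fv f w = (al / pi)%:C * (kf p w * tr al p (fv f) 0 w).
Proof.
have c0 : 0 < (al / 4) by rewrite divr_gt0.
have gf : gr (al / 2) (fv f) by exists (hn f); [exact: hn_ge0|exact: fv_le].
rewrite -reproducing dotE /tr; congr (_ * _); rewrite -cintZ; last first.
  apply: (@citg_tr _ al p _ 0 w (al / 2)); [exact: half_lt|by apply: holo_cmea; exact: holo_fv|exact: gf].
apply: eq_cint => z; rewrite /prd fv_ker expr0 mul1r.
have -> : cj (kf w z) = kf p w * cexp (al%:C * w * cj (z - p)).
  by rewrite kf_sym conjC_K /kf -cexpD conjC_B; congr cexp; ring.
ring.
Qed.

(* Pointwise limits of norm-bounded sequences stay in the space, since the
   reproducing formula passes to the limit by dominated convergence. *)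
Lemma fock_lim (u : nat -> fock al) (v : R[i] -> R[i]) (C : R) :
  (forall n, hn (u n) <= C) -> (forall z, ccvg (fun n => fv (u n) z) (v z)) ->
  exists2 f, fv f =1 v & hn f <= C.
Proof.
move=> uC uv.
have C0 : 0 <= C by apply: le_trans (hn_ge0 (u 0%N)) (uC _).
have ub n z : nrm (fv (u n) z) <= C * expR (al / 2 * nrm z ^+ 2).
  by apply: le_trans (fv_le _ _) _; rewrite ler_wpM2r ?expR_ge0.
have mu n : cmea (fv (u n)) by apply: holo_cmea; exact: holo_fv.
have mv : cmea v.
  split; [apply: (@mea_cvg _ (fun n z => complex.Re (fv (u n) z)))|apply: (@mea_cvg _ (fun n z => complex.Im (fv (u n) z)))].
  - by move=> n; case: (mu n).
  - by move=> z; exact: ccvg_Re (uv z).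
  - by move=> n; case: (mu n).
  - by move=> z; exact: ccvg_Im (uv z).
have vb z : nrm (v z) <= C * expR (al / 2 * nrm z ^+ 2) by apply: ccvg_le (uv z) _ => n; exact: ub.
have gv : gr (al / 2) v by exists C.
have a2 := half_lt.
have vE w : v w = (al / pi)%:C * tr al 0 v 0 w.
  have h1 : ccvg (fun n => fv (u n) w) ((al / pi)%:C * tr al 0 v 0 w).
    apply: (@ccvg_eq _ (fun n => (al / pi)%:C * tr al 0 (fv (u n)) 0 w)).
      by move=> n; rewrite (fv_tr (u n) 0) /kf conjc0 mulr0 mul0r cexp0 mul1r.
    apply: ccvgZ.
    have a4 : 0 < al / 4 by rewrite divr_gt0.
    have [[Ck Ck0 Hk] mk] := gr_tr al 0 0 w a4.
    set k := fun z => _ in Hk mk.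
    have iG : itg (fun z => (C * Ck) * gauss (al / 4) z).
      by apply: itgZ; case: (itg_gauss a4).
    apply: (cint_dominated _ _ iG _).2.
    - by move=> n; apply: cmeaM; [exact: cmeaM|apply: cmea_real; exact: mea_gauss].
    - by move=> z; apply: ccvgM; [apply: ccvgM => //; exact: ccvg_cst|exact: ccvg_cst].
    - move=> n z; rewrite nrmM nrmR ger0_norm ?gauss_ge0// nrmM.
      have -> : gauss (al / 4) z = (expR (al / 2 * nrm z ^+ 2) * expR (al / 4 * nrm z ^+ 2)) * gauss al z.
        by rewrite /gauss -!expRD; congr expR; field.
      rewrite mulrA ler_wpM2r ?gauss_ge0// mulrACA; apply: ler_pM; rewrite ?nrm_ge0//.
  exact: ccvg_uniq (uv w) h1.
have hv : holo v.
  move=> z; exists ((al / pi)%:C * tr al 0 v 1 z).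
  have := cderivZ (al / pi)%:C (cderiv_tr 0 0 z al0 a2 mv gv).
  by rewrite (_ : (fun w => _) = v)//; apply/funext => w; rewrite -vE.
(* The pointwise bound [vb] is too weak for square integrability; membership and the norm bound come
   from Fatou's lemma. *)
have [iv vC] : itg (fun z => nrm (v z) ^+ 2 * gauss al z) /\
    Int (fun z => nrm (v z) ^+ 2 * gauss al z) <= C ^+ 2 * (pi / al).
  apply: (@Int_fatou _ (fun n z => nrm (fv (u n) z) ^+ 2 * gauss al z)).
  - by move=> n; case: (fv_inF (u n)).
  - by move=> n z; exact: sq_gauss_ge0.
  - by move=> z; apply: cvgM; [apply: cvgM; exact: ccvg_nrm|exact: cvg_cst].
  - move=> n; have : nn (u n) <= C ^+ 2.
      by rewrite -hn_sqr ler_pXn2r ?nnegrE ?hn_ge0.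
    rewrite /nn => h.
    have -> : Int (fun z => nrm (fv (u n) z) ^+ 2 * gauss al z) =
        (al / pi * Int (fun z => nrm (fv (u n) z) ^+ 2 * gauss al z)) * (pi / al).
      by have := pi_neq0; move: (pi : R) => P P0; field; rewrite P0 al_neq0.
    by rewrite ler_wpM2r// divr_ge0 ?pi_ge0// ltW.
have [f fE] := mkF (conj hv iv); exists f => //.
rewrite hnE -[C]ger0_norm// -sqrtr_sqr ler_wsqrtr// /nn.
have -> : C ^+ 2 = al / pi * (C ^+ 2 * (pi / al)) by have := pi_neq0; move: (pi : R) => P P0; field; rewrite P0 al_neq0.
rewrite ler_wpM2l ?alpi_ge0//; apply: le_trans vC.
by rewrite (_ : Int _ = Int (fun z => nrm (v z) ^+ 2 * gauss al z))//; apply: eq_Int => z; rewrite fE.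
Qed.

End FockBasics.

(** * Taylor expansion in the orthogonal basis [(z - p)^n K_p] *)

Section Taylor.
Context {R : realType}.
Implicit Types (z w p h c : R[i]).

Lemma fact_neq0 n : (n`!%:R : R[i]) != 0.
Proof. by rewrite pnatr_eq0 -lt0n fact_gt0. Qed.

Lemma pow_fact_cvg0 (x : R) : (fun n => x ^+ n / n`!%:R) @ \oo --> (0 : R).
Proof. by apply: cvg_series_cvg_0; exact: is_cvg_series_exp_coeff. Qed.

Lemma pow_fact_le (x : R) n : 0 <= x -> x ^+ n / n`!%:R <= expR x.
Proof.
move=> x0; case: n => [|n]; last by apply: le_trans (expR_ge1Dxn n x0); rewrite lerDr.
by rewrite expr0 fact0 divr1 -expR0 ler_expR.
Qed.

Lemma cexp_series z : ccvg (fun n => \sum_(k < n) (k`!%:R)^-1 * z ^+ k) (cexp z).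
Proof.
move=> e e0.
have : (fun n => nrm z ^+ n / n`!%:R * expR (nrm z)) @ \oo --> (0 : R).
  by rewrite -[X in _ --> X](mul0r (expR (nrm z))); apply: cvgM; [exact: pow_fact_cvg0|exact: cvg_cst].
move=> /cvgrPdist_lt /(_ e e0) [N _ HN]; exists N => n /HN /=.
rewrite sub0r normrN => /(le_lt_trans (ler_norm _)) H.
by rewrite nrm_distC; apply: le_lt_trans H; exact: cexp_taylor.
Qed.

(** Uniformity in [n] gives the partial sums under the integral in [tr_taylor] a common integrable
    majorant. *)
Lemma exp_sum_le n z : nrm (\sum_(k < n) (k`!%:R)^-1 * z ^+ k) <= 2 * expR (2 * nrm z).
Proof.
have -> : \sum_(k < n) (k`!%:R)^-1 * z ^+ k = cexp z - (cexp z - \sum_(k < n) (k`!%:R)^-1 * z ^+ k) by rewrite subKr.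
apply: le_trans (nrmB _ _) _.
have e1 : expR (nrm z) <= expR (2 * nrm z).
  by rewrite ler_expR ler_peMl ?nrm_ge0// ler1n.
have h1 : nrm (cexp z) <= expR (2 * nrm z) by apply: le_trans (cexp_le z) e1.
have h2 : nrm (cexp z - \sum_(k < n) (k`!%:R)^-1 * z ^+ k) <= expR (2 * nrm z).
  apply: le_trans (cexp_taylor _ _) _.
  rewrite (_ : 2 * nrm z = nrm z + nrm z); last by ring.
  by rewrite expRD ler_wpM2r ?expR_ge0// pow_fact_le// nrm_ge0.
lra.
Qed.

Lemma cint_sum n (F : nat -> R[i] -> R[i]) : (forall k, citg (F k)) ->
  citg (fun z => \sum_(k < n) F k z) /\
  cintegral (fun z => \sum_(k < n) F k z) = \sum_(k < n) cintegral (F k).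
Proof.
move=> iF; elim: n => [|n [IH1 IH2]].
  have e : (fun=> 0 : R[i]) =1 (fun z => \sum_(k < 0) F k z) by move=> z; rewrite big_ord0.
  have c0 : citg (fun=> 0 : R[i]) by apply: (citg_real (@itg0 R)).
  split; first exact: eq_citg e c0.
  by rewrite -(eq_cint e) big_ord0 (cint_real (fun=> 0)) Int0.
have e : (fun z => \sum_(k < n) F k z + F n z) =1 (fun z => \sum_(k < n.+1) F k z).
  by move=> z; rewrite big_ord_recr.
split; first by apply: eq_citg e _; exact: citgD.
by rewrite -(eq_cint e) cintD// IH2 big_ord_recr.
Qed.

Variable al : R.
Hypothesis al0 : 0 < al.
Implicit Types f g : fock al.

Lemma tr_taylor p v w h (c : R) : c < al -> cmea v -> gr c v ->
  ccvg (fun n => \sum_(k < n) (k`!%:R)^-1 * h ^+ k * tr al p v k w) (tr al p v 0 (w + h)).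
Proof.
move=> cal mv gv.
pose x z := al%:C * cj (z - p).
pose F k z := (k`!%:R)^-1 * h ^+ k * (v z * (x z ^+ k * cexp (al%:C * w * cj (z - p))) * (gauss al z)%:C).
have iF k : citg (F k) by apply: citgZ; exact: citg_tr cal mv gv.
have FE n z : \sum_(k < n) F k z =
    v z * ((\sum_(k < n) (k`!%:R)^-1 * (h * x z) ^+ k) * cexp (al%:C * w * cj (z - p))) * (gauss al z)%:C.
  rewrite mulr_suml mulr_sumr mulr_suml; apply: eq_bigr => k _.
  have H (a b y e c1 d : R[i]) : a * b * (y * (c1 * e) * d) = y * (a * (b * c1) * e) * d by ring.
  by rewrite /F [(h * x z) ^+ _]exprMn H.
apply: (@ccvg_eq _ (fun n => cintegral (fun z => \sum_(k < n) F k z))).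
  move=> n; rewrite (cint_sum n iF).2; apply: eq_bigr => k _.
  by rewrite /F cintZ//; exact: citg_tr cal mv gv.
have [C C0 Hv] := gv.
have d0 : 0 < (al - c) / 2 by rewrite divr_gt0// subr_gt0.
pose b := 2 * nrm h * al + al * nrm w.
have b0 : 0 <= b by rewrite addr_ge0// !mulr_ge0 ?nrm_ge0// ltW.
have [K K0 HK] : gr ((al - c) / 2) (fun z => (2 * expR (b * nrm (z - p)))%:C).
  apply: (@gr_lin _ _ _ b (2 * expR (b * nrm p))) => //.
  move=> z; rewrite nrmR ger0_norm ?mulr_ge0 ?expR_ge0// -mulrA -expRD ler_wpM2l// ler_expR.
  by rewrite -mulrDr ler_wpM2l// [leRHS]addrC; exact: nrmB.
have ac : 0 < al - (c + (al - c) / 2) by lra.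
have iG : itg (fun z => C * K * gauss (al - (c + (al - c) / 2)) z).
  by apply: itgZ; case: (itg_gauss ac).
rewrite /tr; apply: (cint_dominated _ _ iG _).2.
- by move=> n; apply: citg_cmea; exact: (cint_sum n iF).1.
- move=> z; apply: (@ccvg_eq _ (fun n => v z * ((\sum_(k < n) (k`!%:R)^-1 * (h * x z) ^+ k) * cexp (al%:C * w * cj (z - p))) * (gauss al z)%:C)).
    by move=> n; rewrite FE.
  apply: ccvgM; last exact: ccvg_cst.
  apply: ccvgM; first exact: ccvg_cst.
  have -> : (al%:C * cj (z - p)) ^+ 0 * cexp (al%:C * (w + h) * cj (z - p)) = cexp (h * x z) * cexp (al%:C * w * cj (z - p)).
    by rewrite mul1r -cexpD /x; congr cexp; ring.
  by apply: ccvgM; [exact: cexp_series|exact: ccvg_cst].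
- move=> n z; rewrite FE nrmM nrmR ger0_norm ?gauss_ge0// -gaussD mulrA.
  rewrite ler_wpM2r ?gauss_ge0// mulrDl expRD mulrACA nrmM; apply: ler_pM; rewrite ?nrm_ge0//.
  apply: le_trans (HK z); rewrite nrmM nrmR ger0_norm ?mulr_ge0 ?expR_ge0//.
  have xE : nrm (x z) = al * nrm (z - p) by rewrite /x nrmM nrmJ nrmR gtr0_norm.
  have -> : 2 * expR (b * nrm (z - p)) = 2 * expR (2 * nrm (h * x z)) * expR (nrm (al%:C * w * cj (z - p))).
    rewrite -mulrA -expRD; congr (_ * expR _).
    by rewrite [nrm (h * _)]nrmM xE !nrmM nrmJ nrmR (gtr0_norm al0) /b; ring.
  by apply: ler_pM; rewrite ?nrm_ge0//; [exact: exp_sum_le|exact: cexp_le].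
Qed.

Lemma fv_gr f : gr (al / 2) (fv f).
Proof. by exists (hn f); [exact: hn_ge0|exact: fv_le]. Qed.

Lemma fv_cmea f : cmea (fv f). Proof. by apply: holo_cmea; exact: holo_fv. Qed.

Lemma cderiv_tr_fv p f n w : cderiv (tr al p (fv f) n) w (tr al p (fv f) n.+1 w).
Proof. exact: cderiv_tr al0 (half_lt al0) (fv_cmea f) (fv_gr f). Qed.

Definition ef p n z : R[i] := (z - p) ^+ n * kf al p z.

Lemma ef_inF p n : inF al (ef p n).
Proof.
have c0 : 0 < al / 8 by rewrite divr_gt0.
have [C C0 H] := grM (gr_pow p n c0) (@kf_gr R al (al / 8)%:C p c0).
have hf : holo (ef p n) by apply: holo_M; [apply: holo_X; exact: holo_sub|exact: holo_kf].
have [|f fE _] := growth_fock al0 hf _ C0 H; first by rewrite /=; lra.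
have := fv_inF f; rewrite (_ : fv f = ef p n)//; exact/funext.
Qed.

Definition eb p n : fock al := sval (cid (mkF (ef_inF p n))).

Lemma fv_eb p n z : fv (eb p n) z = (z - p) ^+ n * kf al p z.
Proof. by rewrite /eb; case: cid => /=. Qed.

Lemma alC_neq0 : al%:C != 0 :> R[i].
Proof. by rewrite -nrm_eq0 nrmR normr_eq0 gt_eqF. Qed.

Lemma kf_neq0 w z : kf al w z != 0. Proof. exact: cexp_neq0. Qed.

Lemma dot_eb f p n : dot f (eb p n) =
  (al / pi)%:C * ((al%:C ^+ n)^-1 * kf al p p * tr al p (fv f) n p).
Proof.
rewrite dotE /tr; congr (_ * _).
rewrite -cintZ; last exact: (citg_tr _ _ _ (half_lt al0) (fv_cmea f) (fv_gr f)).
apply: eq_cint => z; rewrite /prd fv_eb.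
have -> : cj ((z - p) ^+ n * kf al p z) = cj (z - p) ^+ n * (kf al p p * cexp (al%:C * p * cj (z - p))).
  rewrite conjC_M conjC_X; congr (_ * _).
  by rewrite /kf cexpJ -cexpD !conjC_M conjC_B conjC_K conjC_R; congr cexp; ring.
by rewrite exprMn; field; rewrite expf_neq0// alC_neq0.
Qed.

(** By [fv_tr], dividing [eb p m] by the kernel leaves [(w - p)^m], and higher [n] are its
    derivatives. At [w = p] only [n = m] survives: this is the orthogonality of the basis. *)
Lemma tr_eb p m n w : tr al p (fv (eb p m)) n w = (pi / al)%:C * ((m ^_ n)%:R * (w - p) ^+ (m - n)).
Proof.
elim: n w => [|n IH] w.
  have := fv_tr al0 (eb p m) p w; rewrite fv_eb => e.
  have {}e : (w - p) ^+ m = (al / pi)%:C * tr al p (fv (eb p m)) 0 w.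
    by apply: (mulIf (kf_neq0 p w)); rewrite e; ring.
  by rewrite ffactn0 mul1r subn0 e mulrA -RCM mulrC [pi / al * _]mulrC alpiK// mulr1.
have h1 := cderiv_tr_fv p (eb p m) n w.
have h2 : cderiv (tr al p (fv (eb p m)) n) w ((pi / al)%:C * ((m ^_ n)%:R * ((m - n)%:R * (w - p) ^+ (m - n).-1))).
  rewrite (_ : tr al p (fv (eb p m)) n = fun w => (pi / al)%:C * ((m ^_ n)%:R * (w + - p) ^+ (m - n))).
    apply: cderivZ; apply: cderivZ.
    exact: (@cderiv_shift R (fun x => x ^+ (m - n)) w (- p) _ (cderivX _ _)).
  exact/funext.
by rewrite (cderiv_uniq h1 h2) ffactnSr natrM subnS; ring.
Qed.

Definition Nk p n : R := n`!%:R / al ^+ n * expR (al * nrm p ^+ 2).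

Lemma Nk_gt0 p n : 0 < Nk p n.
Proof. by rewrite mulr_gt0 ?expR_gt0// divr_gt0 ?exprn_gt0// ltr0n fact_gt0. Qed.

Lemma NkC p n : (Nk p n)%:C = n`!%:R / al%:C ^+ n * kf al p p.
Proof. by rewrite kf_diag /Nk RCM [X in X * _ = _]RCM RCV RCX rmorph_nat. Qed.

Lemma dot_eb_eb p m n : dot (eb p m) (eb p n) = if m == n then (Nk p n)%:C else 0.
Proof.
rewrite dot_eb tr_eb subrr.
have [->|mn] := eqVneq m n.
  have H (a b c d e : R[i]) : a * (b * c * (d * e)) = (a * d) * (e * b * c) by ring.
  by rewrite ffactnn subnn expr0 mulr1 NkC H -RCM alpiK// mul1r.
have [lt|] := ltnP m n; first by rewrite ffact_small// mul0r !mulr0.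
by rewrite leq_eqVlt eq_sym (negbTE mn) /= -subn_gt0 => /prednK <-; rewrite exprS mul0r !mulr0.
Qed.

Lemma nn_eb p n : nn (eb p n) = Nk p n.
Proof.
have := dot_self (eb p n); rewrite dot_eb_eb eqxx => e.
by have := congr1 (@complex.Re R) e.
Qed.

Definition uk p f n : R[i] := dot f (eb p n) / (Nk p n)%:C.

Lemma NkC_neq0 p n : (Nk p n)%:C != 0 :> R[i].
Proof. by rewrite -nrm_eq0 nrmR normr_eq0 gt_eqF// Nk_gt0. Qed.

Lemma fock_taylor p f w : ccvg (fun n => \sum_(k < n) uk p f k * fv (eb p k) w) (fv f w).
Proof.
have T := tr_taylor p p (w - p) (half_lt al0) (fv_cmea f) (fv_gr f).
rewrite [p + _]addrC subrK in T.
rewrite (fv_tr al0 f p w).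
apply: ccvg_eq (ccvgZ (al / pi)%:C (ccvgZ (kf al p w) T)).
move=> n; rewrite !mulr_sumr; apply: eq_bigr => k _.
rewrite /uk dot_eb fv_eb NkC.
have H (a b d y t c e g : R[i]) : b != 0 -> y != 0 -> g != 0 ->
    a * (c * (b^-1 * e * t)) = a * (y^-1 * d * t) / (b / y * d) * (e * c) \/ d = 0.
  by move=> b0 y0 g0; have [->|d0] := eqVneq d 0; [right|left; field; rewrite b0 y0 d0].
have [//|e0] := H (al / pi)%:C k`!%:R (kf al p p) (al%:C ^+ k) (tr al p (fv f) k p) (kf al p w) ((w - p) ^+ k) 1 (fact_neq0 k) (expf_neq0 k alC_neq0) (oner_neq0 _).
by have := kf_neq0 p p; rewrite e0 eqxx.
Qed.

End Taylor.

(** * Series, diagonal operators and Cauchy estimates *)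

Section Series.
Context {R : realType}.
Implicit Types (z w p h c : R[i]).

Lemma ccvg_series (a : nat -> R[i]) (q : nat -> R) : (forall k, nrm (a k) <= q k) ->
  cvgn (series q) -> exists l, ccvg (fun n => \sum_(k < n) a k) l.
Proof.
move=> aq cq.
have cv (r : R[i] -> R) : (forall z, `|r z| <= nrm z) -> cvgn (series (r \o a)).
  move=> rn; apply: normed_cvg; apply: series_le_cvg cq => k.
  - exact: normr_ge0.
  - exact: le_trans (nrm_ge0 _) (aq k).
  - exact: le_trans (rn _) (aq k).
exists (limn (series (@complex.Re R \o a)) +i* limn (series (@complex.Im R \o a))).
have E (r : R[i] -> R) n : r 0 = 0 -> (forall x y, r (x + y) = r x + r y) ->
    r (\sum_(k < n) a k) = series (r \o a) n.
  move=> r0 rD; rewrite seriesEord /=; elim: n => [|n IH]; first by rewrite !big_ord0.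
  by rewrite !big_ord_recr /= rD IH.
apply: ccvg_ReIm => /=.
  rewrite (_ : (fun n => _) = series (@complex.Re R \o a)); first exact: cv (@Re_le R).
  by apply/funext => n; apply: E => //; exact: cReD.
rewrite (_ : (fun n => _) = series (@complex.Im R \o a)); first exact: cv (@Im_le R).
by apply/funext => n; apply: E => //; exact: cImD.
Qed.

Lemma half_series (C : R) : cvgn (series (fun k => C * (2^-1 : R) ^+ k)).
Proof. by apply: is_cvg_geometric_series; rewrite ger0_norm ?invr_ge0// invf_lt1// ltr1n. Qed.

Lemma half_sum_le (C : R) n : 0 <= C -> \sum_(k < n) C * (2^-1 : R) ^+ k <= 2 * C.
Proof.
move=> C0; suff -> : \sum_(k < n) C * (2^-1 : R) ^+ k = 2 * C - 2 * C * 2^-1 ^+ n.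
  by rewrite gerBl mulr_ge0 ?mulr_ge0// exprn_ge0// invr_ge0.
elim: n => [|n IH]; first by rewrite big_ord0 expr0 mulr1 subrr.
by rewrite big_ord_recr /= IH exprS; field.
Qed.

(** After squaring, the claim is that [(4 t^2)^k / k!] is at most [exp (4 t^2)]. The larger exponent
    pays for the factor [2^-1 ^+ k], which turns the later majorants into geometric series. *)
Lemma sqrt_fact (t : R) k : 0 <= t ->
  t ^+ k / Num.sqrt k`!%:R <= expR (2 * t ^+ 2) * 2^-1 ^+ k.
Proof.
move=> t0; have f0 : 0 < (k`!%:R : R) by rewrite ltr0n fact_gt0.
have l0 : 0 <= t ^+ k / Num.sqrt k`!%:R by rewrite divr_ge0 ?exprn_ge0 ?sqrtr_ge0.
have r0 : 0 <= expR (2 * t ^+ 2) * (2^-1 : R) ^+ k by rewrite mulr_ge0 ?expR_ge0 ?exprn_ge0 ?invr_ge0.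
rewrite -(@ler_pXn2r _ 2)// ?nnegrE//.
have -> : (t ^+ k / Num.sqrt k`!%:R) ^+ 2 = (4 * t ^+ 2) ^+ k / k`!%:R * 2^-1 ^+ k ^+ 2.
  rewrite exprMn [(Num.sqrt _)^-1 ^+ 2]exprVn sqr_sqrtr ?ltW// exprMn.
  have -> : t ^+ 2 ^+ k = (t ^+ k) ^+ 2 by rewrite -!exprM mulnC.
  have -> : ((2^-1 : R) ^+ k) ^+ 2 = (4 ^+ k)^-1.
    by rewrite -exprM mulnC exprM -exprVn; congr (_ ^+ k); field.
  by field; rewrite gt_eqF//= expf_neq0.
rewrite [leRHS]exprMn ler_wpM2r ?sqr_ge0//.
have -> : expR (2 * t ^+ 2) ^+ 2 = expR (4 * t ^+ 2) by rewrite expr2 -expRD; congr expR; ring.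
by apply: pow_fact_le; rewrite mulr_ge0 ?sqr_ge0.
Qed.

Lemma series_bound (a : nat -> R[i]) (C : R) : 0 <= C -> (forall k, nrm (a k) <= C * 2^-1 ^+ k) ->
  (exists l, ccvg (fun n => \sum_(k < n) a k) l) /\ forall n, nrm (\sum_(k < n) a k) <= 2 * C.
Proof.
move=> C0 H; split; first exact: ccvg_series H (@half_series C).
move=> n; apply: le_trans (nrm_sum _ _ _) _; apply: le_trans (half_sum_le n C0).
by apply: ler_sum => k _; exact: H.
Qed.

(** [sqrt_fact] at [t * |z|] sums the series. The partial sums obey the same growth bound, so they
    are norm-bounded in the Fock space of parameter [8 * t ^+ 2], which exceeds twice the exponent
    [2 * t ^+ 2], and [fock_lim] makes the limit entire. *)
Lemma power_series (c : nat -> R[i]) (C t : R) : 0 <= C -> 0 < t ->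
  (forall k, nrm (c k) <= C * (t ^+ k / Num.sqrt k`!%:R)) ->
  exists S, [/\ holo S, forall z, ccvg (fun n => \sum_(k < n) c k * z ^+ k) (S z) &
    forall z, nrm (S z) <= 2 * C * expR (2 * t ^+ 2 * nrm z ^+ 2)].
Proof.
move=> C0 t0 cC.
have H z k : nrm (c k * z ^+ k) <= C * expR (2 * t ^+ 2 * nrm z ^+ 2) * 2^-1 ^+ k.
  rewrite nrmM nrmX; apply: le_trans (ler_wpM2r (exprn_ge0 _ (nrm_ge0 _)) (cC k)) _.
  have h := sqrt_fact k (mulr_ge0 (ltW t0) (nrm_ge0 z)); rewrite !exprMn mulrA in h.
  have -> : C * (t ^+ k / Num.sqrt k`!%:R) * nrm z ^+ k = C * (t ^+ k * nrm z ^+ k / Num.sqrt k`!%:R) by ring.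
  by rewrite -[leRHS]mulrA ler_wpM2l.
have B z := series_bound (mulr_ge0 C0 (expR_ge0 (2 * t ^+ 2 * nrm z ^+ 2))) (H z).
pose S z := sval (cid (B z).1).
have SP z : ccvg (fun n => \sum_(k < n) c k * z ^+ k) (S z) by rewrite /S; case: cid.
have be0 : 0 < 8 * t ^+ 2 by rewrite mulr_gt0 ?exprn_gt0.
have be1 : 2 * (2 * t ^+ 2) < 8 * t ^+ 2 by rewrite mulrA ltr_pM2r ?exprn_gt0//; lra.
have hp n : holo (fun z => \sum_(k < n) c k * z ^+ k).
  elim: n => [|n IH].
    by rewrite (_ : (fun z => _) = fun=> 0); [exact: holo_cst|apply/funext => z; rewrite big_ord0].
  rewrite (_ : (fun z => _) = fun z => \sum_(k < n) c k * z ^+ k + c n * z ^+ n).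
    apply: holo_D => //; apply: holo_M; first exact: holo_cst.
    by apply: holo_X => z; eexists; exact: cderiv_id.
  by apply/funext => z; rewrite big_ord_recr.
have C20 : 0 <= 2 * C by rewrite mulr_ge0.
have Bz n z : nrm (\sum_(k < n) c k * z ^+ k) <= 2 * C * expR (2 * t ^+ 2 * nrm z ^+ 2).
  by rewrite -mulrA; exact: (B z).2.
have F n : exists f : fock (8 * t ^+ 2), fv f =1 (fun z => \sum_(k < n) c k * z ^+ k) /\
    hn f <= 2 * C * Num.sqrt (8 * t ^+ 2 / (8 * t ^+ 2 - 2 * (2 * t ^+ 2))).
  by have [f fE fC] := growth_fock be0 (hp n) be1 C20 (Bz n); exists f.
have [|z|f fE _] := @fock_lim R _ be0 (fun n => sval (cid (F n))) S (2 * C * Num.sqrt (8 * t ^+ 2 / (8 * t ^+ 2 - 2 * (2 * t ^+ 2)))).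
- by move=> n; case: cid => f [].
- by apply: ccvg_eq (SP z) => n; case: cid => f [].
exists S; split => //.
- by have := holo_fv f; rewrite (_ : fv f = S)//; exact/funext.
- by move=> z; apply: ccvg_le (SP z) _ => n.
Qed.

Variable al : R.
Hypothesis al0 : 0 < al.
Implicit Types f g : fock al.

Notation eb := (eb al0).
Notation uk := (uk al0).

Lemma nn_comb p (b : nat -> R[i]) n :
  nn (\sum_(k < n) b k *: eb p k) = \sum_(k < n) nrm (b k) ^+ 2 * Nk al p k.
Proof.
elim: n => [|n IH].
  by rewrite !big_ord0 -[0 : fock al](scale0r 0) nnZ nrm0 expr0n mul0r.
rewrite !big_ord_recr /= nnD// IH nnZ nn_eb dotZr dot_suml.
rewrite [X in cj (b n) * X]big1 ?mulr0 ?addr0//= => k _.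
by rewrite dotZl dot_eb_eb// ltn_eqF// mulr0.
Qed.

Lemma dot_uk p f k : dot f (eb p k) = uk p f k * (Nk al p k)%:C.
Proof. by rewrite /uk mulfVK// NkC_neq0. Qed.

Lemma uk_lin p c f g k : uk p (c *: f + g) k = c * uk p f k + uk p g k.
Proof. by rewrite /uk dotDl dotZl// mulrDl mulrA. Qed.

Lemma bessel p f n : \sum_(k < n) nrm (uk p f k) ^+ 2 * Nk al p k <= nn f.
Proof.
set S := \sum_(k < n) uk p f k *: eb p k.
have E : dot S f = (\sum_(k < n) nrm (uk p f k) ^+ 2 * Nk al p k)%:C.
  rewrite dot_suml rmorph_sum; apply: eq_bigr => k _.
  by rewrite dotZl dotC dot_uk conjC_M conjC_R mulrA mulcJ -RCM.
have := nn_ge0 al0 (f - S); rewrite nnB// dotC E conjC_R nn_comb /=; lra.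
Qed.

Lemma uk_le p f k : nrm (uk p f k) <= hn f / Num.sqrt (Nk al p k).
Proof.
have N0 := Nk_gt0 al0 p k.
rewrite ler_pdivlMr ?sqrtr_gt0//.
have : nrm (dot f (eb p k)) <= hn f * Num.sqrt (Nk al p k).
  by apply: le_trans (cauchy_schwarz al0 _ _) _; rewrite [hn (eb p k)]hnE nn_eb.
rewrite dot_uk nrmM nrmR gtr0_norm// => H.
rewrite -(@ler_pM2r _ (Num.sqrt (Nk al p k))) ?sqrtr_gt0// -mulrA -expr2 sqr_sqrtr// ltW//.
Qed.

Lemma sqrt_Nk p k : (Num.sqrt (Nk al p k))^-1 <= Num.sqrt al ^+ k / Num.sqrt k`!%:R.
Proof.
have f0 : 0 < (k`!%:R : R) by rewrite ltr0n fact_gt0.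
have a0 : 0 < al ^+ k by rewrite exprn_gt0.
have -> : Num.sqrt al ^+ k / Num.sqrt k`!%:R = (Num.sqrt (k`!%:R / al ^+ k))^-1.
  have sX : Num.sqrt al ^+ k = Num.sqrt (al ^+ k).
    by elim: (k) => [|m IH]; rewrite ?expr0 ?sqrtr1// !exprS IH sqrtrM// ltW.
  by rewrite sX sqrtrM ?ltW// sqrtrV ?ltW// invfM invrK mulrC.
rewrite lef_pV2 ?posrE ?sqrtr_gt0 ?Nk_gt0 ?divr_gt0// ler_wsqrtr// /Nk.
rewrite ler_peMr ?divr_ge0 ?(ltW a0) ?(ltW f0)// -[leLHS]expR0 ler_expR.
by rewrite mulr_ge0 ?sqr_ge0// ltW.
Qed.

(** Bessel's inequality bounds the partial sums in norm independently of their length; pointwise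
    convergence comes from [sqrt_fact], and [fock_lim] provides the sum. *)
Lemma multiplier p (b : nat -> R[i]) (B : R) f : (forall k, nrm (b k) <= B) ->
  exists2 g : fock al, hn g <= B * hn f &
    forall w, ccvg (fun n => \sum_(k < n) b k * (uk p f k * fv (eb p k) w)) (fv g w).
Proof.
move=> bB; have B0 : 0 <= B by apply: le_trans (nrm_ge0 _) (bB 0%N).
pose C w := B * hn f * nrm (kf al p w) * expR (2 * (Num.sqrt al * nrm (w - p)) ^+ 2).
have C0 w : 0 <= C w by rewrite !mulr_ge0 ?hn_ge0 ?nrm_ge0 ?expR_ge0.
have H w k : nrm (b k * (uk p f k * fv (eb p k) w)) <= C w * 2^-1 ^+ k.
  rewrite fv_eb (nrmM (b k)) (nrmM (uk p f k)) (nrmM (_ ^+ k)) nrmX.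
  have h1 : nrm (uk p f k) <= hn f * (Num.sqrt al ^+ k / Num.sqrt k`!%:R).
    by apply: le_trans (uk_le _ _ _) _; rewrite ler_wpM2l ?hn_ge0// sqrt_Nk.
  have h2 := sqrt_fact k (mulr_ge0 (sqrtr_ge0 al) (nrm_ge0 (w - p))).
  have x0 : 0 <= nrm (w - p) ^+ k * nrm (kf al p w) by rewrite mulr_ge0 ?exprn_ge0 ?nrm_ge0.
  apply: le_trans (ler_pM (nrm_ge0 _) (mulr_ge0 (nrm_ge0 _) x0) (bB k) (ler_wpM2r x0 h1)) _.
  rewrite exprMn in h2; rewrite /C.
  have -> : B * (hn f * (Num.sqrt al ^+ k / Num.sqrt k`!%:R) * (nrm (w - p) ^+ k * nrm (kf al p w))) =
    B * hn f * nrm (kf al p w) * (Num.sqrt al ^+ k * nrm (w - p) ^+ k / Num.sqrt k`!%:R) by ring.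
  by rewrite -[leRHS]mulrA ler_wpM2l// !mulr_ge0 ?hn_ge0 ?nrm_ge0.
have P w := (series_bound (C0 w) (H w)).1.
pose v w := sval (cid (P w)).
have vP w : ccvg (fun n => \sum_(k < n) b k * (uk p f k * fv (eb p k) w)) (v w).
  by rewrite /v; case: cid.
have [||g gE gC] := @fock_lim R al al0 (fun n => \sum_(k < n) (b k * uk p f k) *: eb p k) v (B * hn f).
- move=> n; rewrite -(@ler_pXn2r _ 2) ?nnegrE ?mulr_ge0 ?hn_ge0// exprMn !hn_sqr// (nn_comb p (fun k => b k * uk p f k)).
  apply: (@le_trans _ _ (B ^+ 2 * \sum_(k < n) nrm (uk p f k) ^+ 2 * Nk al p k)).
    rewrite mulr_sumr; apply: ler_sum => k _; rewrite nrmM exprMn -mulrA.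
    apply: ler_wpM2r; first exact: mulr_ge0 (sqr_ge0 _) (ltW (Nk_gt0 al0 p k)).
    by rewrite ler_pXn2r ?nnegrE ?nrm_ge0.
  by rewrite ler_wpM2l ?sqr_ge0// bessel.
- move=> w; apply: ccvg_eq (vP w) => n; rewrite fv_sum; apply: eq_bigr => k _.
  by rewrite fvZ mulrA.
by exists g => // w; rewrite gE.
Qed.

(** All [tr al p (fv f) n] vanish on the disc, each being the derivative of the previous one; hence
    every coefficient in the basis at [p] is zero. *)
Lemma fock_ident f p (d : R) : 0 < d -> (forall z, nrm (z - p) < d -> fv f z = 0) -> f = 0.
Proof.
move=> d0 H.
have T n : forall w, nrm (w - p) < d -> tr al p (fv f) n w = 0.
  elim: n => [|n IH] w wd.
    have := fv_tr al0 f p w; rewrite H// => /esym/eqP; rewrite mulf_eq0 => /orP[|].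
      by rewrite -nrm_eq0 nrmR normr_eq0 mulf_eq0 invr_eq0 (negbTE (al_neq0 al0)) (negbTE pi_neq0).
    by rewrite mulf_eq0 (negbTE (kf_neq0 _ _ _)) => /eqP.
  have e0 : 0 < d - nrm (w - p) by rewrite subr_gt0.
  apply: cderiv_uniq (cderiv_tr_fv al0 p f n w) _.
  apply: (cderiv_local e0 _ (cderiv_cst 0 w)) => x xd; rewrite IH//.
  by apply: le_lt_trans (nrmBD w _ _) _; rewrite -ltrBrDr.
apply: fv_inj => w; rewrite fv0; apply: ccvg_uniq (fock_taylor al0 p f w) _.
apply: ccvg_eq (ccvg_cst 0) => n; rewrite big1// => k _.
by rewrite /uk dot_eb T ?subrr ?nrm0// !mulr0 mul0r mul0r.
Qed.

(** Since [K_0 = 1], the [n]-th derivative at 0 is [al ^+ n] times the inner product with [z^n],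
    whose squared norm is [n! / al^n]; the bound is Cauchy-Schwarz. Varying [al] plays the part of
    varying the radius. *)
Lemma cauchy_estimate f : exists D : nat -> R[i] -> R[i], [/\ D 0%N =1 fv f,
  forall n w, cderiv (D n) w (D n.+1 w) &
  forall n, nrm (D n 0) <= hn f * Num.sqrt (n`!%:R * al ^+ n)].
Proof.
exists (fun n w => (al / pi)%:C * tr al 0 (fv f) n w); split.
- by move=> w; rewrite (fv_tr al0 f 0 w) /kf conjc0 mulr0 mul0r cexp0 mul1r.
- by move=> n w; apply: cderivZ; exact: cderiv_tr_fv.
move=> n.
have -> : (al / pi)%:C * tr al 0 (fv f) n 0 = (al ^+ n)%:C * dot f (eb 0 n).
  rewrite dot_eb /kf mulr0 cexp0 mulr1 mulrCA; congr (_ * _).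
  by rewrite RCX mulVKf// expf_neq0// alC_neq0.
rewrite nrmM nrmR gtr0_norm ?exprn_gt0//.
apply: le_trans (ler_wpM2l (ltW (exprn_gt0 n al0)) (cauchy_schwarz al0 f (eb 0 n))) _.
rewrite mulrCA ler_wpM2l ?hn_ge0// [hn (eb 0 n)]hnE nn_eb /Nk nrm0 expr0n mulr0 expR0 mulr1.
rewrite -{1}[al ^+ n]gtr0_norm ?exprn_gt0// -sqrtr_sqr -sqrtrM ?sqr_ge0// ler_wsqrtr//.
rewrite le_eqVlt; apply/orP; left; apply/eqP; field.
by rewrite expf_neq0// gt_eqF.
Qed.

End Series.

(** * Liouville's theorem and decay of weighted moduli *)

Section Entire.
Context {R : realType}.
Implicit Types (f : R[i] -> R[i]) (z w : R[i]).

(** A function bounded by [M] has norm at most [M] in the Fock space of every weight, the normalized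
    Gaussian having mass one. For the weight [e ^+ 2], centred at [w], the Cauchy estimate bounds
    the derivative by [M * e], and [e] is arbitrary. *)
Lemma liouville f (M : R) : holo f -> (forall z, nrm (f z) <= M) -> forall z w, f z = f w.
Proof.
move=> hf fM; apply: cderiv0_cst => w.
have M0 : 0 <= M by apply: le_trans (nrm_ge0 _) (fM 0).
have [l fl] := hf w.
suff l0 : l = 0 by rewrite -l0.
have le_l (e : R) : 0 < e -> nrm l <= M * e.
  move=> e0; have be0 : 0 < e ^+ 2 by rewrite exprn_gt0.
  have hF : holo (fun z => f (z + w)) by move=> z; have [l' fl'] := hf (z + w); exists l'; exact: cderiv_shift.
  have [||z|F FE FM] := @growth_fock R _ be0 (fun z => f (z + w)) M 0 hF.
  - by rewrite mulr0.
  - by [].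
  - by rewrite mul0r expR0 mulr1.
  have [D [D0 D1 D2]] := cauchy_estimate be0 F.
  have e1 : D 1%N 0 = l.
    have h1 := D1 0%N 0.
    have h2 : cderiv (D 0%N) 0 l.
      rewrite (_ : D 0%N = fun z => f (z + w)); first by apply: cderiv_shift; rewrite add0r.
      by apply/funext => z; rewrite D0 FE.
    exact: cderiv_uniq h1 h2.
  rewrite -e1; apply: le_trans (D2 1%N) _.
  rewrite (_ : 1`!%:R = 1 :> R)// mul1r expr1 sqrtr_sqr gtr0_norm// ler_wpM2r ?(ltW e0)//.
  by apply: le_trans FM _; rewrite mulr0 subr0 divff ?gt_eqF// sqrtr1 mulr1.
apply/eqP; rewrite -nrm_eq0; apply/negPn/negP => l0.
have lp : 0 < nrm l by rewrite lt_def l0 nrm_ge0.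
have M1 : 0 < M + 1 by rewrite ltr_wpDl.
have := le_l (nrm l / (M + 1) / 2); rewrite !divr_gt0// => /(_ isT).
have -> : M * (nrm l / (M + 1) / 2) = nrm l * (M / (M + 1)) / 2 by field; rewrite gt_eqF.
have : M / (M + 1) <= 1 by rewrite ler_pdivrMr// mul1r lerDl.
nra.
Qed.

(* The mean value property of [f(z)^2 exp(-2 al w^* z)] for the weight [2 al]
   bounds [|f w|^2 e^{-al|w|^2}] by the mass of [|f|^2 gauss] near [w]. *)
Lemma fock_decay (al : R) (al0 : 0 < al) (f : fock al) (w : nat -> R[i]) :
  (forall A : R, exists N, forall n, (N <= n)%N -> A <= nrm (w n)) ->
  (fun n => nrm (fv f (w n)) ^+ 2 * gauss al (w n)) @ \oo --> (0 : R).
Proof.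
move=> winf.
pose u n z := nrm (fv f z) ^+ 2 * gauss al z * expR (- (al * nrm (z - w n) ^+ 2)).
have [hf i_f] := fv_inF f.
have e1 n z : expR (- (al * nrm (z - w n) ^+ 2)) <= 1.
  by rewrite -expR0 ler_expR oppr_le0 mulr_ge0 ?sqr_ge0// ltW.
have ub n z : `|u n z| <= nrm (fv f z) ^+ 2 * gauss al z.
  have u0 : 0 <= u n z by apply: mulr_ge0; [exact: sq_gauss_ge0|exact: expR_ge0].
  by rewrite ger0_norm// /u ler_piMr// sq_gauss_ge0.
have mu n : mea (u n).
  apply: meaM; first exact: itg_mea i_f.
  by apply: mea_cont => z; exact: cont_gauss.
have [iu0 cu] : itg (fun=> 0 : R) /\ Int (u n) @[n --> \oo] --> Int (fun=> 0 : R).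
  apply: (Int_dominated mu _ i_f ub) => z.
  rewrite -[X in _ --> X](mulr0 (nrm (fv f z) ^+ 2 * gauss al z)).
  apply: cvgM; first exact: cvg_cst.
  apply/cvgrPdist_lt => e e0.
  (* This makes [|z - w n| >= 1 + 1 / (al e)], so the square is at least [1 / (al e)], and
     [exp x >= 1 + x] pushes the Gaussian factor below [e]. *)
  have [N HN] := winf (nrm z + 1 + (al * e)^-1).
  exists N => // n /HN wn /=; rewrite sub0r normrN ger0_norm ?expR_ge0//.
  have ae : 0 < (al * e)^-1 by rewrite invr_gt0 mulr_gt0.
  have d1 : 1 + (al * e)^-1 <= nrm (z - w n).
    have := nrmBD z (w n) 0; rewrite !subr0 nrm_distC => h; lra.
  have d2 : (al * e)^-1 <= nrm (z - w n) ^+ 2 by nra.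
  have d3 : e^-1 < expR (al * nrm (z - w n) ^+ 2).
    apply: lt_le_trans (expR_ge1Dx _).
    rewrite ltr_pwDl// -ler_pdivrMl// (le_trans _ d2)// invfM//.
  by rewrite expRN -[e]invrK ltf_pV2 ?posrE ?invr_gt0 ?expR_gt0.
have key n : nrm (fv f (w n)) ^+ 2 * gauss al (w n) <= 2 * al / pi * Int (u n).
  have al2 : 0 < 2 * al by rewrite mulr_gt0.
  (* Squaring is what calls for the weight [2 * al]: [|F z| exp (- 2 al |z - w n|^2)] is exactly
     [u n z], and at the centre [|F (w n)|] is the quantity to be bounded. *)
  pose F z := (fv f z * kf al (- w n) z * (expR (al / 2 * nrm (w n) ^+ 2))%:C) ^+ 2.
  have hF : holo F.
    by apply: holo_X; apply: holo_M; [apply: holo_M => //; exact: holo_kf|exact: holo_cst].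
  have nF1 z : nrm (F z) = nrm (fv f z) ^+ 2 *
      expR (2 * (al / 2 * nrm (w n) ^+ 2 - al * (complex.Re (w n) * complex.Re z + complex.Im (w n) * complex.Im z))).
    rewrite /F nrmX (nrmM (fv f z * _)) (nrmM (fv f z)) nrmR ger0_norm ?expR_ge0// nrm_kfE.
    rewrite -mulrA exprMn -expRD; congr (_ * _); rewrite expr2 -expRD; congr expR.
    by case: (w n) => [c d] /=; ring.
  have nF z : nrm (F z * (expR (- (2 * al * nrm (z - w n) ^+ 2)))%:C) = u n z.
    rewrite nrmM nF1 nrmR ger0_norm ?expR_ge0// /u /gauss -mulrA -expRD -[RHS]mulrA -expRD; congr (_ * expR _).
    by rewrite !nrm_sqr; case: z (w n) => [a b] [c d] /=; field.
  have iF : citg (fun z => F z * (expR (- (2 * al * nrm (z - w n) ^+ 2)))%:C).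
    apply/citgP; split.
      apply: cmeaM; first exact: holo_cmea.
      by apply: cmea_real; apply: mea_cont => z; exact: cont_gauss.
    by apply: (eq_itg (fun z => esym (nF z))); exact: itg_le (mu n) (ub n) i_f.
  have := nrm_cint iF; rewrite (gauss_mean al2 hF iF) (eq_Int nF) nrmM nrmR ger0_norm; last first.
    by rewrite divr_ge0 ?pi_ge0// ltW.
  have -> : nrm (F (w n)) = nrm (fv f (w n)) ^+ 2 * gauss al (w n).
    rewrite nF1 /gauss !nrm_sqr; congr (_ * expR _).
    by case: (w n) => [c d] /=; field.
  move=> h; have -> : 2 * al / pi * Int (u n) = Int (u n) * (pi / (2 * al))^-1 by rewrite invf_div mulrC.
  by rewrite ler_pdivlMr// divr_gt0 ?pi_gt0.
rewrite Int0 in cu.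
apply: (@squeeze_cvgr _ _ _ _ (fun=> 0) (fun n => 2 * al / pi * Int (u n))).
- by apply: nearW => n; rewrite mulr_ge0 ?sqr_ge0 ?gauss_ge0 ?key.
- exact: cvg_cst.
- by rewrite -[X in _ --> X](mulr0 (2 * al / pi)); apply: cvgM => //; exact: cvg_cst.
Qed.

End Entire.

(** * Zero-free functions of the Fock space *)

Section Primitive.
Context {R : realType}.
Implicit Types (f q : R[i] -> R[i]) (z w k : R[i]).

Lemma cont_line f : holo f -> continuous (fun t : R => complex.Re (f t%:C)) /\
  continuous (fun t : R => complex.Im (f t%:C)).
Proof.
move=> hf.
have aux (r : R[i] -> R) : (forall z w, `|r z - r w| <= nrm (z - w)) -> continuous (fun t : R => r (f t%:C)).
  move=> rn t; apply/cvgrPdist_lt => e e0.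
  have [d d0 H] := holo_ccont t%:C hf e0.
  apply/nbhs_normP; exists d => // s /= sd.
  apply: le_lt_trans (rn _ _) _; rewrite nrm_distC; apply: H.
  by rewrite -RCB nrmR distrC.
split; apply: aux => z w; first by rewrite -cReN -cReD; exact: Re_le.
by rewrite -cImN -cImD; exact: Im_le.
Qed.

Lemma J_B (f g : R -> R) : continuous f -> continuous g ->
  J (fun t => f t - g t) 0 1 = J f 0 1 - J g 0 1.
Proof. by move=> cf cg; rewrite /J RintegralB//; exact: J_integrable. Qed.

Lemma cderiv_line f (t : R) l : cderiv f t%:C l ->
  is_derive t 1 (fun s => complex.Re (f s%:C)) (complex.Re l) /\
  is_derive t 1 (fun s => complex.Im (f s%:C)) (complex.Im l).
Proof.
move=> /cderiv_q[q [e cq q0]].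
have aux (r : R[i] -> R) : (forall z w, r (z + w) = r z + r w) ->
    (forall z (x : R), r (z * x%:C) = r z * x) -> (forall z, `|r z| <= nrm z) ->
    is_derive t 1 (fun s => r (f s%:C)) (r l).
  move=> rD rZ rn.
  have rB z w : r (z - w) = r z - r w.
    by rewrite rD -mulrN1 -RCN rZ mulrN1.
  apply: (@cara_is_derive R _ _ _ (fun s => r (q s%:C))).
  - by move=> s; rewrite -rB RCD e -rZ; congr r; ring.
  - apply/cvgrPdist_lt => eps eps0.
    have [d d0 Hd] := cq _ eps0.
    apply/nbhs_normP; exists d => // s /=; rewrite sub0r normrN => sd.
    rewrite -rB; apply: le_lt_trans (rn _) _; rewrite nrm_distC; apply: Hd.
    by rewrite subr0 nrmR.
  - by rewrite q0.
split; apply: aux.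
- exact: cReD.
- exact: cReMr.
- exact: Re_le.
- exact: cImD.
- by move=> [a b] x /=; rewrite mulr0 add0r.
- exact: Im_le.
Qed.

Lemma J_FTC (F f : R -> R) : (forall x : R, is_derive x 1 F (f x)) -> continuous f ->
  J f 0 1 = F 1 - F 0.
Proof.
move=> dF cf; have cF : continuous F.
  by move=> x; apply: differentiable_continuous; apply/derivable1_diffP; case: (dF x).
have := @continuous_FTC2 R f F 0 1 ltr01 (continuous_subspaceT cf).
rewrite /J /Rintegral => H; rewrite integral_itv_obnd_cbnd; last first.
  by apply/measurable_EFinP; apply: measurable_funTS; exact: continuous_measurable_fun.
rewrite H//.
- split.
  + by move=> x _; case: (dF x).
  + by apply: cvg_at_right_filter; exact: cF.
  + by apply: cvg_at_left_filter; exact: cF.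
- by move=> x _; rewrite derive1E; case: (dF x).
Qed.

Definition CJ f : R[i] := J (fun t => complex.Re (f t%:C)) 0 1 +i* J (fun t => complex.Im (f t%:C)) 0 1.

Lemma CJ_B f g : holo f -> holo g -> CJ (fun z => f z - g z) = CJ f - CJ g.
Proof.
move=> /cont_line[f1 f2] /cont_line[g1 g2]; apply: complexP; rewrite /CJ /= -J_B//; congr (J _ 0 1); apply/funext => t.
  by rewrite cReD cReN.
by rewrite cImD cImN.
Qed.

Lemma CJ_est f (K : R) : holo f -> (forall t : R, 0 <= t <= 1 -> nrm (f t%:C) <= K) ->
  nrm (CJ f) <= 2 * K.
Proof.
move=> /cont_line[f1 f2] H; apply: le_trans (nrm_le _) _.
have E (g : R -> R) : continuous g -> (forall t, 0 <= t <= 1 -> `|g t| <= K) -> `|J g 0 1| <= K.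
  move=> cg Hg; have := @J_est R g 0 1 0 K cg ler01.
  by rewrite mul0r !subr0 mulr1; apply => y /Hg; rewrite subr0.
rewrite mulr2n mulrDl mul1r; apply: lerD; apply: E => // t /H.
  exact: le_trans (Re_le _).
exact: le_trans (Im_le _).
Qed.

Lemma CJ_FTC f df : (forall z, cderiv f z (df z)) -> holo df -> CJ df = f 1 - f 0.
Proof.
move=> Hf /cont_line[c1 c2]; apply: complexP; rewrite /CJ /=.
  by rewrite (J_FTC (fun x => (cderiv_line (Hf x%:C)).1) c1) cReD cReN.
by rewrite (J_FTC (fun x => (cderiv_line (Hf x%:C)).2) c2) cImD cImN.
Qed.

(** The mean value inequality is used for [q], then for [q x - q1 z * x], whose derivative is in
    turn controlled by a bound for [q2]. *)
Lemma cderiv_quad_bound q q1 q2 (N : R) : 0 < N -> (forall z, cderiv q z (q1 z)) ->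
  (forall z, cderiv q1 z (q2 z)) -> (forall z, ccont q2 z) -> exists2 K : R, 0 <= K &
  forall z k, nrm z + nrm k < N -> nrm (q (z + k) - q z) <= K * nrm k /\
    nrm (q (z + k) - q z - k * q1 z) <= K * nrm k ^+ 2.
Proof.
move=> N0 H1 H2 c2.
have c1 z : ccont q1 z by exact: cderiv_cont (H2 z).
have [K1 B1] := box_bounded N0 c1; have [K2 B2] := box_bounded N0 c2.
have K10 : 0 <= K1 by apply: le_trans (nrm_ge0 _) (B1 0 _); rewrite nrm0.
have K20 : 0 <= K2 by apply: le_trans (nrm_ge0 _) (B2 0 _); rewrite nrm0.
exists (K1 + K2); first exact: addr_ge0.
move=> z k zk.
have le_t (t : R) (h : R[i]) : 0 <= t <= 1 -> nrm (t%:C * h) <= nrm h.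
  by move=> /andP[t0 t1]; rewrite nrmM nrmR ger0_norm// ler_piMl ?nrm_ge0.
have zt (t : R) : 0 <= t <= 1 -> nrm (z + t%:C * k) < N.
  by move=> tb; apply: le_lt_trans (nrmD _ _) (le_lt_trans _ zk); rewrite lerD2l le_t.
have L1 : nrm (q (z + k) - q z) <= K1 * nrm k.
  by apply: (@cderiv_lip R q q1) => t tb; [exact: H1|exact/B1/zt].
split; first by apply: le_trans L1 _; rewrite ler_wpM2r ?nrm_ge0// lerDl.
have L2 (t : R) : 0 <= t <= 1 -> nrm (q1 (z + t%:C * k) - q1 z) <= K2 * nrm k.
  move=> tb; apply: (@le_trans _ _ (K2 * nrm (t%:C * k))); last by rewrite ler_wpM2l// le_t.
  apply: (@cderiv_lip R q1 q2) => s sb; first exact: H2.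
  apply: B2; apply: le_lt_trans (nrmD _ _) (le_lt_trans _ zk); rewrite lerD2l.
  exact: le_trans (le_t _ _ sb) (le_t _ _ tb).
have -> : q (z + k) - q z - k * q1 z = (q (z + k) - q1 z * (z + k)) - (q z - q1 z * z) by ring.
apply: (@le_trans _ _ (K2 * nrm k * nrm k)).
  apply: (@cderiv_lip R (fun x => q x - q1 z * x) (fun x => q1 x - q1 z)) => t tb; last exact: L2.
  apply: cderivB; first exact: H1.
  by apply: cderiv_eq (cderivZ (q1 z) (cderiv_id _)); rewrite mulr1.
by rewrite -mulrA -expr2 ler_wpM2r ?sqr_ge0// lerDr.
Qed.

Lemma holo_scale f z : holo f -> holo (fun s => f (s * z)).
Proof.
move=> hf; apply: (@holo_comp R (fun s => s * z) f) => //.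
by apply: holo_M; [move=> s; eexists; exact: cderiv_id|exact: holo_cst].
Qed.

(** The integral of [q] along the segment from 0 to [z] is a primitive because the first-order
    variation of its integrand is an exact derivative in the segment parameter. *)
Lemma primitive q q1 q2 : (forall z, cderiv q z (q1 z)) -> (forall z, cderiv q1 z (q2 z)) ->
  (forall z, ccont q2 z) -> exists h, h 0 = 0 /\ forall z, cderiv h z (q z).
Proof.
move=> H1 H2 c2.
have hq : holo q by move=> z; exists (q1 z).
have hq1 : holo q1 by move=> z; exists (q2 z).
pose F (z s : R[i]) : R[i] := z * q (s * z).
have hF z : holo (F z) by apply: holo_M; [exact: holo_cst|exact: holo_scale].
exists (fun z => CJ (F z)); split.
  by apply: complexP; rewrite /CJ /= J0// => y; rewrite /F mul0r.
move=> z.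
have N0 : 0 < nrm z + 2 by rewrite ltr_wpDl ?nrm_ge0.
have [K K0 HK] := cderiv_quad_bound N0 H1 H2 c2.
apply: (@cderiv_quad R _ _ _ (2 * ((nrm z + 1) * K))) => k k1.
(* The variation of the integrand in the direction [k]. It equals [k * d/ds (s * q (s * z))] and so
   integrates to [k * q z]. *)
pose G (s : R[i]) : R[i] := k * (q (s * z) + s * (z * q1 (s * z))).
have hid : holo (fun s : R[i] => s) by move=> s; eexists; exact: cderiv_id.
have hG : holo G.
  apply: holo_M; [exact: holo_cst|apply: holo_D; first exact: holo_scale].
  by apply: holo_M => //; apply: holo_M; [exact: holo_cst|exact: holo_scale].
have -> : q z * k = CJ G.
  rewrite (@CJ_FTC (fun s => k * (s * q (s * z))))//; first by rewrite mul1r mul0r mulr0 subr0 !mul1r mulrC.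
  move=> s; apply: cderivZ.
  have d1 : cderiv (fun s => q (s * z)) s (z * q1 (s * z)).
    apply: cderiv_eq (cderiv_comp (_ : cderiv (fun s => s * z) s z) (H1 _)); first by rewrite mulrC.
    by apply: cderiv_eq (cderivM (cderiv_id s) (cderiv_cst z s)); rewrite mulr0 addr0 mul1r.
  by apply: cderiv_eq (cderivM (cderiv_id s) d1); ring.
rewrite -CJ_B// -CJ_B//; last by apply: holo_B.
apply: (@le_trans _ _ (2 * ((nrm z + 1) * K * nrm k ^+ 2))); last by rewrite !mulrA.
apply: CJ_est.
  by apply: holo_B => //; apply: holo_B.
move=> t /andP[t0 t1].
have tz x : nrm (t%:C * x) <= nrm x by rewrite nrmM nrmR ger0_norm// ler_piMl ?nrm_ge0.
have [|E1 E2] := HK (t%:C * z) (t%:C * k).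
  by apply: le_lt_trans (lerD (tz z) (tz k)) _; rewrite ltrD2l (le_lt_trans k1)// ltr1n.
have -> : F (z + k) t%:C - F z t%:C - G t%:C =
    z * (q (t%:C * z + t%:C * k) - q (t%:C * z) - t%:C * k * q1 (t%:C * z)) +
    k * (q (t%:C * z + t%:C * k) - q (t%:C * z)).
  by rewrite /F /G mulrDr; ring.
apply: le_trans (nrmD _ _) _; rewrite !mulrDl mul1r; apply: lerD.
  rewrite nrmM -[leRHS]mulrA ler_wpM2l ?nrm_ge0//; apply: le_trans E2 _.
  by rewrite ler_wpM2l// ler_pXn2r ?nnegrE ?nrm_ge0.
rewrite nrmM expr2 mulrCA ler_wpM2l ?nrm_ge0//; apply: le_trans E1 _.
by rewrite ler_wpM2l.
Qed.

End Primitive.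

(** * Hadamard's theorem for quadratic growth *)

Section Hadamard.
Context {R : realType}.
Implicit Types (z w : R[i]).

(* The [n]-th root [exp (h / n)] has growth [al / n], so Cauchy's estimate
   bounds its second derivative, about [h'' / n], by a constant over [n]. *)
Lemma log_second_deriv (h q q1 : R[i] -> R[i]) (al A : R) : 0 < al ->
  (forall z, cderiv h z (q z)) -> (forall z, cderiv q z (q1 z)) ->
  (forall z, complex.Re (h z) <= A + al / 2 * nrm z ^+ 2) ->
  forall w, nrm (q1 w) <= 1 + 8 * al * expR 1.
Proof.
move=> al0 H1 H2 HA w.
pose X := A + al * nrm w ^+ 2 - complex.Re (h w).
(* With [n] above both terms, [X / n <= 1] and [|q w|^2 / n <= 1]; these produce the [expR 1] and
   the summand [1] of the bound. *)
have [m Hm] : exists m : nat, `|X| + nrm (q w) ^+ 2 < m.+1%:R.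
  exists (Num.truncn (`|X| + nrm (q w) ^+ 2)); exact: truncnS_gt.
pose n : R := m.+1%:R; have n0 : 0 < n by [].
(* By [|z + w|^2 <= 2 |z|^2 + 2 |w|^2], the root recentred at [w] grows with exponent [al / n]. The
   weight [4 * al / n] is twice what membership requires and makes the norm factor [sqrt 2]. *)
have al4 : 0 < 4 * al / n by rewrite divr_gt0// mulr_gt0.
pose F z := cexp (n%:C^-1 * h (z + w)).
have dh z : cderiv (fun z => n%:C^-1 * h (z + w)) z (n%:C^-1 * q (z + w)).
  by apply: cderivZ; apply: cderiv_shift.
have dF z : cderiv F z (n%:C^-1 * q (z + w) * F z).
  by apply: cderiv_eq (cderiv_comp (dh z) (cderiv_cexp _)); rewrite mulrC.
have ddF : cderiv (fun z => n%:C^-1 * q (z + w) * F z) 0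
    ((n%:C^-1 * q1 w + (n%:C^-1 * q w) ^+ 2) * F 0).
  apply: cderiv_eq (cderivM (_ : cderiv (fun z => n%:C^-1 * q (z + w)) 0 (n%:C^-1 * q1 w)) (dF 0)).
    by rewrite add0r; ring.
  by apply: cderivZ; apply: cderiv_shift; rewrite add0r.
have hF : holo F by move=> z; eexists; exact: dF.
pose C := expR ((A + al * nrm w ^+ 2) / n).
have [||z|f fE fC] := @growth_fock R _ al4 F C (al / n) hF.
- by rewrite mulrA ltr_pM2r ?invr_gt0// ltr_pM2r//; lra.
- exact: expR_ge0.
- rewrite nrm_cexp /C -expRD ler_expR -RCV mulrC cReMr mulrAC -mulrDl ler_wpM2r ?invr_ge0 ?(ltW n0)//.
  apply: le_trans (HA _) _.
  have : nrm (z + w) ^+ 2 <= 2 * nrm z ^+ 2 + 2 * nrm w ^+ 2 by exact: normcD_sqr.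
  rewrite -(@ler_pM2l _ (al / 2)) ?divr_gt0//; lra.
have [D [D0 D1 D2]] := cauchy_estimate al4 f.
have e1 : D 1%N = fun z => n%:C^-1 * q (z + w) * F z.
  apply/funext => z; apply: cderiv_uniq (D1 0%N z) _.
  by rewrite (_ : D 0%N = F)//; apply/funext => x; rewrite D0 fE.
have e2 : D 2%N 0 = (n%:C^-1 * q1 w + (n%:C^-1 * q w) ^+ 2) * F 0.
  by apply: cderiv_uniq (D1 1%N 0) _; rewrite e1.
have := D2 2%N; rewrite e2.
have -> : Num.sqrt (2`!%:R * (4 * al / n) ^+ 2) = Num.sqrt 2 * (4 * al / n).
  by rewrite sqrtrM// sqrtr_sqr gtr0_norm.
have rE : 4 * al / n / (4 * al / n - 2 * (al / n)) = 2.
  have -> : 4 * al / n - 2 * (al / n) = 2 * al / n by ring.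
  by field; rewrite !gt_eqF.
rewrite rE in fC => H.
have C0 : 0 < C by exact: expR_gt0.
have {}H : nrm ((n%:C^-1 * q1 w + (n%:C^-1 * q w) ^+ 2) * F 0) <= C * (8 * al / n).
  apply: le_trans H _; apply: (@le_trans _ _ (C * Num.sqrt 2 * (Num.sqrt 2 * (4 * al / n)))).
    by rewrite ler_wpM2r// mulr_ge0 ?sqrtr_ge0// ltW.
  have -> : C * Num.sqrt 2 * (Num.sqrt 2 * (4 * al / n)) = C * (Num.sqrt 2 ^+ 2 * (4 * al / n)) by ring.
  by rewrite sqr_sqrtr// le_eqVlt; apply/orP; left; apply/eqP; ring.
have F0 : nrm (F 0) = expR (complex.Re (h w) / n).
  by rewrite /F nrm_cexp add0r -RCV mulrC cReMr.
have E1 : n%:C^-1 * q1 w + (n%:C^-1 * q w) ^+ 2 = n%:C^-1 * (q1 w + n%:C^-1 * q w ^+ 2) by ring.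
rewrite nrmM F0 E1 nrmM nrmV nrmR (gtr0_norm n0) in H.
have {}H : nrm (q1 w + n%:C^-1 * q w ^+ 2) <= 8 * al * expR (X / n).
  have e0 := expR_gt0 (complex.Re (h w) / n).
  rewrite -(@ler_pM2r _ (n^-1 * expR (complex.Re (h w) / n))); last by rewrite mulr_gt0 ?invr_gt0.
  have -> : 8 * al * expR (X / n) * (n^-1 * expR (complex.Re (h w) / n)) = C * (8 * al / n).
    rewrite /C (_ : (A + al * nrm w ^+ 2) / n = X / n + complex.Re (h w) / n); last by rewrite /X; ring.
    by rewrite expRD; ring.
  by apply: le_trans H; rewrite le_eqVlt; apply/orP; left; apply/eqP; ring.
have q0 : 0 <= nrm (q w) ^+ 2 by exact: sqr_ge0.
have X1 : expR (X / n) <= expR 1.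
  rewrite ler_expR ler_pdivrMr// mul1r; apply: le_trans (ler_norm _) _; apply: ltW; apply: le_lt_trans Hm.
  by rewrite lerDl.
have h1 : nrm (n%:C^-1 * q w ^+ 2) <= 1.
  rewrite nrmM nrmV nrmR (gtr0_norm n0) nrmX mulrC ler_pdivrMr// mul1r; apply: ltW; apply: le_lt_trans Hm.
  by rewrite lerDr.
have -> : q1 w = (q1 w + n%:C^-1 * q w ^+ 2) - n%:C^-1 * q w ^+ 2 by rewrite addrK.
apply: le_trans (nrmB _ _) _; rewrite addrC; apply: lerD => //.
by apply: le_trans H _; rewrite ler_wpM2l// mulr_ge0// ltW.
Qed.

(** A primitive [h] of [f' / f] gives [f = f 0 * exp h]; point evaluation bounds the real part of
    [h] from above, so [h''] is bounded, hence constant. That bound alone would still allow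
    [2 |h2| = al]; strictness comes from [fock_decay]. *)
Lemma zero_free_fock (al : R) (al0 : 0 < al) (f : fock al) : (forall z, fv f z != 0) ->
  exists h1 h2 : R[i], 2 * nrm h2 < al /\
    forall z, fv f z = fv f 0 * cexp (h1 * z + h2 * z ^+ 2).
Proof.
move=> f0.
have [D [D0 D1 _]] := cauchy_estimate al0 f.
have n0 z : D 0%N z != 0 by rewrite D0.
pose q z := D 1%N z * (D 0%N z)^-1.
pose q1 z := D 2%N z * (D 0%N z)^-1 - q z ^+ 2.
have dV z : cderiv (fun z => (D 0%N z)^-1) z (- ((D 0%N z)^-1 ^+ 2 * D 1%N z)).
  by apply: cderiv_eq (cderivV (n0 z) (D1 0%N z)); rewrite exprVn mulrC.
have dq z : cderiv q z (q1 z).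
  by apply: cderiv_eq (cderivM (D1 1%N z) (dV z)); rewrite /q1 /q; ring.
have dq1 z : cderiv q1 z (D 3%N z * (D 0%N z)^-1 + D 2%N z * (- ((D 0%N z)^-1 ^+ 2 * D 1%N z)) - (q1 z * q z + q z * q1 z)).
  rewrite /q1; apply: cderivB; first exact: cderiv_eq (cderivM (D1 2%N z) (dV z)).
  rewrite (_ : (fun z => q z ^+ 2) = fun z => q z * q z); last by apply/funext => x; rewrite expr2.
  exact: cderivM.
have hD n : holo (D n) by move=> z; eexists; exact: D1.
have hV : holo (fun z => (D 0%N z)^-1) by move=> z; eexists; exact: dV.
have hq : holo q by move=> z; eexists; exact: dq.
have hq1 : holo q1 by move=> z; eexists; exact: dq1.
have c2 z : ccont (fun z => D 3%N z * (D 0%N z)^-1 + D 2%N z * (- ((D 0%N z)^-1 ^+ 2 * D 1%N z)) - (q1 z * q z + q z * q1 z)) z.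
  have c (g : R[i] -> R[i]) : holo g -> ccont g z by move=> hg; exact: holo_ccont.
  apply: ccontB; apply: ccontD; apply: ccontM; try by apply: c.
  by apply: ccontN; apply: ccontM; [apply: ccontX; exact: c|exact: c].
have [h [h0 dh]] := primitive dq dq1 c2.
have fE z : fv f z = fv f 0 * cexp (h z).
  have d0 x : cderiv (fun z => fv f z * cexp (- h z)) x 0.
    have dE : cderiv (fun z => cexp (- h z)) x (cexp (- h x) * - q x).
      by apply: cderiv_eq (cderiv_comp (cderivN (dh x)) (cderiv_cexp _)); rewrite mulrC.
    have df : cderiv (fv f) x (D 1%N x).
      by have := D1 0%N x; rewrite (_ : D 0%N = fv f)//; exact/funext.
    apply: cderiv_eq (cderivM df dE).
    by rewrite /q D0 [_ * - _](_ : _ = - (cexp (- h x) * D 1%N x * (fv f x)^-1)); [field; exact: f0|ring].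
  have := cderiv0_cst d0 z 0; rewrite h0 oppr0 cexp0 mulr1 => <-.
  by rewrite -mulrA -cexpD addNr cexp0 mulr1.
have hA : exists A, forall z, complex.Re (h z) <= A + al / 2 * nrm z ^+ 2.
  have n00 : 0 < nrm (fv f 0) by rewrite nrm_gt0.
  have hf0 : 0 < hn f.
    rewrite lt_def hn_ge0 andbT; apply: contraTneq n00 => e.
    by rewrite -leNgt; have := fv_le al0 f 0; rewrite e mul0r.
  exists (ln (hn f / nrm (fv f 0))) => z.
  rewrite -ler_expR expRD lnK ?posrE ?divr_gt0// -nrm_cexp.
  rewrite mulrAC ler_pdivlMr// mulrC -nrmM -fE; exact: fv_le.
have [A HA] := hA.
have q1c : forall z w, q1 z = q1 w by apply: liouville hq1 (log_second_deriv al0 dh dq HA).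
pose c := q1 0.
have qE z : q z = q 0 + c * z.
  have d0 x : cderiv (fun z => q z - c * z) x 0.
    by apply: cderiv_eq (cderivB (dq x) (cderivZ c (cderiv_id x))); rewrite mulr1 (q1c x 0) subrr.
  by have := cderiv0_cst d0 z 0; rewrite mulr0 subr0 => <-; rewrite subrK.
have hE z : h z = q 0 * z + c / 2 * z ^+ 2.
  have d0 x : cderiv (fun z => h z - (q 0 * z + c / 2 * z ^+ 2)) x 0.
    have d1 := cderivD (cderivZ (q 0) (cderiv_id x)) (cderivZ (c / 2) (cderivX x 2)).
    by apply: cderiv_eq (cderivB (dh x) d1); rewrite qE expr1; field.
  by have := cderiv0_cst d0 z 0; rewrite h0 expr0n !mulr0 addr0 subr0 => /eqP; rewrite subr_eq0 => /eqP.
exists (q 0), (c / 2); split; last by move=> z; rewrite fE hE.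
rewrite ltNge; apply/negP => hle.
pose H := c / 2; have H0 : 0 < nrm H by rewrite -(@pmulr_rgt0 _ 2)//; exact: lt_le_trans al0 hle.
(* On the ray through [u] the quadratic term attains its modulus, and the free sign of [u] keeps the
   linear term nonnegative. If [al <= 2 |H|], the weighted square [|f|^2 gauss] then stays above
   [|f 0|^2] on the ray instead of decaying. *)
have [u [uH u1 uq]] : exists u, [/\ complex.Re (H * u ^+ 2) = nrm H, nrm u = 1 & 0 <= complex.Re (q 0 * u)].
  pose v : R[i] := sqrtC (cj H / (nrm H)%:C).
  have v2 : v ^+ 2 = cj H / (nrm H)%:C by rewrite /v sqrtCK.
  have Hv : H * v ^+ 2 = (nrm H)%:C.
    rewrite v2 mulrA mulcJ RCX expr2 mulfK//.
    by rewrite -nrm_eq0 nrmR normr_eq0 gt_eqF.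
  have nv : nrm v = 1.
    apply/eqP; rewrite -(@eqrXn2 _ 2) ?nrm_ge0// expr1n -nrmX v2 nrmM nrmJ nrmV nrmR.
    by rewrite gtr0_norm// divff// gt_eqF.
  have [q0|q0] := leP 0 (complex.Re (q 0 * v)); first by exists v; rewrite Hv.
  exists (- v); rewrite sqrrN Hv nrmN; split => //.
  by rewrite mulrN cReN oppr_ge0 ltW.
pose w n := n%:R%:C * u.
have wn n : nrm (w n) = n%:R by rewrite nrmM u1 mulr1 nrmR ger0_norm.
have winf (B : R) : exists N, forall n, (N <= n)%N -> B <= nrm (w n).
  exists (Num.truncn B).+1 => n Nn; rewrite wn; apply: le_trans (ltW (truncnS_gt B)) _.
  by rewrite ler_nat.
have := fock_decay al0 f winf => /cvgrPdist_lt /(_ (nrm (fv f 0) ^+ 2)).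
rewrite exprn_gt0 ?nrm_gt0// => /(_ isT) [N _ /(_ N (leqnn N))] /=.
rewrite sub0r normrN ger0_norm ?sq_gauss_ge0// ltNge => /negP; apply.
have -> : nrm (fv f (w N)) ^+ 2 * gauss al (w N) = nrm (fv f 0) ^+ 2 *
    expR (2 * complex.Re (q 0 * w N + c / 2 * w N ^+ 2) - al * N%:R ^+ 2).
  rewrite (fE (w N)) hE nrmM nrm_cexp /gauss wn.
  move: (complex.Re _) (nrm _) => x y; rewrite exprMn -mulrA; congr (_ * _).
  by rewrite [expR x ^+ 2]expr2 -!expRD; congr expR; ring.
rewrite ler_peMr ?sqr_ge0// -[leLHS]expR0 ler_expR.
have -> : complex.Re (q 0 * w N + c / 2 * w N ^+ 2) = N%:R * complex.Re (q 0 * u) + N%:R ^+ 2 * nrm H.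
  rewrite -uH cReD; congr (_ + _).
    by rewrite /w mulrCA mulrC cReMr mulrC.
  by rewrite /w exprMn -RCX mulrCA mulrC cReMr mulrC.
have N0 : 0 <= N%:R :> R by [].
have N2 : 0 <= N%:R ^+ 2 :> R by exact: sqr_ge0.
have h1 := mulr_ge0 N0 uq.
have h2 : al * N%:R ^+ 2 <= 2 * nrm H * N%:R ^+ 2 by rewrite ler_wpM2r.
lra.
Qed.

End Hadamard.

(** * Spectra *)

Section Operators.
Context {R : realType}.
Variable al : R.
Hypothesis al0 : 0 < al.
Implicit Types (f g : fock al) (T Q : fock al -> fock al) (z w l c : R[i]) (q : R).

Notation bop := (bounded_op (@fock_dot R al)).
Notation spec := (spectrum (@fock_dot R al)).

Lemma linD T f g : linear T -> T (f + g) = T f + T g.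
Proof. by move=> lT; have := lT 1 f g; rewrite !scale1r. Qed.

Lemma lin0 T : linear T -> T 0 = 0.
Proof.
by move=> lT; have := linD 0 0 lT; rewrite addr0 => /eqP; rewrite -subr_eq0 opprD addNKr oppr_eq0 => /eqP.
Qed.

Lemma linZ T c f : linear T -> T (c *: f) = c *: T f.
Proof. by move=> lT; rewrite -[c *: f]addr0 lT lin0// addr0. Qed.

Lemma linB T f g : linear T -> T (f - g) = T f - T g.
Proof. by move=> lT; rewrite linD// -scaleN1r linZ// scaleN1r. Qed.

Lemma bop_lin T : bop T -> linear T. Proof. by case. Qed.

Lemma bopP T : linear T -> (exists M : R, forall f, hn (T f) <= M * hn f) -> bop T.
Proof. by []. Qed.

Lemma bop_bound T : bop T -> exists2 M : R, 0 <= M & forall f, hn (T f) <= M * hn f.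
Proof.
move=> [_ [M HM]]; exists `|M| => // f; apply: le_trans (HM f) _.
by rewrite ler_wpM2r ?hn_ge0 ?ler_norm.
Qed.

Lemma bop_id : bop id.
Proof. by split=> //; exists 1 => f; rewrite mul1r. Qed.

Lemma bop_comp T Q : bop T -> bop Q -> bop (fun f => T (Q f)).
Proof.
move=> bT bQ; have [M M0 HM] := bop_bound bT; have [K K0 HK] := bop_bound bQ.
split; first by move=> c f g; rewrite (bop_lin bQ) (bop_lin bT).
by exists (M * K) => f; apply: le_trans (HM _) _; rewrite -mulrA ler_wpM2l// HK.
Qed.

Lemma bop_comb c T Q : bop T -> bop Q -> bop (fun f => c *: T f + Q f).
Proof.
move=> bT bQ; have [M M0 HM] := bop_bound bT; have [K K0 HK] := bop_bound bQ.
split.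
  move=> e f g; rewrite (bop_lin bQ) (bop_lin bT) scalerDr !scalerA.
  by rewrite [c * e]mulrC -!scalerA scalerDr addrACA.
exists (nrm c * M + K) => f; apply: le_trans (hnD _ _ _) _ => //.
rewrite mulrDl; apply: lerD; last exact: HK.
by rewrite hnZ// -mulrA ler_wpM2l ?nrm_ge0// HM.
Qed.

Lemma bop_scale c T : bop T -> bop (fun f => c *: T f).
Proof.
move=> bT; have [M M0 HM] := bop_bound bT; split.
  by move=> e f g; rewrite (bop_lin bT) scalerDr !scalerA [c * e]mulrC.
by exists (nrm c * M) => f; rewrite -/(hn _) hnZ// -mulrA ler_wpM2l ?nrm_ge0// HM.
Qed.

Lemma bop_iter n T : bop T -> bop (iter n T).
Proof. by move=> bT; elim: n => [|n IH]; [exact: bop_id|exact: (bop_comp bT IH)]. Qed.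

Lemma iter_bound n T q f : 0 <= q -> (forall f, hn (T f) <= q * hn f) -> hn (iter n T f) <= q ^+ n * hn f.
Proof.
move=> q0 H; elim: n => [|n IH]; first by rewrite expr0 mul1r.
by rewrite iterS exprS -mulrA; apply: le_trans (H _) _; rewrite ler_wpM2l.
Qed.

(** An inverse of [T - l] bounded by [M] would give [hn f <= M * hn (T f - l *: f)] for every
    [f]. *)
Lemma spec_approx T l :
  (forall M : R, 0 <= M -> exists f, M * hn (T f - l *: f) < hn f) -> spec T l.
Proof.
move=> H [S [bS S1 _]]; have [M M0 HM] := bop_bound bS.
by have [f] := H M M0; rewrite ltNge => /negP; apply; rewrite -{1}[f]S1; exact: HM.
Qed.

Lemma spec_eigen T l f : hn f != 0 -> T f = l *: f -> spec T l.
Proof.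
move=> f0 Tf; apply: spec_approx => M M0; exists f.
rewrite Tf subrr -[0 : fock al](scale0r 0) hnZ// nrm0 mul0r mulr0.
by rewrite lt_def f0 hn_ge0.
Qed.

Lemma geo_le0 (x K q : R) : 0 <= q < 1 -> (forall m, x <= K * q ^+ m) -> x <= 0.
Proof.
move=> /andP[q0 q1] H; rewrite leNgt; apply/negP => x0.
have : (fun m => K * q ^+ m) @ \oo --> (0 : R).
  by apply: cvg_geometric; rewrite ger0_norm.
move=> /cvgrPdist_lt /(_ x x0)[N _ /(_ N (leqnn N))] /=.
by rewrite sub0r normrN => /(le_lt_trans (ler_norm _)); rewrite ltNge H.
Qed.

(** The sum of the iterates is formed pointwise and placed in the space by [fock_lim]; [fock_lim]
    applied to the blocks [P m n] gives the geometric tail bounds from which both identities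
    follow. *)
Lemma neumann T q : linear T -> 0 <= q < 1 -> (forall f, hn (T f) <= q * hn f) ->
  exists Q, [/\ bop Q, forall f, Q (f - T f) = f & forall f, Q f - T (Q f) = f].
Proof.
move=> lT /andP[q0 q1] HT.
have q10 : 0 < 1 - q by rewrite subr_gt0.
pose P m n f := \sum_(k < n) iter (m + k) T f.
have hnP m n f : hn (P m n f) <= q ^+ m / (1 - q) * hn f.
  have : hn (P m n f) <= q ^+ m * (1 - q ^+ n) / (1 - q) * hn f.
    elim: n => [|n IH].
      by rewrite /P big_ord0 -[0 : fock al](scale0r 0) hnZ// nrm0 mul0r expr0 subrr mulr0 !mul0r.
    rewrite /P big_ord_recr; apply: le_trans (hnD al0 _ _) _.
    apply: le_trans (lerD IH (iter_bound (m + n) f q0 HT)) _.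
    rewrite -mulrDl ler_wpM2r ?hn_ge0// exprD exprS le_eqVlt; apply/orP; left; apply/eqP; field.
    by rewrite gt_eqF.
  move=> /le_trans; apply; rewrite ler_wpM2r ?hn_ge0// ler_wpM2r ?invr_ge0 ?(ltW q10)//.
  by rewrite ler_piMr ?exprn_ge0// gerBl exprn_ge0.
have cv f z : exists v, ccvg (fun n => fv (P 0%N n f) z) v.
  have [||v Hv] := @ccvg_series R (fun k => fv (iter k T f) z) (fun k => hn f * expR (al / 2 * nrm z ^+ 2) * q ^+ k).
  - move=> k; apply: le_trans (fv_le al0 _ _) _; rewrite mulrC [leRHS]mulrAC mulrC.
    by rewrite ler_wpM2r ?expR_ge0// mulrC iter_bound.
  - by apply: is_cvg_geometric_series; rewrite ger0_norm.
  - by exists v; apply: ccvg_eq Hv => n; rewrite /P fv_sum.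
pose v f z := sval (cid (cv f z)).
have vP f z : ccvg (fun n => fv (P 0%N n f) z) (v f z) by rewrite /v; case: cid.
have exQ f : exists g, fv g =1 v f.
  have [|g gE _] := @fock_lim R al al0 (fun n => P 0%N n f) (v f) (q ^+ 0 / (1 - q) * hn f) _ (vP f).
    by move=> n; exact: hnP.
  by exists g.
pose Q f := sval (cid (exQ f)).
have QE f z : fv (Q f) z = v f z by rewrite /Q; case: cid => /=.
have PD m n f : P 0%N (m + n)%N f = P 0%N m f + P m n f.
  by rewrite /P big_split_ord.
have tail m f : hn (Q f - P 0%N m f) <= q ^+ m / (1 - q) * hn f.
  have [||g gE gC] := @fock_lim R al al0 (fun n => P m n f) (fun z => v f z - fv (P 0%N m f) z) (q ^+ m / (1 - q) * hn f).
  - by move=> n; exact: hnP.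
  - move=> z; apply: ccvg_eq (ccvgB (ccvg_shift m (vP f z)) (ccvg_cst (fv (P 0%N m f) z))) => n.
    by rewrite addnC PD fvD addrC addKr.
  - by rewrite (_ : Q f - _ = g)//; apply: fv_inj => z; rewrite gE fvB QE.
have lP n : linear (P 0%N n).
  move=> c f g; rewrite /P scaler_sumr -big_split /=; apply: eq_bigr => k _.
  by elim: (0 + k)%N => //= j ->; rewrite lT.
have lQ : linear Q.
  move=> c f g; apply: fv_inj => z; rewrite QE fvD fvZ !QE.
  apply: ccvg_uniq (vP _ z) _.
  by apply: ccvg_eq (ccvgD (ccvgZ c (vP f z)) (vP g z)) => n; rewrite lP fvD fvZ.
have PSr n f : P 0%N n.+1 f = P 0%N n f + iter n T f by rewrite /P big_ord_recr.
have PS n f : P 0%N n.+1 f = f + T (P 0%N n f).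
  elim: n => [|n IH]; first by rewrite PSr /P big_ord0 lin0// addr0 add0r.
  by rewrite PSr {1}IH PSr linD// addrA.
have PT n f : P 0%N n (f - T f) = f - iter n T f.
  elim: n => [|n IH]; first by rewrite /P big_ord0 subrr.
  rewrite /P big_ord_recr /= -/(P 0%N n _) IH.
  have -> : iter n T (f - T f) = iter n T f - iter n.+1 T f.
    by rewrite iterSr; elim: (n) => //= j ->; rewrite linB.
  by rewrite addrA subrK.
have bQ : bop Q.
  apply: bopP => //; exists (1 / (1 - q)) => f.
  by have := tail 0%N f; rewrite {1}/P big_ord0 subr0 expr0.
have z0 (x : fock al) (K : R) : (forall m, hn x <= K * q ^+ m) -> x = 0.
  by move=> H; apply: (hn_eq0 al0); apply: geo_le0 H; rewrite q0.
exists Q; split=> // f; apply/eqP; rewrite -subr_eq0; apply/eqP.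
- apply: (z0 _ (1 / (1 - q) * hn (f - T f) + hn f)) => m.
  have -> : Q (f - T f) - f = (Q (f - T f) - P 0%N m (f - T f)) - iter m T f.
    by rewrite PT; apply: fv_inj => z; rewrite !fvB; ring.
  apply: le_trans (hnB al0 _ _) _; rewrite mulrDl; apply: lerD.
    by apply: le_trans (tail _ _) _; rewrite le_eqVlt; apply/orP; left; apply/eqP; ring.
  by rewrite mulrC; exact: iter_bound.
- apply: (z0 _ ((q + q) / (1 - q) * hn f)) => m.
  have -> : Q f - T (Q f) - f = (Q f - P 0%N m.+1 f) - T (Q f - P 0%N m f).
    by rewrite PS linB//; apply: fv_inj => z; rewrite !fvB fvD; ring.
  apply: le_trans (hnB al0 _ _) _.
  have h1 := tail m.+1 f; have h2 := HT (Q f - P 0%N m f).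
  have h3 := ler_wpM2l q0 (tail m f).
  have -> : (q + q) / (1 - q) * hn f * q ^+ m = q ^+ m.+1 / (1 - q) * hn f + q * (q ^+ m / (1 - q) * hn f).
    by rewrite exprS; ring.
  by apply: lerD => //; exact: le_trans h2 h3.
Qed.

Lemma unit_arg (u : R[i]) : nrm u = 1 -> exists t : R, cexp ('i * t%:C) = u.
Proof.
move=> u1; have x1 : -1 <= complex.Re u <= 1.
  by rewrite -ler_norml -u1 Re_le.
have s2 : complex.Im u ^+ 2 = 1 - complex.Re u ^+ 2.
  by have := nrm_sqr u; rewrite u1 expr1n => ->; rewrite addrC addKr.
have E (t : R) : cexp ('i * t%:C) = cos t +i* sin t.
  apply: complexP; rewrite /cexp cReM ?cImM /=; rewrite !(mul0r, mulr0, mul1r, mulr1, addr0, add0r, subr0, oppr0, expR0, sub0r); by [].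
have [s0|s0] := leP 0 (complex.Im u).
  exists (acos (complex.Re u)); rewrite E acosK ?in_itv//= sin_acos// -s2 sqrtr_sqr ger0_norm//.
  by case: (u).
exists (- acos (complex.Re u)); rewrite E cosN sinN acosK ?in_itv//= sin_acos// -s2 sqrtr_sqr ltr0_norm// opprK.
by case: (u).
Qed.

Lemma closureP (A : set R[i]) l :
  closure (A : set R[i]^o) l <-> forall e : R, 0 < e -> exists2 x, A x & nrm (x - l) < e.
Proof.
split=> [H e e0|H B /nbhs_normP[d /ltC0[r r0 ->] dB]].
  have [|x [Ax xe]] := H [set x : R[i]^o | nrm (x - l) < e].
    apply/(@nbhs_normP R[i] R[i]^o); exists e%:C; first by rewrite /= ltcR.
    move=> x /=; rewrite distrC => h.
    by rewrite -ltcR.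
  by exists x.
have [x Ax xr] := H r r0; exists x; split => //; apply: dB => /=.
rewrite distrC [ltLHS](_ : _ = (nrm (x - l))%:C) ?ltcR//.
Qed.

Lemma expr_lt (t e : R) : 0 <= t < 1 -> 0 < e -> exists n, t ^+ n < e.
Proof.
move=> /andP[t0 t1] e0.
have : (fun m => 1 * t ^+ m) @ \oo --> (0 : R) by apply: cvg_geometric; rewrite ger0_norm.
move=> /cvgrPdist_lt /(_ e e0)[N _ /(_ N (leqnn N))] /=.
by rewrite sub0r normrN mul1r => /(le_lt_trans (ler_norm _)) H; exists N.
Qed.

End Operators.

(** * Adjoint and symmetry; the cases [|a| = 1] and [a = 0] *)

Section Weighted.
Context {R : realType}.
Variable al : R.
Hypothesis al0 : 0 < al.
Variables (Psi Phi : R[i] -> R[i]) (a d : R[i]) (W S J : fock al -> fock al).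
Hypothesis hPsi : holo Psi.
Hypothesis Psi_neq0 : exists z, Psi z != 0.
Hypothesis PhiE : forall z, Phi z = a * z + d.
Hypothesis WE : forall f z, fv (W f) z = Psi z * fv f (Phi z).
Notation bop := (bounded_op (@fock_dot R al)).
Notation spec := (spectrum (@fock_dot R al)).
Hypothesis bW : bop W.
Hypothesis bS : bop S.
Hypothesis adj : forall f g, dot (W f) g = dot f (S g).
Hypothesis J_lin : forall c f g, J (c *: f + g) = cj c *: J f + J g.
Hypothesis JK : forall f, J (J f) = f.
Hypothesis W_sym : forall f, W f = J (S (J f)).
Implicit Types (f g : fock al) (z w l c : R[i]).

Lemma conjC_N z : cj (- z) = - cj z. Proof. exact: rmorphN. Qed.

Lemma dot_ext_r f g : (forall h, dot h f = dot h g) -> f = g.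
Proof. by move=> H; apply: (dot_ext al0) => h; rewrite dotC// H -dotC. Qed.

Lemma S_ker w : S (ker al0 w) = cj (Psi w) *: ker al0 (Phi w).
Proof.
apply: dot_ext_r => h; rewrite -adj reproducing WE dotZr// conjC_K reproducing//.
Qed.

Lemma J_scale c f : J (c *: f) = cj c *: J f.
Proof.
have J0 : J 0 = 0.
  have := J_lin 1 0 0; rewrite scale1r addr0 conjC_R scale1r => /eqP.
  by rewrite -subr_eq0 opprD addNKr oppr_eq0 => /eqP.
by have := J_lin c f 0; rewrite addr0 J0 addr0.
Qed.

Lemma SJ f : S (J f) = J (W f). Proof. by rewrite W_sym JK. Qed.

Lemma Psi_bound : exists2 M : R, 0 <= M &
  forall w, nrm (Psi w) * expR (al / 2 * nrm (Phi w) ^+ 2) <= M * expR (al / 2 * nrm w ^+ 2).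
Proof.
have [M M0 HM] := bop_bound bS; exists M => // w.
by have := HM (ker al0 w); rewrite S_ker hnZ// nrmJ !hn_ker_eq.
Qed.

Section Unimodular.
Hypothesis a1 : nrm a = 1.

Lemma aJ : a * cj a = 1. Proof. by rewrite mulcJ a1 expr1n. Qed.

Lemma Psi_form z : Psi z = Psi 0 * cexp (- (al%:C * (a * cj d) * z)).
Proof.
have [M M0 HM] := Psi_bound.
have hF : holo (fun z => Psi z * cexp (al%:C * (a * cj d) * z)).
  apply: holo_M => //; apply: holo_cexp_comp; apply: holo_M; first exact: holo_cst.
  by move=> x; eexists; exact: cderiv_id.
have bF x : nrm (Psi x * cexp (al%:C * (a * cj d) * x)) <= M * expR (- (al / 2 * nrm d ^+ 2)).
  rewrite nrmM nrm_cexp.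
  (* Because [|a| = 1], the terms [|x|^2] cancel in [Psi_bound]; the remaining term, linear in [x],
     is compensated by the exponential factor. *)
  have E : nrm (Phi x) ^+ 2 = nrm x ^+ 2 + 2 * complex.Re (a * cj d * x) + nrm d ^+ 2.
    have e1 : nrm (a * x) ^+ 2 = nrm x ^+ 2 by rewrite nrmM a1 mul1r.
    rewrite -e1 PhiE !nrm_sqr.
    have -> : a * cj d * x = (a * x) * cj d by ring.
    by case: (a * x) d => [b c] [e h] /=; ring.
  have := HM x; rewrite E; set X := complex.Re (a * cj d * x).
  have -> : complex.Re (al%:C * (a * cj d) * x) = al * X by rewrite -mulrA mulrC cReMr mulrC.
  move=> H; have e0 : 0 < expR (al / 2 * (nrm x ^+ 2 + nrm d ^+ 2)) by exact: expR_gt0.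
  rewrite -(@ler_pM2r _ (expR (al / 2 * (nrm x ^+ 2 + nrm d ^+ 2))))//.
  have -> : nrm (Psi x) * expR (al * X) * expR (al / 2 * (nrm x ^+ 2 + nrm d ^+ 2)) =
    nrm (Psi x) * expR (al / 2 * (nrm x ^+ 2 + 2 * X + nrm d ^+ 2)).
    by rewrite -mulrA -expRD; congr (_ * expR _); field.
  rewrite -[leRHS]mulrA -expRD; apply: le_trans H _; rewrite ler_wpM2l// ler_expR.
  lra.
have := liouville hF bF z 0; rewrite mulr0 cexp0 mulr1 => <-.
by rewrite -mulrA -cexpD subrr cexp0 mulr1.
Qed.

Lemma Psi0_neq0 : Psi 0 != 0.
Proof. by case: Psi_neq0 => z; apply: contraNneq => e; rewrite Psi_form e mul0r. Qed.

(** The factor by which [W] multiplies norms: [W S = S W = rho ^+ 2], so [W / rho] is unitary. *)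
Definition rho : R := nrm (Psi 0) * expR (al / 2 * nrm d ^+ 2).

Lemma rho_gt0 : 0 < rho.
Proof. by rewrite mulr_gt0 ?expR_gt0// nrm_gt0 Psi0_neq0. Qed.

Lemma rho_sqr : rho ^+ 2 = nrm (Psi 0) ^+ 2 * expR (al * nrm d ^+ 2).
Proof. by rewrite exprMn [expR _ ^+ 2]expr2 -expRD; congr (_ * expR _); field. Qed.

Lemma WS_ker w : W (S (ker al0 w)) = (rho ^+ 2)%:C *: ker al0 w.
Proof.
apply: fv_inj => z; rewrite S_ker WE !fvZ !fv_ker /kf !PhiE (Psi_form z) (Psi_form w) rho_sqr.
rewrite RCM -mulcJ -cexpR conjC_M cexpJ.
have H (p e q e' k : R[i]) : p * e * (q * e' * k) = p * q * (e * e' * k) by ring.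
rewrite H -[RHS]mulrA; congr (_ * _); rewrite -!cexpD; congr cexp.
rewrite conjC_N !conjC_M conjC_D conjC_M conjC_K conjC_R RCM -mulcJ.
have -> : al%:C * (cj a * cj w + cj d) * (a * z + d) = al%:C * ((a * cj a) * cj w * z + cj a * cj w * d + a * cj d * z + d * cj d) by ring.
by rewrite aJ; ring.
Qed.

(** [W S] is self-adjoint, so its action on kernels determines the value of [W (S f)] at every
    point. *)
Lemma WS f : W (S f) = (rho ^+ 2)%:C *: f.
Proof.
apply: fv_inj => w; rewrite -reproducing adj [LHS]dotC// -adj WS_ker dotZl// conjC_M conjC_R.
by rewrite -dotC// reproducing fvZ.
Qed.

(** Here complex symmetry makes the co-isometry an isometry: [S J = J W] turns [S W = S J S J] into
    [J W S J], to which [WS] applies. *)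
Lemma SW f : S (W f) = (rho ^+ 2)%:C *: f.
Proof. by rewrite W_sym SJ WS J_scale conjC_R JK. Qed.

Lemma dotWW f g : dot (W f) (W g) = (rho ^+ 2)%:C * dot f g.
Proof. by rewrite adj SW dotZr// conjC_R. Qed.

Lemma hn_W f : hn (W f) = rho * hn f.
Proof.
have E : nn (W f) = rho ^+ 2 * nn f.
  have := dotWW f f; rewrite !dot_self// -RCM => e.
  by have := congr1 (@complex.Re R) e.
apply/eqP; rewrite -(@eqrXn2 _ 2) ?hn_ge0 ?(mulr_ge0 (ltW rho_gt0) (hn_ge0 _))//.
by rewrite exprMn !hn_sqr// E.
Qed.

Lemma hn_S f : hn (S f) = rho * hn f.
Proof.
have r0 : rho != 0 by rewrite gt_eqF// rho_gt0.
apply: (mulfI r0); rewrite -(hn_W (S f)) WS hnZ// nrmR ger0_norm ?sqr_ge0//.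
by ring.
Qed.

Lemma ker_neq0 w : hn (ker al0 w) != 0.
Proof. by rewrite hn_ker_eq gt_eqF// expR_gt0. Qed.

Lemma spec_scalar : a = 1 -> d = 0 -> spec W = [set Psi 0].
Proof.
move=> a_1 d0.
have WcE f : W f = Psi 0 *: f.
  apply: fv_inj => z; rewrite WE fvZ (Psi_form z) d0 conjc0 mulr0 mulr0 mul0r oppr0 cexp0 mulr1.
  by rewrite PhiE a_1 d0 mul1r addr0.
apply/seteqP; split=> [l|_ ->]; last first.
  by apply: (spec_eigen (ker_neq0 0)); rewrite WcE.
apply: contraPP => /eqP lc; case; exists (fun f => (Psi 0 - l)^-1 *: f).
have c0 : Psi 0 - l != 0 by rewrite subr_eq0 eq_sym.
split=> [|f|f]; first exact: (@bop_scale R al _ id (bop_id al)).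
  by rewrite WcE -scalerBl scalerA mulVf// scale1r.
by rewrite WcE -scalerBl scalerA mulfV// scale1r.
Qed.

(** For [|l| < rho] factor [W - l = W (1 - l rho^-2 S)], for [|l| > rho] factor
    [W - l = - l (1 - l^-1 W)]; the perturbations of the identity have norms [|l| / rho] and
    [rho / |l|]. *)
Lemma spec_rho l : spec W l -> nrm l = rho.
Proof.
apply: contraPP => lr; case.
have r0 := rho_gt0.
have [lt|] := ltrP (nrm l) rho.
  have [||f|Q [bQ Q1 Q2]] := @neumann R al al0 (fun f => (l / (rho ^+ 2)%:C) *: S f) (nrm l / rho).
  - exact: (bop_lin (bop_scale _ bS)).
  - by rewrite divr_ge0 ?nrm_ge0 ?(ltW r0)// ltr_pdivrMr// mul1r.
  - rewrite hnZ// hn_S nrmM nrmV nrmR ger0_norm ?sqr_ge0// le_eqVlt; apply/orP; left; apply/eqP.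
    by field; rewrite gt_eqF.
  have rC : (rho ^+ 2)%:C != 0 :> R[i] by rewrite -nrm_eq0 nrmR normr_eq0 expf_neq0// gt_eqF.
  have WA f : W f - l *: f = W (f - (l / (rho ^+ 2)%:C) *: S f).
    rewrite (linB _ _ (bop_lin bW)) (linZ _ _ (bop_lin bW)) WS scalerA mulfVK//.
  exists (fun f => Q ((rho ^+ 2)%:C^-1 *: S f)); split=> [|f|f].
  - exact: (bop_comp bQ (bop_scale _ bS)).
  - by rewrite WA SW scalerA mulVf// scale1r Q1.
  - by rewrite WA Q2 (linZ _ _ (bop_lin bW)) WS scalerA mulVf// scale1r.
rewrite le_eqVlt eq_sym => /orP[/eqP//|lt].
have l0 : 0 < nrm l by exact: lt_trans lt.
have lC : l != 0 by rewrite -nrm_gt0.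
have [||f|Q [bQ Q1 Q2]] := @neumann R al al0 (fun f => l^-1 *: W f) (rho / nrm l).
- exact: (bop_lin (bop_scale _ bW)).
- by rewrite divr_ge0 ?nrm_ge0 ?(ltW r0)// ltr_pdivrMr// mul1r.
- by rewrite hnZ// hn_W nrmV mulrCA mulrA.
have WA f : W f - l *: f = - l *: (f - l^-1 *: W f).
  by rewrite scalerBr scalerA mulNr mulfV// !scaleNr scale1r opprK addrC.
exists (fun f => - l^-1 *: Q f); split=> [|f|f].
- exact: (bop_scale _ bQ).
- by rewrite WA (linZ _ _ (bop_lin bQ)) Q1 scalerA mulrNN mulVf// scale1r.
- rewrite WA (linZ _ _ (bop_lin bW)) scalerBr !scalerA mulrNN mulfV// scale1r.
  by rewrite (_ : - l / l * - l^-1 = l^-1) ?Q2//; field.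
Qed.

(* With [b] chosen so that [<(W / l)^k K_b, K_b>] is positive for all [k], the
   vectors [(W / l)^k K_b], [k < N], have a sum of norm at least [sqrt N ||K_b||]
   which [W - l] maps to a bounded vector. *)
Lemma spec_translation l : a = 1 -> d != 0 -> nrm l = rho -> spec W l.
Proof.
move=> a_1 d0 lr.
have r0 := rho_gt0.
have lC : l != 0 by rewrite -nrm_gt0 lr.
have dn : 0 < nrm d by rewrite nrm_gt0.
(* [eta] is the phase of [l / Psi 0], the modulus being fixed by [|l| = rho]. Under translation by
   [d] the phase contributed by [K_b] is governed by the imaginary part of [cj d * b], so a real
   multiple of [i d] can be taken for [b] to cancel the argument [t]. *)
pose eta := l / Psi 0 * (expR (- (al / 2 * nrm d ^+ 2)))%:C.
have eta1 : nrm eta = 1.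
  rewrite !nrmM nrmV nrmR ger0_norm ?expR_ge0// lr /rho expRN -mulrA mulrACA mulrC.
  rewrite [_ / nrm _]mulrC mulVf ?gt_eqF ?nrm_gt0 ?Psi0_neq0// mulr1.
  by rewrite divff// gt_eqF// expR_gt0.
have [t tE] := unit_arg eta1.
pose b := 'i * (- t / (2 * al * nrm d ^+ 2))%:C * d.
have bd : cj d * b - cj b * d = - ('i * (t / al)%:C).
  have e1 : cj b * d = - ('i * (- t / (2 * al * nrm d ^+ 2))%:C * (nrm d ^+ 2)%:C).
    rewrite /b conjC_M conjC_M conjC_R -mulcJ; have -> : cj 'i = - 'i :> R[i] by apply: complexP; rewrite /= ?oppr0.
    by ring.
  have e2 : cj d * b = 'i * (- t / (2 * al * nrm d ^+ 2))%:C * (nrm d ^+ 2)%:C.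
    by rewrite /b -mulcJ; ring.
  rewrite e1 e2 opprK -!mulrA -!RCM -mulrDr -RCD -mulrN -RCN; congr ('i * _%:C).
  by field; rewrite !gt_eqF.
pose U f := l^-1 *: W f.
(* The factors [Psi (z + j d)] for [j < k] multiply up; the sum of these [j] produces
   [k (k - 1) / 2]. *)
have Uiter k z : fv (iter k U (ker al0 b)) z =
    (Psi 0 / l) ^+ k * cexp (- (al%:C * cj d * (k%:R * z)) - al%:C * (d * cj d) * (k%:R * (k%:R - 1) / 2) + al%:C * cj b * (z + k%:R * d)).
  elim: k z => [|k IH] z.
    by rewrite fv_ker /kf expr0 mul1r; congr cexp; ring.
  rewrite iterS fvZ WE IH PhiE a_1 mul1r (Psi_form z) a_1 mul1r exprS.
  have H (e1 e2 p x : R[i]) : l^-1 * (p * e1 * (x * e2)) = p / l * x * (e1 * e2) by ring.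
  rewrite H -cexpD; congr (_ * cexp _).
  by rewrite -[k.+1%:R]natr1; field.
have Ub k : fv (iter k U (ker al0 b)) b = (expR (al * nrm b ^+ 2 - al / 2 * nrm d ^+ 2 * k%:R ^+ 2))%:C.
  have kb : k%:R = k%:R%:C :> R[i] by rewrite rmorph_nat.
  rewrite Uiter -cexpR.
  have E1 : Psi 0 / l = cexp (- ('i * t%:C)) * cexp (- (al / 2 * nrm d ^+ 2)%:C).
    rewrite (cexpN ('i * _)) tE /eta -RCN cexpR; field.
    by rewrite lC Psi0_neq0 -nrm_eq0 nrmR normr_eq0 gt_eqF ?expR_gt0.
  rewrite E1 -cexpD cexpX -cexpD; congr cexp.
  have -> : al%:C * cj b * (b + k%:R * d) = al%:C * (cj b * b) + al%:C * k%:R * (cj d * b - (cj d * b - cj b * d)) by ring.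
  have two : 2%:C = 2 :> R[i] by rewrite rmorph_nat.
  have h2 : (al / 2 * nrm d ^+ 2)%:C = al%:C / 2 * (d * cj d) by rewrite mulcJ (RCM (al / 2)) (RCM al) RCV two.
  rewrite RCB (RCM al) (RCM (al / 2 * nrm d ^+ 2)) h2 RCX -kb bd -(mulcJ b) (RCM t) RCV.
  have a0 : al%:C != 0 :> R[i] by rewrite -nrm_eq0 nrmR normr_eq0 gt_eqF.
  by field.
have dotUU f g : dot (U f) (U g) = dot f g.
  rewrite dotZl dotZr// dotWW -lr mulrA mulrA RCX -RCX -mulcJ.
  have lJ : cj l != 0 by rewrite -nrm_gt0 nrmJ lr.
  have -> : cj l^-1 = (cj l)^-1 by rewrite fmorphV.
  by field; rewrite lC lJ.
have dotUn n f g : dot (iter n U f) (iter n U g) = dot f g by elim: n => //= n IH; rewrite dotUU.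
pose s n := \sum_(k < n) iter k U (ker al0 b).
(* As [U] is isometric, each mixed inner product reduces to that of [K_b] with [U^(n-k) K_b], a
   positive number by [Ub]; so the squared norm of the sum is at least the sum of the squared
   norms. *)
have big n : n%:R * nn (ker al0 b) <= nn (s n).
  elim: n => [|n IH]; first by rewrite mul0r nn_ge0.
  rewrite /s big_ord_recr /= -/(s n) nnD// -natr1 mulrDl mul1r.
  have -> : nn (iter n U (ker al0 b)) = nn (ker al0 b).
    have := dotUn n (ker al0 b) (ker al0 b); rewrite !dot_self// => e.
    by have := congr1 (@complex.Re R) e.
  rewrite lerD2r; apply: le_trans IH _; rewrite lerDl mulr_ge0//.
  rewrite /s dot_suml (big_morph _ (@cReD R) (erefl : complex.Re (0 : R[i]) = 0)).
  apply: sumr_ge0 => k _; rewrite -[in X in dot _ X](subnKC (ltnW (ltn_ord k))) iterD dotUn.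
  by rewrite dotC// cReJ reproducing Ub /= expR_ge0.
apply: spec_approx => M M0.
pose K := M * (rho * 2).
have K0 : 0 <= K := mulr_ge0 M0 (mulr_ge0 (ltW r0) (ler0n _ 2)).
(* [N > K ^+ 2], so the norm of [s N], at least [sqrt N] times that of [K_b], beats the bound
   [K * hn (ker al0 b)] for [M] times the telescoped image under [W - l]. *)
exists (s (Num.truncn (K ^+ 2)).+1); set N := (Num.truncn (K ^+ 2)).+1.
have E n : W (s n) - l *: s n = l *: (iter n U (ker al0 b) - ker al0 b).
  have lU f : W f = l *: U f by rewrite scalerA mulfV// scale1r.
  elim: n => [|n IH].
    by rewrite /s big_ord0 subrr scaler0 subr0 (lin0 (bop_lin bW)).
  rewrite /s big_ord_recr /= -/(s n) (linD _ _ (bop_lin bW)) scalerDr opprD addrACA IH lU.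
  by rewrite -scalerBr -scalerDr; congr (l *: _); rewrite addrC addrA subrK.
have hU n : hn (iter n U (ker al0 b)) = hn (ker al0 b).
  elim: n => [//|n IH]; rewrite iterS /U hnZ// hn_W IH nrmV lr mulrA mulVf ?gt_eqF// mul1r//.
have k0 : 0 < hn (ker al0 b) by rewrite lt_def ker_neq0 hn_ge0.
rewrite E hnZ// lr.
apply: (@le_lt_trans _ _ (K * hn (ker al0 b))).
  rewrite /K -[leRHS]mulrA ler_wpM2l// -mulrA ler_wpM2l ?(ltW r0)//.
  by apply: le_trans (hnB al0 _ _) _; rewrite hU mulr2n mulrDl mul1r.
rewrite -(@ltr_pXn2r _ 2) ?nnegrE ?hn_ge0 ?(mulr_ge0 K0 (hn_ge0 _))// exprMn !hn_sqr//.
apply: lt_le_trans (big N); rewrite ltr_pM2r; first exact: truncnS_gt.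
by rewrite -hn_sqr// exprn_gt0.
Qed.

Section Rotation.
Hypothesis a_neq1 : a != 1.
Let p := d / (1 - a).
Let x k := Psi p * a ^+ k.

Lemma dE : d = (1 - a) * p.
Proof. by rewrite /p mulrC divfK// subr_eq0 eq_sym. Qed.

(** [Phi z - p = a (z - p)] yields the power of [a], and [Psi_form] with [d = (1 - a) p] and
    [a * cj a = 1] makes [Psi * (K_p o Phi)] equal to [Psi p * K_p]. *)
Lemma W_eb k : W (eb al0 p k) = x k *: eb al0 p k.
Proof.
apply: fv_inj => z; rewrite WE fvZ !fv_eb /x /kf PhiE.
have -> : a * z + d - p = a * (z - p) by rewrite {1}dE; ring.
rewrite exprMn (Psi_form z) (Psi_form p).
have H (c e e' y y' k' k'' : R[i]) : e * k' = e' * k'' -> c * e * (y * y' * k') = c * e' * y * (y' * k'').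
  by move=> h; transitivity (c * (e * k') * y * y'); [ring|rewrite h; ring].
apply: H; rewrite -!cexpD; congr cexp.
have -> : cj d = (1 - cj a) * cj p by rewrite {1}dE conjC_M conjC_B conjC_R.
rewrite {1}dE.
have -> : - (al%:C * (a * ((1 - cj a) * cj p)) * z) + al%:C * cj p * (a * z + (1 - a) * p) =
  al%:C * cj p * ((a * cj a) * z + (1 - a) * p) by ring.
have -> : - (al%:C * (a * ((1 - cj a) * cj p)) * p) + al%:C * cj p * z =
  al%:C * cj p * (z + (a * cj a) * p - a * p) by ring.
by rewrite aJ; ring.
Qed.

Lemma hn_eb_gt0 k : 0 < hn (eb al0 p k).
Proof. by rewrite hnE nn_eb sqrtr_gt0 Nk_gt0. Qed.

Lemma nrm_x k : nrm (x k) = rho.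
Proof.
have e0 : hn (eb al0 p k) != 0 by rewrite gt_eqF// hn_eb_gt0.
by have := hn_W (eb al0 p k); rewrite W_eb hnZ// => /(mulIf e0).
Qed.

Lemma uk_W f k : uk al0 p (W f) k = x k * uk al0 p f k.
Proof.
have x0 : x k != 0 by rewrite -nrm_gt0 nrm_x rho_gt0.
have Se : S (eb al0 p k) = cj (x k) *: eb al0 p k.
  apply: (scalerI x0); rewrite -(linZ _ _ (bop_lin bS)) -W_eb SW scalerA mulcJ nrm_x.
  by [].
by rewrite /uk adj Se dotZr// conjC_K mulrA.
Qed.

(** Away from the closure of the orbit the factors [(x k - l)^-1] are bounded and [multiplier] turns
    them into the resolvent; on the closure the basis vectors are approximate eigenvectors. *)
Lemma spec_rotation l : spec W l <-> forall e : R, 0 < e -> exists k, nrm (x k - l) < e.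
Proof.
split=> [|H]; last first.
  apply: spec_approx => M M0.
  have M1 : 0 < M + 1 by rewrite ltr_wpDl.
  have [k Hk] := H (M + 1)^-1 (ltac:(by rewrite invr_gt0)).
  exists (eb al0 p k); rewrite W_eb -scalerBl hnZ// mulrA gtr_pMl ?hn_eb_gt0//.
  apply: le_lt_trans (_ : (M + 1) * nrm (x k - l) < 1).
    by rewrite ler_wpM2r ?nrm_ge0// lerDl.
  by rewrite mulrC -ltr_pdivlMr// mul1r.
apply: contraPP => /existsNP[e /not_implyP[e0 /forallNP He]]; case.
have xl k : e <= nrm (x k - l) by rewrite leNgt; apply/negP; exact: He.
have xl0 k : x k - l != 0 by rewrite -nrm_gt0; exact: lt_le_trans (xl k).
pose b k := (x k - l)^-1.
have bB k : nrm (b k) <= e^-1.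
  by rewrite nrmV lef_pV2 ?posrE// (lt_le_trans e0 (xl k)).
pose Q f := sval (cid2 (multiplier al0 p f bB)).
have [QB QE] : (forall f, hn (Q f) <= e^-1 * hn f) /\ (forall f w,
    ccvg (fun n => \sum_(k < n) b k * (uk al0 p f k * fv (eb al0 p k) w)) (fv (Q f) w)).
  by split=> f; rewrite /Q; case: cid2.
exists Q; split=> [|f|f].
- apply: bopP; last by exists e^-1.
  move=> c f g; apply: fv_inj => w; rewrite fvD fvZ; apply: ccvg_uniq (QE _ w) _.
  apply: ccvg_eq (ccvgD (ccvgZ c (QE f w)) (QE g w)) => n.
  by rewrite mulr_sumr -big_split; apply: eq_bigr => k _; rewrite uk_lin /=; ring.
- apply: fv_inj => w; apply: ccvg_uniq (QE _ w) _.
  apply: ccvg_eq (fock_taylor al0 p f w) => n; apply: eq_bigr => k _.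
  rewrite addrC -scaleNr uk_lin uk_W /b.
  have -> : - l * uk al0 p f k + x k * uk al0 p f k = (x k - l) * uk al0 p f k by ring.
  by rewrite -mulrA mulKf.
- apply: fv_inj => w; rewrite fvB fvZ WE; apply: ccvg_uniq _ (fock_taylor al0 p f w).
  apply: ccvg_eq (ccvgB (ccvgZ (Psi w) (QE f (Phi w))) (ccvgZ l (QE f w))) => n.
  rewrite !mulr_sumr -sumrB; apply: eq_bigr => k _.
  have -> : Psi w * (b k * (uk al0 p f k * fv (eb al0 p k) (Phi w))) = b k * (uk al0 p f k * (Psi w * fv (eb al0 p k) (Phi w))) by ring.
  rewrite -WE W_eb fvZ.
  have H (y u v : R[i]) : b k * (u * (y * v)) - l * (b k * (u * v)) = b k * (y - l) * (u * v) by ring.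
  by rewrite H /b mulVf// mul1r.
Qed.

End Rotation.

End Unimodular.

Lemma spec_constant : a = 0 -> spec W = [set 0; Psi d].
Proof.
move=> a0.
have WdE f z : fv (W f) z = Psi z * fv f d by rewrite WE PhiE a0 mul0r add0r.
pose P := W (ker al0 0).
have PE z : fv P z = Psi z by rewrite WdE fv_ker /kf conjc0 mulr0 mul0r cexp0 mulr1.
have WP f : W f = fv f d *: P by apply: fv_inj => z; rewrite WdE fvZ PE mulrC.
have P0 : hn P != 0.
  case: Psi_neq0 => z; apply: contra => /eqP h; rewrite -PE.
  by rewrite (_ : P = 0) ?fv0//; apply: (hn_eq0 al0); rewrite h.
apply/seteqP; split=> [l|l].
  apply: contraPP => /not_orP[/eqP l0 /eqP lp]; case.
  have pl : Psi d - l != 0 by rewrite subr_eq0 eq_sym.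
  have bid := @bop_id R al.
  (* Since [W^2 = Psi d * W], the inverse of [W - l] is a combination of the identity and [W]. *)
  pose Q f := (- l^-1) *: f + (l^-1 / (Psi d - l)) *: W f.
  have bQ : bop Q.
    exact: (@bop_comb R al al0 (- l^-1) id (fun f => (l^-1 / (Psi d - l)) *: W f) bid (bop_scale _ bW)).
  exists Q; split=> [//|f|f]; apply: fv_inj => z.
    rewrite /Q !(fvD, fvZ) !WdE !(fvD, fvN, fvZ) !WdE.
    by field; rewrite pl l0.
  rewrite fvD fvN fvZ /Q WdE !(fvD, fvZ) !WdE.
  by field; rewrite pl l0.
case=> ->; last first.
  by apply: (spec_eigen P0); rewrite WP PE.
(* The kernel of [W] consists of the functions vanishing at [d]; [(z - d) K_d] is a nonzero one. *)
have [f [fd fn]] : exists f, fv f d = 0 /\ hn f != 0.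
  exists (eb al0 d 1); rewrite fv_eb subrr expr1 mul0r; split => //.
  by rewrite hnE nn_eb gt_eqF// sqrtr_gt0 Nk_gt0.
by apply: (spec_eigen fn); rewrite WP fd !scale0r.
Qed.

End Weighted.

(** * Quasi-inverses and auxiliary facts for contractive symbols *)

Section Resolvent.
Context {R : realType}.
Implicit Types (al : R) (z l : R[i]).

(* [l^-1 (Q - T^n)] turns a quasi-inverse of order [n + 1] into one of order [n]. *)
Lemma quasi_resolvent al (al0 : 0 < al) (T Q : fock al -> fock al) l n : l != 0 ->
  bounded_op (@fock_dot R al) T -> bounded_op (@fock_dot R al) Q ->
  (forall f, Q (T f - l *: f) = iter n T f) -> (forall f, T (Q f) - l *: Q f = iter n T f) ->
  ~ spectrum (@fock_dot R al) T l.
Proof.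
move=> l0 bT; elim: n Q => [|n IH] Q bQ Q1 Q2; first by apply; exists Q.
have lT := bop_lin bT; have lTn := bop_lin (bop_iter n bT).
apply: (IH (fun f => l^-1 *: Q f + (- l^-1) *: iter n T f)) => [|f|f].
- exact: (bop_comb al0 _ bQ (bop_scale _ (bop_iter n bT))).
- rewrite Q1 (linB _ _ lTn) (linZ _ _ lTn) scalerBr -iterSr scalerA addrA scaleNr subrr add0r.
  by rewrite mulNr mulVf// scaleN1r opprK.
- rewrite (linD _ _ lT) !(linZ _ _ lT) scalerDr !scalerA mulrN mulfV// scale1r -iterS scaleN1r.
  have -> : T (Q f) = iter n.+1 T f + l *: Q f by rewrite -Q2 subrK.
  rewrite scalerDr scalerA mulVf// scale1r scaleNr [iter n.+1 T f]lock -!addrA.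
  by rewrite opprB [Q f + _]addrCA addNKr addrC subrK.
Qed.

Lemma min_pos (r : nat -> R) (m : R) K : 0 < m -> (forall k, 0 < r k) ->
  (forall k, (K <= k)%N -> m <= r k) -> exists2 e, 0 < e & forall k, e <= r k.
Proof.
move=> m0 r0; elim: K m m0 => [|K IH] m m0 H; first by exists m => // k; exact: H.
apply: (IH (Num.min m (r K))); first by rewrite lt_min m0 r0.
move=> k; rewrite leq_eqVlt => /orP[/eqP <-|Kk]; rewrite ge_min ?lexx ?orbT//.
by rewrite H.
Qed.

Lemma nonzero_ball (f : R[i] -> R[i]) z : holo f -> f z != 0 ->
  exists2 e : R, 0 < e & forall w, nrm (w - z) < e -> f w != 0.
Proof.
move=> hf; rewrite -nrm_gt0 => fz; have [e e0 He] := holo_ccont z hf fz.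
exists e => // w /He; apply: contraTneq => ->; by rewrite sub0r nrmN ltxx.
Qed.

(** At the centre 0 the coefficients are derivatives up to a constant, and each differentiation of
    [F1 (a * z)] brings out one factor [a]. *)
Lemma uk_dilate al (al0 : 0 < al) (F1 F2 : fock al) (P a : R[i]) k :
  (forall z, fv F2 z = P * fv F1 (a * z)) -> uk al0 0 F2 k = P * a ^+ k * uk al0 0 F1 k.
Proof.
move=> H.
have trE (F : fock al) z : fv F z = (al / pi)%:C * tr al 0 (fv F) 0 z.
  by rewrite (fv_tr al0 F 0) /kf conjc0 mulr0 mul0r cexp0 mul1r.
have T : forall z, tr al 0 (fv F2) k z = P * a ^+ k * tr al 0 (fv F1) k (a * z).
  elim: k => [|k IH] z.
    have c0 : (al / pi)%:C != 0 :> R[i].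
      by rewrite -nrm_eq0 nrmR normr_eq0 mulf_neq0 ?invr_eq0 ?pi_neq0 ?al_neq0.
    by apply: (mulfI c0); rewrite -trE H trE expr0 mulr1; ring.
  apply: cderiv_uniq (cderiv_tr_fv al0 0 F2 k z) _.
  rewrite (_ : tr al 0 (fv F2) k = fun z => P * a ^+ k * tr al 0 (fv F1) k (a * z)); last exact/funext.
  have d1 : cderiv (fun x => a * x) z a.
    by apply: cderiv_eq (cderivZ a (cderiv_id z)); rewrite mulr1.
  by apply: cderiv_eq (cderivZ (P * a ^+ k) (cderiv_comp d1 (cderiv_tr_fv al0 0 F1 k (a * z)))); rewrite exprSr; ring.
by rewrite /uk !dot_eb T mulr0; ring.
Qed.

Lemma sq_shift (z p : R[i]) : nrm (z + p) ^+ 2 <= 2 * nrm z ^+ 2 + 2 * nrm p ^+ 2.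
Proof. exact: normcD_sqr. Qed.

End Resolvent.

(** * Spectrum of a contraction with a zero-free eigenfunction *)

Section Contraction.
Context {R : realType}.
Variable al : R.
Hypothesis al0 : 0 < al.
Variables (Psi Phi : R[i] -> R[i]) (a p P : R[i]) (W : fock al -> fock al) (g : R[i] -> R[i]).
Hypothesis PhiE : forall z, Phi z = p + a * (z - p).
Hypothesis WE : forall f z, fv (W f) z = Psi z * fv f (Phi z).
Hypothesis bW : bounded_op (@fock_dot R al) W.
Hypothesis a0 : a != 0.
Hypothesis a1 : nrm a < 1.
Hypothesis P0 : P != 0.
Hypothesis hg : holo g.
Hypothesis g_neq0 : forall z, g z != 0.
Hypothesis gW : forall z, Psi z * g (Phi z) = P * g z.
Variables (c C : R).
Hypothesis C0 : 0 <= C.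
Hypothesis cal : 2 * c < al.
Hypothesis g_le : forall z, nrm (g z) <= C * expR (c * nrm z ^+ 2).
Hypothesis gV_le : forall z, nrm (g z)^-1 <= C * expR (al * nrm z ^+ 2).
Implicit Types (f : fock al) (z l : R[i]).
Notation spec := (spectrum (@fock_dot R al)).

Let x k := P * a ^+ k.

Lemma PhiB z : Phi z - p = a * (z - p).
Proof. by rewrite PhiE addrAC subrr add0r. Qed.

(** The vector is [(z - p)^k g]. The polynomial costs a quarter of the margin [al - 2 * c], which is
    counted twice in the membership condition and still leaves half of it. *)
Lemma contraction_eigen k : exists2 v : fock al, 0 < hn v & W v = x k *: v.
Proof.
have e0 : 0 < (al - 2 * c) / 4 by rewrite divr_gt0// subr_gt0.
have [K K0 HK] := gr_pow p k e0.
have hv : holo (fun z => g z * (z - p) ^+ k).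
  by apply: holo_M => //; apply: holo_X; exact: holo_sub.
have [||z|v vE _] := @growth_fock R al al0 _ (C * K) (c + (al - 2 * c) / 4) hv.
- lra.
- exact: mulr_ge0.
- by rewrite nrmM mulrDl expRD mulrACA; apply: ler_pM; rewrite ?nrm_ge0.
exists v.
  rewrite lt_def hn_ge0 andbT; apply/negP => /eqP h.
  have := vE (p + 1); rewrite (_ : v = 0) ?fv0; last by apply: (hn_eq0 al0); rewrite h.
  by rewrite addrAC subrr add0r expr1n mulr1 => /esym/eqP; rewrite (negbTE (g_neq0 _)).
apply: fv_inj => z; rewrite WE fvZ !vE mulrA gW PhiB exprMn /x; ring.
Qed.

Lemma contraction_zero : spec W 0.
Proof.
apply: spec_approx => M M0.
have M1 : 0 < M + 1 by rewrite ltr_wpDl.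
have P1 : 0 < nrm P by rewrite nrm_gt0.
have [||k Hk] := @expr_lt R (nrm a) ((M + 1)^-1 / nrm P).
- by rewrite nrm_ge0 a1.
- by rewrite divr_gt0// invr_gt0.
have [v v0 Wv] := contraction_eigen k.
exists v; rewrite scale0r subr0 Wv hnZ// mulrA gtr_pMl// /x nrmM nrmX.
rewrite ltr_pdivlMr// -[ltRHS]mul1r ltr_pdivlMr// in Hk.
apply: le_lt_trans Hk; rewrite -subr_ge0.
have -> : nrm a ^+ k * nrm P * (M + 1) - M * (nrm P * nrm a ^+ k) = nrm a ^+ k * nrm P by ring.
by rewrite mulr_ge0 ?exprn_ge0 ?nrm_ge0.
Qed.

(** For [f / g] the two growth bounds add up to [3 al / 2] in [|z + p|^2], hence at most [3 al] in
    [|z|^2] up to a constant. The weight must exceed twice that; [12 * al] is a convenient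
    choice. *)
Let be := 12 * al.
Lemma be0 : 0 < be. Proof. by rewrite mulr_gt0. Qed.
Let C1 := C * expR (3 * al * nrm p ^+ 2) * Num.sqrt (be / (be - 2 * (3 * al))).

Lemma quotient_fock f : exists2 F : fock be, fv F =1 (fun z => fv f (z + p) / g (z + p)) &
  hn F <= C1 * hn f.
Proof.
have hq : holo (fun z => fv f (z + p) / g (z + p)).
  have sh (h : R[i] -> R[i]) : holo h -> holo (fun z => h (z + p)).
    by move=> hh z; have [l hl] := hh (z + p); exists l; exact: cderiv_shift.
  by apply: holo_M; [apply: sh; exact: holo_fv|apply: (sh (fun z => (g z)^-1)); exact: holo_V].
have [||z|F FE FC] := @growth_fock R be be0 _ (hn f * (C * expR (3 * al * nrm p ^+ 2))) (3 * al) hq.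
- by rewrite /be mulrA ltr_pM2r//; lra.
- by rewrite mulr_ge0 ?hn_ge0// mulr_ge0 ?expR_ge0.
- have h1 := ler_pM (nrm_ge0 _) (nrm_ge0 _) (fv_le al0 f (z + p)) (gV_le (z + p)).
  rewrite nrmM; apply: le_trans h1 _.
  rewrite [leLHS](_ : _ = hn f * (C * expR (3 * al / 2 * nrm (z + p) ^+ 2))).
    rewrite -!mulrA ler_wpM2l ?hn_ge0// ler_wpM2l// -expRD ler_expR.
    have h3 : 0 <= 3 * al / 2 by rewrite divr_ge0 ?mulr_ge0 ?(ltW al0).
    have := ler_wpM2l h3 (sq_shift z p); lra.
  rewrite (_ : 3 * al / 2 * nrm (z + p) ^+ 2 = al / 2 * nrm (z + p) ^+ 2 + al * nrm (z + p) ^+ 2); last by field.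
  by rewrite expRD; ring.
by exists F => //; apply: le_trans FC _; rewrite le_eqVlt; apply/orP; left; apply/eqP; rewrite /C1; ring.
Qed.

Let Y f := sval (cid2 (quotient_fock f)).
Lemma YE f z : fv (Y f) z = fv f (z + p) / g (z + p). Proof. by rewrite /Y; case: cid2. Qed.
Lemma hn_Y f : hn (Y f) <= C1 * hn f. Proof. by rewrite /Y; case: cid2. Qed.

(** The Taylor coefficients of [f / g] at [p], recentred to 0. [W] acts on them diagonally by [u_W],
    although the functions [(z - p)^k g] need not be orthogonal. *)
Let u f k := uk be0 0 (Y f) k.

Lemma u_lin b f h k : u (b *: f + h) k = b * u f k + u h k.
Proof.
rewrite /u (_ : Y (b *: f + h) = b *: Y f + Y h); first exact: uk_lin.
by apply: fv_inj => z; rewrite fvD fvZ !YE fvD fvZ; ring.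
Qed.

Lemma u_W f k : u (W f) k = x k * u f k.
Proof.
apply: uk_dilate => z; rewrite !YE WE PhiE addrK.
have h := gW (z + p); rewrite PhiE addrK in h.
rewrite [p + _]addrC in h *.
have -> : Psi (z + p) = P * g (z + p) / g (a * z + p) by rewrite -h mulfK.
by field; rewrite !g_neq0.
Qed.

Lemma u_le f k : nrm (u f k) <= C1 * hn f * (Num.sqrt be ^+ k / Num.sqrt k`!%:R).
Proof.
apply: le_trans (uk_le be0 0 (Y f) k) _; apply: ler_pM.
- exact: hn_ge0.
- by rewrite invr_ge0 sqrtr_ge0.
- exact: hn_Y.
- exact: sqrt_Nk be0 _ _.
Qed.

Lemma u_series f z : ccvg (fun n => \sum_(k < n) u f k * z ^+ k) (fv f (z + p) / g (z + p)).
Proof.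
rewrite -YE; apply: ccvg_eq (fock_taylor be0 0 (Y f) z) => n; apply: eq_bigr => k _.
by rewrite fv_eb subr0 /kf conjc0 mulr0 mul0r cexp0 mulr1.
Qed.

Lemma W_iter n f z : fv (iter n W f) z = P ^+ n * g z * (fv f (p + a ^+ n * (z - p)) / g (p + a ^+ n * (z - p))).
Proof.
elim: n z => [|n IH] z; first by rewrite !expr0 !mul1r addrC subrK mulrC divfK.
rewrite iterS WE IH PhiB [a ^+ n * (a * _)]mulrA -exprSr; have h := gW z.
have -> (X Z : R[i]) : Psi z * (P ^+ n * g (Phi z) * (X / Z)) = P ^+ n * (Psi z * g (Phi z)) * (X / Z) by ring.
by rewrite h [P ^+ n.+1]exprSr; ring.
Qed.

(** On coefficients [W - l] multiplies by [x k - l], bounded away from 0. The series with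
    coefficients [u f k / (x k - l)] may however grow too fast to be multiplied by [g] inside the
    space; the extra factor [x k ^+ N] coming from [W^N] slows it down. *)
Lemma contraction_resolvent l : l != 0 -> (forall k, l != x k) -> ~ spec W l.
Proof.
move=> l0 lx.
have an0 : 0 < nrm a by rewrite nrm_gt0.
have xl0 k : x k - l != 0 by rewrite subr_eq0 eq_sym.
(* The orbit tends to 0, so from some [K] on it stays at distance [|l| / 2] from [l]; [min_pos]
   takes care of the finitely many earlier terms. *)
have [dl dl0 Hdl] : exists2 e : R, 0 < e & forall k, e <= nrm (x k - l).
  have [||K HK] := @expr_lt R (nrm a) (nrm l / 2 / nrm P).
  - by rewrite nrm_ge0 a1.
  - by rewrite divr_gt0 ?divr_gt0 ?nrm_gt0.
  apply: (@min_pos R _ (nrm l / 2) K); first by rewrite divr_gt0// nrm_gt0.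
    by move=> k; rewrite nrm_gt0.
  move=> k Kk; have h1 : nrm (x k) <= nrm l / 2.
    rewrite /x nrmM nrmX -ler_pdivlMl ?nrm_gt0// mulrC; apply: ltW; apply: le_lt_trans HK.
    by apply: ler_wiXn2l => //; rewrite ?nrm_ge0 ?ltW.
  have := nrmBD (x k) l 0; rewrite !subr0 nrm_distC; lra.
(* [N] is chosen to give [t^2 < ga]: the series has exponent [2 t^2], recentring at [p] doubles it,
   and [2 (c + 4 t^2) < al] is what membership of its product with [g] requires. *)
pose ga := (al - 2 * c) / 8; have ga0 : 0 < ga by rewrite divr_gt0// subr_gt0.
have [||N HN] := @expr_lt R (nrm a ^+ 2) (ga / be).
- by rewrite sqr_ge0 expr_lt1 ?nrm_ge0.
- by rewrite divr_gt0 ?be0.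
pose t := nrm a ^+ N * Num.sqrt be.
have t0 : 0 < t by rewrite mulr_gt0 ?exprn_gt0 ?sqrtr_gt0 ?be0.
have t2 : t ^+ 2 < ga.
  rewrite /t exprMn sqr_sqrtr ?(ltW be0)// -exprM mulnC exprM.
  by rewrite -ltr_pdivlMr ?be0.
pose b f k := x k ^+ N / (x k - l) * u f k.
pose C2 := nrm P ^+ N / dl * C1.
have C10 : 0 <= C1 by rewrite !mulr_ge0 ?expR_ge0 ?sqrtr_ge0.
have C20 : 0 <= C2 by rewrite mulr_ge0// divr_ge0 ?exprn_ge0 ?nrm_ge0 ?ltW.
have b_le f k : nrm (b f k) <= C2 * hn f * (t ^+ k / Num.sqrt k`!%:R).
  have h1 : nrm (x k ^+ N / (x k - l)) <= nrm P ^+ N * (nrm a ^+ N) ^+ k / dl.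
    rewrite nrmM nrmV nrmX /x nrmM nrmX exprMn -!exprM [(k * N)%N]mulnC ler_wpM2l//.
      by rewrite mulr_ge0 ?exprn_ge0 ?nrm_ge0.
    by rewrite lef_pV2 ?posrE ?(lt_le_trans dl0 (Hdl k))//; exact: Hdl.
  rewrite /b nrmM; apply: le_trans (ler_pM (nrm_ge0 _) (nrm_ge0 _) h1 (u_le f k)) _.
  by rewrite /t exprMn /C2 le_eqVlt; apply/orP; left; apply/eqP; ring.
have [C3 exQ] : exists C3 : R, forall f, exists F : fock al, hn F <= C3 * hn f /\
    forall z, ccvg (fun n => g z * \sum_(k < n) b f k * (z - p) ^+ k) (fv F z).
  exists (C * (2 * C2) * expR (4 * t ^+ 2 * nrm p ^+ 2) * Num.sqrt (al / (al - 2 * (c + 4 * t ^+ 2)))) => f.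
  have [S [hS S1 S2]] := power_series (mulr_ge0 C20 (hn_ge0 f)) t0 (b_le f).
  have hv : holo (fun z => g z * S (z - p)).
    by apply: holo_M => //; apply: (holo_comp (holo_sub p) hS).
  have [||z|F FE FC] := @growth_fock R al al0 _ (C * (2 * (C2 * hn f)) * expR (4 * t ^+ 2 * nrm p ^+ 2)) (c + 4 * t ^+ 2) hv.
  - by rewrite /ga in t2; lra.
  - by rewrite mulr_ge0 ?expR_ge0// mulr_ge0// mulr_ge0// mulr_ge0// hn_ge0.
  - rewrite nrmM; apply: le_trans (ler_pM (nrm_ge0 _) (nrm_ge0 _) (g_le z) (S2 _)) _.
    rewrite [(c + _) * _]mulrDl expRD.
    have h : expR (2 * t ^+ 2 * nrm (z - p) ^+ 2) <= expR (4 * t ^+ 2 * nrm p ^+ 2) * expR (4 * t ^+ 2 * nrm z ^+ 2).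
      rewrite -expRD ler_expR.
      have t20 : 0 <= 2 * t ^+ 2 by rewrite mulr_ge0 ?sqr_ge0.
      have := ler_wpM2l t20 (sq_shift z (- p)); rewrite nrmN; lra.
    have K0 : 0 <= C * expR (c * nrm z ^+ 2) * (2 * (C2 * hn f)).
      exact: mulr_ge0 (mulr_ge0 C0 (expR_ge0 _)) (mulr_ge0 (ler0n _ 2) (mulr_ge0 C20 (hn_ge0 f))).
    set E1 := expR (2 * _ * _) in h *; set E2 := expR (4 * _ * nrm p ^+ 2) in h *.
    set E3 := expR (4 * _ * nrm z ^+ 2) in h *; set E4 := expR (c * _) in K0 *.
    have := ler_wpM2l K0 h; congr (_ <= _); ring.
  exists F; split.
    by apply: le_trans FC _; rewrite le_eqVlt; apply/orP; left; apply/eqP; ring.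
  by move=> z; rewrite FE; apply: ccvgZ; exact: S1.
have [Q QB QP] : exists2 Q : fock al -> fock al, (forall f, hn (Q f) <= C3 * hn f) &
    forall f z, ccvg (fun n => g z * \sum_(k < n) b f k * (z - p) ^+ k) (fv (Q f) z).
  by exists (fun f => sval (cid (exQ f))) => f; case: cid => F [].
have b_lin e f h k : b (e *: f + h) k = e * b f k + b h k by rewrite /b u_lin mulrDr mulrCA.
have iterP f z : ccvg (fun n => g z * \sum_(k < n) x k ^+ N * u f k * (z - p) ^+ k) (fv (iter N W f) z).
  rewrite W_iter mulrAC [P ^+ N * _ * g z]mulrC.
  apply: ccvgZ; have := ccvgZ (P ^+ N) (u_series f (a ^+ N * (z - p))).
  rewrite [a ^+ N * _ + p]addrC; apply: ccvg_eq => n; rewrite mulr_sumr; apply: eq_bigr => k _.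
  by move: (u f k) => v; rewrite /x !exprMn -!exprM [(k * N)%N]mulnC; ring.
have bQ : bounded_op (@fock_dot R al) Q.
  apply: bopP; last by exists C3.
  move=> e f h; apply: fv_inj => z; rewrite fvD fvZ; apply: ccvg_uniq (QP _ z) _.
  apply: ccvg_eq (ccvgD (ccvgZ e (QP f z)) (QP h z)) => n.
  rewrite mulrCA -mulrDr; congr (_ * _); rewrite mulr_sumr -big_split; apply: eq_bigr => k _.
  by rewrite b_lin; move: (b f k) (b h k) => v v'; rewrite /=; ring.
have b_x f k : (x k - l) * b f k = x k ^+ N * u f k.
  by rewrite /b; move: (u f k) (xl0 k) => v h; field.
have b_W f k : b (W f - l *: f) k = x k ^+ N * u f k.
  rewrite addrC -scaleNr b_lin /b u_W.
  by move: (u f k) (xl0 k) => v h; field.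
apply: (quasi_resolvent al0 l0 bW bQ) => f; apply: fv_inj => z.
- apply: ccvg_uniq (QP _ z) _; apply: ccvg_eq (iterP f z) => n; apply: congr1.
  by apply: eq_bigr => k _; rewrite b_W.
- rewrite fvB fvZ WE; apply: ccvg_uniq _ (iterP f z).
  apply: ccvg_eq (ccvgB (ccvgZ (Psi z) (QP f (Phi z))) (ccvgZ l (QP f z))) => n.
  rewrite mulrA gW PhiB.
  rewrite [P * g z]mulrC -mulrA [l * _]mulrCA -mulrBr; apply: congr1.
  rewrite !mulr_sumr -sumrB; apply: eq_bigr => k _.
  by rewrite -b_x; move: (b f k) => v; rewrite [(a * _) ^+ k]exprMn /x; ring.
Qed.

Lemma spec_contraction : spec W = [set 0] `|` [set x n | n in [set: nat]].
Proof.
apply/seteqP; split=> [l|l [->|[k _ <-]]]; last 2 first.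
- exact: contraction_zero.
- by have [v v0 Wv] := contraction_eigen k; apply: spec_eigen Wv; rewrite gt_eqF.
move=> sl; have [->|l0] := eqVneq l 0; first by left.
right; apply: contrapT => H; apply: (contraction_resolvent l0 _ sl) => k.
by apply/eqP => lk; apply: H; exists k.
Qed.

End Contraction.

(** * The eigenfunction [J K_p] has no zeros *)

Section SymmetricContraction.
Context {R : realType}.
Variable al : R.
Hypothesis al0 : 0 < al.
Variables (Psi Phi : R[i] -> R[i]) (a d : R[i]) (W S J : fock al -> fock al).
Hypothesis hPsi : holo Psi.
Hypothesis Psi_neq0 : exists z, Psi z != 0.
Hypothesis PhiE : forall z, Phi z = a * z + d.
Hypothesis WE : forall f z, fv (W f) z = Psi z * fv f (Phi z).
Hypothesis bW : bounded_op (@fock_dot R al) W.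
Hypothesis adj : forall f g, dot (W f) g = dot f (S g).
Hypothesis J_lin : forall c f g, J (c *: f + g) = cj c *: J f + J g.
Hypothesis JK : forall f, J (J f) = f.
Hypothesis W_sym : forall f, W f = J (S (J f)).
Hypothesis a0 : a != 0.
Hypothesis a1 : nrm a < 1.
Implicit Types (f g : fock al) (z w l c : R[i]).

Let p := d / (1 - a).

Lemma Phi_p z : Phi z = p + a * (z - p).
Proof.
have a_1 : 1 - a != 0.
  by rewrite subr_eq0; apply: contraTneq a1 => <-; rewrite nrm1 ltxx.
by rewrite PhiE /p; field.
Qed.

Let jk z w := fv (J (ker al0 w)) z.

(** [W J = J S] on [K_w]: the adjoint yields [cj (Psi w)] times [K_(Phi w)], and antilinearity of
    [J] removes the conjugate. The relation shifts [Phi] from one argument of [jk] to the other. *)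
Lemma jk_W z w : Psi z * jk (Phi z) w = Psi w * jk z (Phi w).
Proof.
rewrite /jk -WE W_sym JK (S_ker al0 WE adj) (J_scale J_lin) conjC_K fvZ.
by [].
Qed.

Lemma J_ker_neq0 w : J (ker al0 w) <> 0.
Proof.
move=> h; have := JK (ker al0 w); rewrite h -[0 : fock al](scale0r 0) (J_scale J_lin) conjc0 scale0r => e.
by have := ker_neq0 al0 w; rewrite -e -[0 : fock al](scale0r 0) hnZ// nrm0 mul0r eqxx.
Qed.

Let g z := jk z p.

Lemma Phi_fix : Phi p = p. Proof. by rewrite Phi_p subrr mulr0 addr0. Qed.

Lemma jk_p z : Psi z * g (Phi z) = Psi p * g z.
Proof. by rewrite /g jk_W Phi_fix. Qed.

Lemma g_not_locally0 q (e : R) : 0 < e -> ~ (forall z, nrm (z - q) < e -> g z = 0).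
Proof. by move=> e0 H; apply: (J_ker_neq0 (w := p)); apply: (fock_ident al0 (p := q) e0) => z; exact: H. Qed.

Lemma holo_g : holo g. Proof. exact: holo_fv. Qed.

(** Otherwise [Psi * (g o Phi)] vanishes identically by [jk_p]; around a point where [Psi] is
    nonzero, [g] then vanishes on the image of a disc under [Phi], again a disc because [a != 0]. *)
Lemma Psi_p_neq0 : Psi p != 0.
Proof.
apply/negP => /eqP P0; have [z0 z0P] := Psi_neq0.
have [e e0 He] := nonzero_ball hPsi z0P.
have ae : 0 < nrm a * e by rewrite mulr_gt0// nrm_gt0.
apply: (g_not_locally0 (q := Phi z0) ae) => y yz.
pose z := z0 + (y - Phi z0) / a.
have zy : Phi z = y by rewrite /z !PhiE; field.
have : Psi z * g (Phi z) = 0 by rewrite jk_p P0 mul0r.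
rewrite zy => /eqP; rewrite mulf_eq0 => /orP[|/eqP//].
rewrite (negbTE (He z _))// /z addrAC subrr add0r nrmM nrmV.
by rewrite ltr_pdivrMr ?nrm_gt0// mulrC.
Qed.

(** If [g p = 0], then [|g z| <= L |z - p|] near [p], while the eigenfunction equation and
    continuity of [Psi] give [|g z| <= r |g (Phi z)|] with a fixed [r > 1]. The choice
    [r |a| = t < 1] makes iteration towards [p] force [g = 0] near [p]. *)
Lemma g_p_neq0 : g p != 0.
Proof.
apply/negP => /eqP gp0.
have an0 : 0 < nrm a by rewrite nrm_gt0.
have a_lt1 := a1.
pose t := (1 + nrm a) / 2; pose r := t / nrm a.
have t01 : 0 <= t < 1 by rewrite /t; apply/andP; split; lra.
have r1 : 1 < r by rewrite /r ltr_pdivlMr// mul1r /t; lra.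
have P0 : 0 < nrm (Psi p) by rewrite nrm_gt0 Psi_p_neq0.
have e0 : 0 < nrm (Psi p) * (r - 1) by rewrite mulr_gt0// subr_gt0.
have [d1 d10 H1] := holo_ccont p hPsi e0.
have [l gl] := holo_g p.
have [d2 d20 H2] := (cderivP _ _ _).1 gl 1 ltr01.
pose e := Num.min d1 d2; have e_0 : 0 < e by rewrite lt_min d10.
pose L := 1 + nrm l; have L0 : 0 <= L by rewrite addr_ge0 ?nrm_ge0.
have gL z : nrm (z - p) < e -> nrm (g z) <= L * nrm (z - p).
  rewrite lt_min => /andP[_ /H2]; rewrite [p + _]addrC subrK gp0 subr0 mul1r => h.
  have := nrmD (g z - l * (z - p)) (l * (z - p)); rewrite subrK nrmM /L mulrDl mul1r => h'.
  by apply: le_trans h' _; rewrite lerD2r.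
have step z : nrm (z - p) < e -> nrm (g z) <= r * nrm (g (Phi z)).
  rewrite lt_min => /andP[/H1 h _].
  have Pz : nrm (Psi z) <= nrm (Psi p) * r.
    have := nrmBD (Psi p) (Psi z) 0; rewrite !subr0; move: h; rewrite mulrBr mulr1; lra.
  rewrite -(@ler_pM2l _ (nrm (Psi p)))// -nrmM -jk_p nrmM mulrA.
  by rewrite ler_wpM2r ?nrm_ge0.
have it n : forall z, nrm (z - p) < e -> nrm (g z) <= L * nrm (z - p) * t ^+ n.
  elim: n => [|n IH] z ze; first by rewrite expr0 mulr1 gL.
  have Pz : nrm (Phi z - p) = nrm a * nrm (z - p) by rewrite Phi_p addrAC subrr add0r nrmM.
  have ze' : nrm (Phi z - p) < e by rewrite Pz; apply: le_lt_trans ze; rewrite ler_piMl ?nrm_ge0// ltW.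
  apply: le_trans (step z ze) _; apply: le_trans (ler_wpM2l (ltW (lt_trans ltr01 r1)) (IH _ ze')) _.
  rewrite Pz le_eqVlt; apply/orP; left; apply/eqP; rewrite /r exprS; field.
  by rewrite gt_eqF.
apply: (g_not_locally0 e_0 (q := p)) => z ze; apply/eqP.
rewrite -nrm_eq0 eq_le nrm_ge0 andbT; apply: (geo_le0 t01) => n; exact: it.
Qed.

(** Zeros cannot persist along the orbit, which tends to [p] where [g] is nonzero; so some zero [w0]
    has [g (Phi w0) != 0], and [jk_p] forces [Psi w0 = 0]. Then [jk_W] makes [Psi z * jk (Phi z) w0]
    vanish, and [Psi z] is nonzero wherever [g z] is, in particular near [p]: [J K_(w0)] would
    vanish on a disc. *)
Lemma g_neq0 w : g w != 0.
Proof.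
apply/negP => /eqP gw.
have [e e0 He] := nonzero_ball holo_g g_p_neq0.
have PhB z : Phi z - p = a * (z - p) by rewrite Phi_p addrAC subrr add0r.
have [w0 [w00 w01]] : exists w0, g w0 = 0 /\ g (Phi w0) != 0.
  apply: contrapT => H.
  have st n : exists z, g z = 0 /\ z - p = a ^+ n * (w - p).
    elim: n => [|n [z [gz zE]]]; first by exists w; rewrite expr0 mul1r.
    exists (Phi z); split; last by rewrite PhB zE exprS mulrA.
    by apply/eqP; apply: contrapT => h; apply: H; exists z; split => //; apply/negP.
  have wp : 0 < nrm (w - p) + 1 by rewrite ltr_wpDl ?nrm_ge0.
  have [||n Hn] := @expr_lt R (nrm a) (e / (nrm (w - p) + 1)).
  - by rewrite nrm_ge0 a1.
  - by rewrite divr_gt0.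
  have [z [gz zE]] := st n.
  have : g z != 0.
    apply: He; rewrite zE nrmM nrmX; move: Hn; rewrite ltr_pdivlMr//; apply: le_lt_trans.
    by rewrite ler_wpM2l ?exprn_ge0 ?nrm_ge0// lerDl.
  by rewrite gz eqxx.
have key z : g z != 0 -> jk (Phi z) w0 = 0.
  (* Multiplying by [g (Phi z)] and [g (Phi w0)] lets [jk_p] replace both values of [Psi], and the
     zero [g w0] appears as a factor. *)
  move=> gz; have h1 : (Psi p * g z) * g (Phi w0) * jk (Phi z) w0 = 0.
    rewrite -jk_p.
    have -> : Psi z * g (Phi z) * g (Phi w0) * jk (Phi z) w0 = g (Phi z) * g (Phi w0) * (Psi z * jk (Phi z) w0) by ring.
    rewrite jk_W.
    have -> : g (Phi z) * g (Phi w0) * (Psi w0 * jk z (Phi w0)) = g (Phi z) * jk z (Phi w0) * (Psi w0 * g (Phi w0)) by ring.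
    by rewrite jk_p w00 !mulr0.
  apply/eqP; move/eqP: h1; rewrite !mulf_eq0 (negbTE Psi_p_neq0) (negbTE gz) (negbTE w01) /=.
  by [].
have ae : 0 < nrm a * e by rewrite mulr_gt0// nrm_gt0.
apply: (J_ker_neq0 (w := w0)); apply: (fock_ident al0 (p := p) ae) => y yp.
pose z := p + (y - p) / a.
have zy : Phi z = y by rewrite Phi_p /z; field.
rewrite -zy; apply: key; apply: He.
by rewrite /z addrAC subrr add0r nrmM nrmV ltr_pdivrMr ?nrm_gt0// mulrC.
Qed.

Lemma spec_symmetric_contraction :
  spectrum (@fock_dot R al) W = [set 0] `|` [set Psi p * a ^+ n | n in [set: nat]].
Proof.
have [h1 [h2 [h2al gE]]] := @zero_free_fock R al al0 (J (ker al0 p)) g_neq0.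
have {}gE z : g z = g 0 * cexp (h1 * z + h2 * z ^+ 2) := gE z.
(* A quarter of the gap left by [zero_free_fock]: it absorbs the linear term of the exponent and
   keeps [2 * c] below [al]. The constant [C] below serves both [g] and its inverse. *)
pose e := (al - 2 * nrm h2) / 4; have e0 : 0 < e by rewrite divr_gt0// subr_gt0.
pose c := nrm h2 + e.
pose K := expR (nrm h1 ^+ 2 / (4 * e)).
have Eb z : nrm (h1 * z + h2 * z ^+ 2) <= nrm h1 ^+ 2 / (4 * e) + c * nrm z ^+ 2.
  apply: le_trans (nrmD _ _) _; rewrite (nrmM h1) (nrmM h2) nrmX /c [(_ + e) * _]mulrDl.
  have := exp_lin_quad (nrm h1) (nrm z) e0; lra.
have Kb z (s : R[i]) : nrm s = 1 -> nrm (cexp (s * (h1 * z + h2 * z ^+ 2))) <= K * expR (c * nrm z ^+ 2).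
  move=> s1; apply: le_trans (cexp_le _) _; rewrite nrmM s1 mul1r -expRD ler_expR; exact: Eb.
pose C := (nrm (g 0) + (nrm (g 0))^-1) * K.
have g0 : 0 < nrm (g 0) by rewrite nrm_gt0 g_neq0.
have K0 : 0 < K by exact: expR_gt0.
have C0 : 0 <= C by rewrite mulr_ge0 ?addr_ge0 ?invr_ge0 ?ltW.
have cal : 2 * c < al by rewrite /c /e; lra.
have c_al : c <= al by rewrite /c /e; have := nrm_ge0 h2; lra.
apply: (@spec_contraction R al al0 Psi Phi a p (Psi p) W g Phi_p WE bW a0 a1 Psi_p_neq0 holo_g g_neq0 jk_p c C C0 cal).
- move=> z; rewrite gE nrmM -[X in cexp X]mul1r.
  have h := Kb z 1 nrm1; apply: le_trans (ler_wpM2l (nrm_ge0 _) h) _.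
  by rewrite mulrA ler_wpM2r ?expR_ge0// ler_wpM2r ?(ltW K0)// lerDl invr_ge0 ltW.
- move=> z; rewrite gE invfM -cexpN nrmM nrmV -mulN1r.
  have h : nrm (cexp (-1 * (h1 * z + h2 * z ^+ 2))) <= K * expR (al * nrm z ^+ 2).
    apply: le_trans (Kb z (-1) _) _; first by rewrite nrmN nrm1.
    by rewrite ler_wpM2l ?(ltW K0)// ler_expR ler_wpM2r ?sqr_ge0.
  have i0 : 0 <= (nrm (g 0))^-1 by rewrite invr_ge0 ltW.
  apply: le_trans (ler_wpM2l i0 h) _.
  by rewrite mulrA ler_wpM2r ?expR_ge0// ler_wpM2r ?(ltW K0)// lerDr ltW.
Qed.

End SymmetricContraction.

Theorem proposition5p4 (R : realType) (alpha : R) (halpha : 0 < alpha)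
    (Psi Phi : R[i] -> R[i]) (a d : R[i])
    (hPsi : entire Psi) (hPhi : entire Phi)
    (hPsi0 : exists z, Psi z <> 0)
    (hPhiE : forall z, Phi z = a * z + d) (ha : `|a| <= 1)
    (W : fock alpha -> fock alpha)
    (hW : is_weighted_composition Psi Phi W)
    (hWb : bounded_op (fock_dot alpha) W)
    (hWs : complex_symmetric (fock_dot alpha) W) :
  let p := d / (1 - a) in
  let orbit := [set Psi p * a ^+ n | n in [set: nat]] in
  [/\ a = 0 -> spectrum (fock_dot alpha) W = [set 0; Psi d],
      a = 1 -> d <> 0 ->
        spectrum (fock_dot alpha) W =
        [set Psi 0 * (expR (alpha * Normc.normc d ^+ 2 / 2))%:C * u
          | u in [set u : R[i] | `|u| = 1]],
      a = 1 -> d = 0 -> spectrum (fock_dot alpha) W = [set Psi 0],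
      `|a| = 1 -> a <> 1 ->
        spectrum (fock_dot alpha) W = closure (orbit : set R[i]^o) &
      0 < `|a| -> `|a| < 1 ->
        spectrum (fock_dot alpha) W = [set 0] `|` orbit].
Proof.
move=> p orbit.
have hP : holo Psi by apply/entireP.
have P0 : exists z, Psi z != 0 by have [z zP] := hPsi0; exists z; exact/eqP.
have [J [S [[J_lin JK _] [bS adj] W_sym]]] := hWs.
have WE f z : fv (W f) z = Psi z * fv f (Phi z) := hW f z.
split.
- by move=> a0; exact: (spec_constant halpha P0 hPhiE WE hWb a0).
- move=> a1 d0; have na1 : nrm a = 1 by rewrite a1 nrm1.
  have dn : d != 0 by apply/eqP.
  apply/seteqP; split=> [l sl|_ [u /normcE_nrm u1 <-]].
    have lr := spec_rho halpha hP P0 hPhiE WE hWb bS adj J_lin JK W_sym na1 sl.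
    (* [v] has modulus [rho], as does [l], so [l / v] is the required point of the unit circle. *)
    pose v := Psi 0 * (expR (alpha * nrm d ^+ 2 / 2))%:C.
    have v0 : v != 0.
      have := rho_gt0 halpha hP P0 hPhiE WE bS adj na1.
      rewrite -nrm_gt0 nrmM nrmR ger0_norm ?expR_ge0// /rho.
      by rewrite [alpha * _ / 2]mulrAC.
    exists (l / v); last by rewrite mulrC divfK.
    apply/normcE_nrm; rewrite nrmM nrmV lr nrmM nrmR ger0_norm ?expR_ge0// /rho.
    rewrite [alpha * _ / 2]mulrAC divff// gt_eqF//.
    exact: (rho_gt0 halpha hP P0 hPhiE WE bS adj na1).
  apply: (spec_translation halpha hP P0 hPhiE WE hWb bS adj J_lin JK W_sym na1 a1 dn).
  by rewrite !nrmM u1 mulr1 nrmR ger0_norm ?expR_ge0// /rho [alpha * _ / 2]mulrAC.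
- move=> a1 d0; have na1 : nrm a = 1 by rewrite a1 nrm1.
  exact: (spec_scalar halpha hP hPhiE WE bS adj na1 a1 d0).
- move=> /normcE_nrm na1 /eqP a1.
  apply/seteqP; split=> l.
    move=> /(spec_rotation halpha hP P0 hPhiE WE bS adj J_lin JK W_sym na1 a1) H.
    apply/closureP => e /H[k Hk]; exists (Psi p * a ^+ k) => //.
    by exists k.
  move=> /closureP H; apply/(spec_rotation halpha hP P0 hPhiE WE bS adj J_lin JK W_sym na1 a1) => e /H[_ [k _ <-] Hk].
  by exists k.
- move=> a0 a1.
  have a0' : a != 0 by rewrite -normr_gt0.
  have a1' : nrm a < 1 by rewrite -ltcR.
  exact: (spec_symmetric_contraction halpha hP P0 hPhiE WE hWb adj J_lin JK W_sym a0' a1').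
Qed.
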